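(* Let $(M,j)$ be a complex manifold of complex dimension $m$. Then integrable $(\lambda,\ell)$-structures or integrable $(1,1;n)$-structures on $(M,j)$ are smooth sections of a fiber bundle over $M$ with typical fiber $G/H$, according to the following list (with $m=2k$ in the case $\lambda=\ell=-1$): - $\lambda=1$, $\ell=1$, signature $n$ (that is, $(1,1;n)$-structures): $G=O(2m,\mathbb C)$, $H=O(n,2m-n)$; - $\lambda=1$, $\ell=-1$: $G=U(m,m)$, $H=Sp(m,\mathbb R)$; - $\lambda=-1$, $\ell=1$: $G=O(2m,\mathbb C)$, $H=SO^*(2m)$; - $\lambda=-1$, $\ell=-1$: $G=U(2k,2k)$, $H=Sp(k,k)$.
   Context: All objects are $C^\infty$. For a smooth manifold $M$ put $\mathbb{T}M=TM\oplus T^*M$, with the split pseudo-Riemannian structure $b(u+\sigma,v+\tau)=\tau(u)+\sigma(v)$ and the Courant bracket $[u+\sigma,v+\tau]=[u,v]+\mathcal L_u\tau-\mathcal L_v\sigma-\tfrac12 d(\tau(u)-\sigma(v))$. A real linear isomorphism $S$ with $S^2=\lambda\,\mathrm{id}$, $\lambda=\pm1$, is called split if it has exactly two eigenspaces (in the complexification if $\lambda=-1$), of the same dimension (automatic if $\lambda=-1$). Let $S$ be a smooth section of $\mathrm{End}(\mathbb{T}M)$ with $S^2=\lambda\,\mathrm{id}$, $S$ split and skew-symmetric for $b$. $S$ is a generalized complex structure (if $\lambda=-1$), respectively generalized paracomplex structure (if $\lambda=1$), if the smooth sections of each of the $\pm\sqrt\lambda$-eigenbundles of $S$ are closed under the Courant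 bracket (extended $\mathbb C$-bilinearly to the complexification when $\lambda=-1$). For a complex manifold $(M,j)$ and $\ell=\pm1$ let $J_\ell=\begin{pmatrix} j&0\\0&\ell j^*\end{pmatrix}$ on $\mathbb{T}M$; write $J_+=J_1$. For $\lambda=\pm1$, $\ell=\pm1$, an integrable $(\lambda,\ell)$-structure on $(M,j)$ is a generalized complex ($\lambda=-1$) or generalized paracomplex ($\lambda=1$) structure $S$ on $M$ with $SJ_\ell=-J_\ell S$. For an integrable $(1,1)$-structure $S$, the form $\beta_S(x,y)=b(SJ_+x,y)$ on $\mathbb{T}M$ is symmetric; $S$ is called an integrable $(1,1;n)$-structure if $\beta_S$ has signature $(2n,4m-2n)$ ($2n$ positive, $4m-2n$ negative), where $m=\dim_{\mathbb C}M$ and $0\le n\le 2m$. Groups: $Sp(m,\mathbb R)$ is the automorphism group of a nondegenerate skew-symmetric form on $\mathbb R^{2m}$; $SO^*(2m)$ is the automorphism group of a (nondegenerate) anti-Hermitian form on $\mathbb H^m$; $Sp(k,k)$ is the automorphism group of a split Hermitian form (signature $(k,k)$) on $\mathbb H^{2k}$; $U(p,q)$, $O(p,q)$, $O(2m,\mathbb C)$ are the usual groups. *)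

(* Defs.v *)
From HB Require Import structures.
From mathcomp Require Import all_boot all_order all_algebra.
From mathcomp Require Import all_classical all_reals all_analysis.
From mathcomp Require Import complex.

Set Implicit Arguments.
Unset Strict Implicit.
Unset Printing Implicit Defensive.

Import Order.TTheory GRing.Theory Num.Theory.
Import numFieldNormedType.Exports.

Local Open Scope classical_set_scope.
Local Open Scope ring_scope.
Local Open Scope complex_scope.

(** * Smooth maps and smooth manifolds *)

(* Only used for V finite-dimensional and U open, where asking all directional
   derivatives of a differentiable map to be C^k is the usual C^(k+1). *)
Fixpoint Ck (R : realType) (V W : normedModType R) (k : nat) (U : set V)
    (f : V -> W) : Prop :=
  if k is k'.+1 then
    (forall x, U x -> differentiable f x) /\ (forall v, Ck k' U ('D_v f))
  else forall x, U x -> {for x, continuous f}.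

Definition smooth_on (R : realType) (V W : normedModType R) (U : set V)
    (f : V -> W) : Prop := forall k, Ck k U f.

(* The maps chart and chartV are total; their values outside dom i and outside
   chart i @` dom i are junk. *)
Record smoothManifold (R : realType) (n : nat) := SmoothManifold {
  points :> topologicalType;
  points_hausdorff : hausdorff_space points;
  points_second_countable : @second_countable points;
  idx : Type;
  dom : idx -> set points;
  chart : idx -> points -> 'rV[R]_n;
  chartV : idx -> 'rV[R]_n -> points;
  dom_open : forall i, open (dom i);
  dom_cover : forall p, exists i, dom i p;
  chart_open : forall i, open (chart i @` dom i);
  chartK : forall i p, dom i p -> chartV i (chart i p) = p;
  chart_continuous : forall i p, dom i p -> {for p, continuous (chart i)};
  chartV_continuous : forall i p, dom i p ->
    {for chart i p, continuous (chartV i)};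
  chart_smooth : forall i j,
    smooth_on (chart i @` (dom i `&` dom j)) (chart j \o chartV i)
}.

Arguments idx {R n} M : rename.
Arguments dom {R n} {M} i : rename.
Arguments chart {R n} {M} i : rename.
Arguments chartV {R n} {M} i : rename.

(* Smoothness of a map from an open set of a vector space to a manifold, from an
   open set of a manifold to a vector space, between manifolds, and (the last
   one) from an open set U x F of a product of two manifolds to a manifold. *)
Definition smooth_into (R : realType) (V : normedModType R) (n : nat)
    (Q : smoothManifold R n) (U : set V) (f : V -> Q) : Prop :=
  (forall x, U x -> {for x, continuous f}) /\
  (forall j : idx Q, smooth_on (U `&` f @^-1` dom j) (chart j \o f)).

Definition smooth_from (R : realType) (n : nat) (M : smoothManifold R n)
    (V : normedModType R) (U : set M) (f : M -> V) : Prop :=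
  forall i : idx M, smooth_on (chart i @` (U `&` dom i)) (f \o chartV i).

Definition smooth_map (R : realType) (n1 n2 : nat) (M : smoothManifold R n1)
    (Q : smoothManifold R n2) (U : set M) (f : M -> Q) : Prop :=
  forall i : idx M, smooth_into (chart i @` (U `&` dom i)) (f \o chartV i).

Definition smooth_map2 (R : realType) (n1 n2 n3 : nat)
    (M : smoothManifold R n1) (F : smoothManifold R n2)
    (Q : smoothManifold R n3) (U : set M) (f : M -> F -> Q) : Prop :=
  forall (i : idx M) (a : idx F),
    smooth_into ((chart i @` (U `&` dom i)) `*` (chart a @` dom a))
      (fun z => f (chartV i z.1) (chartV a z.2)).

Definition fiber_bundle (R : realType) (e n f : nat) (E : smoothManifold R e)
    (M : smoothManifold R n) (F : smoothManifold R f) (pr : E -> M) : Prop :=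
  smooth_map setT pr /\
  forall p : M, exists (U : set M) (phi : E -> F) (psi : M -> F -> E),
    [/\ open U /\ U p,
        smooth_map (pr @^-1` U) phi,
        smooth_map2 U psi,
        forall x y, U x -> pr (psi x y) = x /\ phi (psi x y) = y &
        forall z, U (pr z) -> psi (pr z) (phi z) = z].

Definition smooth_section (R : realType) (e n : nat) (E : smoothManifold R e)
    (M : smoothManifold R n) (pr : E -> M) (s : M -> E) : Prop :=
  smooth_map setT s /\ forall p, pr (s p) = p.

(** * Linear algebra *)

Section Linear.
Variable R : realType.

Definition cplx_mx (a b : nat) (z : 'M[R]_(a, b) * 'M[R]_(a, b)) :
    'M[R[i]]_(a, b) :=
  \matrix_(i, j) (z.1 i j +i* z.2 i j).
Definition Re_mx (a b : nat) (g : 'M[R[i]]_(a, b)) : 'M[R]_(a, b) :=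
  map_mx (@complex.Re R) g.
Definition Im_mx (a b : nat) (g : 'M[R[i]]_(a, b)) : 'M[R]_(a, b) :=
  map_mx (@complex.Im R) g.
Definition conj_mx (a b : nat) (g : 'M[R[i]]_(a, b)) : 'M[R[i]]_(a, b) :=
  map_mx (@conjc R) g.

Definition complexify (a b : nat) (A : 'M[R]_(a, b)) : 'M[R[i]]_(a, b) :=
  map_mx (real_complex R) A.

(* Linear maps act on row vectors from the right, as in mathcomp; eigenvalue and
   eigenspace follow that convention as well. *)
Definition two_eigenspaces_same_dim (F : fieldType) (N : nat) (A : 'M[F]_N) :
    Prop :=
  exists a b, [/\ a != b,
    forall c, eigenvalue A c = (c \in [:: a; b]) &
    \rank (eigenspace A a) = \rank (eigenspace A b)].

Definition split_op (lam : R) (N : nat) (A : 'M[R]_N) : Prop :=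
  if lam == 1 then two_eigenspaces_same_dim A
  else two_eigenspaces_same_dim (complexify A).

Definition sig_mx (K : pzRingType) (p N : nat) : 'M[K]_N :=
  diag_mx (\row_(i < N) (if (i < p)%N then 1 else -1)).

Definition has_signature (N : nat) (B : 'M[R]_N) (p q : nat) : Prop :=
  (p + q)%N = N /\
  exists2 P : 'M[R]_N, P \in unitmx & P *m B *m P^T = sig_mx R p N.

(** * The Lie groups, and the embeddings of H in G

   Each H is embedded in G by extending its defining form to the complex vector
   space on which G acts and then passing to a basis adapted to the form of
   G. *)

Definition O_C (N : nat) : set 'M[R[i]]_N := [set g | g^T *m g = 1%:M].

Arguments O_C N : clear implicits.

Definition U_pq (p N : nat) : set 'M[R[i]]_N :=
  [set g | (conj_mx g)^T *m sig_mx R[i] p N *m g = sig_mx R[i] p N].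

Arguments U_pq p N : clear implicits.

Definition O_pq (p N : nat) : set 'M[R]_N :=
  [set A | A^T *m sig_mx R p N *m A = sig_mx R p N].

Arguments O_pq p N : clear implicits.

Definition Omega (m : nat) : 'M[R]_(m + m) := block_mx 0 1%:M (- 1%:M) 0.

Definition Sp_R (m : nat) : set 'M[R]_(m + m) :=
  [set A | A^T *m Omega m *m A = Omega m].

Arguments Sp_R m : clear implicits.

(* The pair (A, B) stands for the quaternionic matrix A + B j, with A and B
   complex; j A = conj(A) j. *)
Definition qmx (N : nat) : Type := ('M[R[i]]_N * 'M[R[i]]_N)%type.
Definition qmul (N : nat) (X Y : qmx N) : qmx N :=
  (X.1 *m Y.1 - X.2 *m conj_mx Y.2, X.1 *m Y.2 + X.2 *m conj_mx Y.1).
Definition qadj (N : nat) (X : qmx N) : qmx N :=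
  ((conj_mx X.1)^T, - X.2^T).

Definition SO_star (m : nat) : set (qmx m) :=
  [set X | qmul (qmul (qadj X) (0, 1%:M)) X = (0, 1%:M)].

Arguments SO_star m : clear implicits.

Definition Sp_kk (k : nat) : set (qmx (k + k)) :=
  [set X | qmul (qmul (qadj X) (sig_mx R[i] k (k + k), 0)) X
           = (sig_mx R[i] k (k + k), 0)].

Arguments Sp_kk k : clear implicits.

Definition qmx_cplx (N : nat) (X : qmx N) : 'M[R[i]]_(N + N) :=
  block_mx X.1 X.2 (- conj_mx X.2) (conj_mx X.1).

Definition conj_by (N : nat) (C : 'M[R[i]]_N) (g : 'M[R[i]]_N) : 'M[R[i]]_N :=
  C *m g *m invmx C.

Definition O_pq_in_O_C (p N : nat) : set 'M[R[i]]_N :=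
  let C := diag_mx (\row_(i < N) (if (i < p)%N then 1 else 'i : R[i])) in
  [set conj_by C (complexify A) | A in O_pq p N].

(* The Cayley matrix carries the Hermitian form i * Omega to sig_mx m, up to a
   positive factor. *)
Definition Sp_R_in_U (m : nat) : set 'M[R[i]]_(m + m) :=
  let C := block_mx 1%:M 'i%:M 1%:M (- 'i%:M) in
  [set conj_by C (complexify A) | A in Sp_R m].

(* Since g Omega = Omega conj(g) for g in the image of qmx_cplx, the
   equation defining SO_star says exactly that g^T g = 1. *)
Definition SO_star_in_O_C (m : nat) : set 'M[R[i]]_(m + m) :=
  [set qmx_cplx X | X in SO_star m].

(* The Hermitian form attached to Sp_kk is diag(1, -1, 1, -1) in k x k blocks;
   C exchanges the two middle blocks. *)
Definition Sp_kk_in_U (k : nat) : set 'M[R[i]]_((k + k) + (k + k)) :=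
  let C := block_mx (block_mx 1%:M 0 0 0) (block_mx 0 0 1%:M 0)
                    (block_mx 0 1%:M 0 0) (block_mx 0 0 0 1%:M) in
  [set conj_by C (qmx_cplx X) | X in Sp_kk k].

End Linear.

Arguments O_C R N : clear implicits.
Arguments U_pq R p N : clear implicits.
Arguments O_pq_in_O_C R p N : clear implicits.
Arguments Sp_R_in_U R m : clear implicits.
Arguments SO_star_in_O_C R m : clear implicits.
Arguments Sp_kk_in_U R k : clear implicits.

(* Q is the quotient manifold G/H of left cosets, with q g = gH: the smooth
   structure on G/H is the one for which q is a smooth submersion, i.e. q is
   smooth and has smooth local sections through all points of G.  Smoothness on
   the matrix group G is by local extension to the ambient real vector space of
   pairs (real part, imaginary part). *)
Definition homogeneous_space (R : realType) (N d : nat)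
    (G H : set 'M[R[i]]_N) (Q : smoothManifold R d) (q : 'M[R[i]]_N -> Q) :
    Prop :=
  [/\ forall y, exists2 g, G g & q g = y,
      forall g h, G g -> G h -> (q g = q h <-> H (invmx g *m h)),
      forall g, G g ->
        exists (W : set ('M[R]_N * 'M[R]_N)) (f : 'M[R]_N * 'M[R]_N -> Q),
          [/\ open W, W (Re_mx g, Im_mx g), smooth_into W f &
              forall z, W z -> G (cplx_mx z) -> f z = q (cplx_mx z)] &
      forall g, G g ->
        exists (O : set Q) (s : Q -> 'M[R]_N * 'M[R]_N),
          [/\ open O /\ O (q g), smooth_from O s, cplx_mx (s (q g)) = g &
              forall y, O y -> G (cplx_mx (s y)) /\ q (cplx_mx (s y)) = y]].

(** * The generalized tangent bundle TM + T*M

   A row vector of length n + n stands for u + sigma, where u and sigma are the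
   components of the vector and of the covector in a chart.  Tensors at a point
   p are families of components indexed by the charts around p, related by the
   usual transformation law; components at points outside the domain of the
   chart are junk. *)

Section GeneralizedTangent.
Variables (R : realType) (n : nat).

Definition pairing (sigma u : 'rV[R]_n) : R := \sum_(k < n) sigma 0 k * u 0 k.

Definition lie_bracket (u v : 'rV[R]_n -> 'rV[R]_n) (a : 'rV[R]_n) : 'rV[R]_n :=
  'D_(u a) v a - 'D_(v a) u a.

Definition lie_derivative (u tau : 'rV[R]_n -> 'rV[R]_n) (a : 'rV[R]_n) :
    'rV[R]_n :=
  'D_(u a) tau a + \row_k pairing (tau a) ('D_(delta_mx 0 k) u a).

Definition ext_d (f : 'rV[R]_n -> R) (a : 'rV[R]_n) : 'rV[R]_n :=
  \row_k 'D_(delta_mx 0 k) f a.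

Definition courant_loc (x y : 'rV[R]_n -> 'rV[R]_(n + n)) (a : 'rV[R]_n) :
    'rV[R]_(n + n) :=
  let u := lsubmx \o x in let sigma := rsubmx \o x in
  let v := lsubmx \o y in let tau := rsubmx \o y in
  row_mx (lie_bracket u v a)
    (lie_derivative u tau a - lie_derivative v sigma a
     - 2^-1 *: ext_d (fun c => pairing (tau c) (u c) - pairing (sigma c) (v c)) a).

Definition b_mx : 'M[R]_(n + n) := block_mx 0 1%:M 1%:M 0.
Definition b_form (x y : 'rV[R]_(n + n)) : R := (x *m b_mx *m y^T) 0 0.

Definition skew_op (A : 'M[R]_(n + n)) : Prop :=
  forall x y, b_form (x *m A) y = - b_form x (y *m A).

Variable M : smoothManifold R n.

Definition trans_jac (i j : idx M) (p : M) : 'M[R]_n :=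
  jacobian (chart j \o chartV i) (chart i p).

(* The components of a covector transform by the transpose of the inverse
   Jacobian. *)
Definition trans_TT (i j : idx M) (p : M) : 'M[R]_(n + n) :=
  block_mx (trans_jac i j p) 0 0 (invmx (trans_jac i j p))^T.

Definition tensor_TT : Type := idx M -> M -> 'rV[R]_(n + n).
Definition tensor_TTC : Type := idx M -> M -> 'rV[R[i]]_(n + n).
Definition tensor_End : Type := idx M -> M -> 'M[R]_(n + n).

Definition section_TT (X : tensor_TT) : Prop :=
  (forall i j p, dom i p -> dom j p -> X j p = X i p *m trans_TT i j p) /\
  (forall i, smooth_from (dom i) (X i)).

Definition Re_TT (Z : tensor_TTC) : tensor_TT := fun i p => Re_mx (Z i p).
Definition Im_TT (Z : tensor_TTC) : tensor_TT := fun i p => Im_mx (Z i p).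

Definition section_TTC (Z : tensor_TTC) : Prop :=
  section_TT (Re_TT Z) /\ section_TT (Im_TT Z).

Definition endo_at (p : M) (A : idx M -> 'M[R]_(n + n)) : Prop :=
  forall i j, dom i p -> dom j p ->
    A i *m trans_TT i j p = trans_TT i j p *m A j.

Definition section_End (S : tensor_End) : Prop :=
  (forall p, endo_at p (S^~ p)) /\ (forall i, smooth_from (dom i) (S i)).

Definition courant (X Y : tensor_TT) : tensor_TT := fun i p =>
  courant_loc (X i \o chartV i) (Y i \o chartV i) (chart i p).

Definition courantC (Z W : tensor_TTC) : tensor_TTC := fun i p => cplx_mx
  (courant (Re_TT Z) (Re_TT W) i p - courant (Im_TT Z) (Im_TT W) i p,
   courant (Re_TT Z) (Im_TT W) i p + courant (Im_TT Z) (Re_TT W) i p).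

Definition eigensection (S : tensor_End) (c : R) (X : tensor_TT) : Prop :=
  forall i p, dom i p -> X i p *m S i p = c *: X i p.

Definition eigensectionC (S : tensor_End) (c : R[i]) (Z : tensor_TTC) : Prop :=
  forall i p, dom i p -> Z i p *m complexify (S i p) = c *: Z i p.

Definition involutive_eigenbundle (S : tensor_End) (c : R) : Prop :=
  forall X Y, section_TT X -> section_TT Y ->
    eigensection S c X -> eigensection S c Y -> eigensection S c (courant X Y).

Definition involutive_eigenbundleC (S : tensor_End) (c : R[i]) : Prop :=
  forall Z W, section_TTC Z -> section_TTC W ->
    eigensectionC S c Z -> eigensectionC S c W ->
    eigensectionC S c (courantC Z W).

Definition integrable (lam : R) (S : tensor_End) : Prop :=
  if lam == 1 then involutive_eigenbundle S 1 /\ involutive_eigenbundle S (-1)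
  else involutive_eigenbundleC S 'i /\
       involutive_eigenbundleC S (- 'i).

Definition gen_structure_op (lam : R) (A : 'M[R]_(n + n)) : Prop :=
  [/\ A *m A = lam%:M, split_op lam A & skew_op A].

(* Generalized complex (lam = -1) or paracomplex (lam = 1) structures. *)
Definition gen_structure (lam : R) (S : tensor_End) : Prop :=
  [/\ section_End S,
      forall i p, dom i p -> gen_structure_op lam (S i p) &
      integrable lam S].

(* E, with projection pr, is the subbundle of End(TM + T*M) cut out by the
   condition P: every e in E is an endomorphism ev e of the generalized tangent
   space at pr e; ev is a bijection onto the endomorphisms with P, it is smooth,
   and its inverse is smooth (i.e. locally extends to a smooth map). *)
Definition subbundle_End (P : 'M[R]_(n + n) -> Prop) (d : nat)
    (E : smoothManifold R d) (pr : E -> M)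
    (ev : E -> idx M -> 'M[R]_(n + n)) : Prop :=
  [/\ forall e, endo_at (pr e) (ev e) /\
        forall i, dom i (pr e) -> P (ev e i),
      forall e e', pr e = pr e' ->
        (forall i, dom i (pr e) -> ev e i = ev e' i) -> e = e',
      forall p A, endo_at p A -> (forall i, dom i p -> P (A i)) ->
        exists2 e, pr e = p & forall i, dom i p -> ev e i = A i,
      forall i, smooth_from (pr @^-1` dom i) (fun e => ev e i) &
      forall e i, dom i (pr e) ->
        exists (W : set ('rV[R]_n * 'M[R]_(n + n)))
               (r : 'rV[R]_n * 'M[R]_(n + n) -> E),
          [/\ open W, W (chart i (pr e), ev e i), smooth_into W r &
              forall e', dom i (pr e') -> W (chart i (pr e'), ev e' i) ->
                r (chart i (pr e'), ev e' i) = e']].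

(* The structures in the class I, whose values satisfy P pointwise, are smooth
   sections of a fiber bundle over M with typical fiber G/H, namely the bundle
   of all endomorphisms of TM + T*M that satisfy P. *)
Definition sections_of_bundle (I : tensor_End -> Prop)
    (P : 'M[R]_(n + n) -> Prop) (N : nat) (G H : set 'M[R[i]]_N) : Prop :=
  exists (d : nat) (Q : smoothManifold R d) (q : 'M[R[i]]_N -> Q)
         (e : nat) (E : smoothManifold R e) (pr : E -> M)
         (ev : E -> idx M -> 'M[R]_(n + n)),
    [/\ homogeneous_space G H q,
        fiber_bundle Q pr,
        subbundle_End P pr ev &
        forall S, I S -> exists2 s : M -> E, smooth_section pr s &
          forall i p, dom i p -> ev (s p) i = S i p].

End GeneralizedTangent.

(** * Complex manifolds and integrable structures on them *)

(* Multiplication by i on C^m = R^m + R^m: (x, y) is sent to (-y, x). *)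
Definition j_std (R : realType) (m : nat) : 'M[R]_(m + m) :=
  block_mx 0 1%:M (- 1%:M) 0.

(* The complex structure j is the tensor with components j_std in every chart;
   the condition is the system of Cauchy-Riemann equations. *)
Record complexManifold (R : realType) (m : nat) := ComplexManifold {
  underlying :> smoothManifold R (m + m);
  holomorphic_charts : forall (i j : idx underlying) (p : underlying),
    dom i p -> dom j p ->
    j_std R m *m trans_jac i j p = trans_jac i j p *m j_std R m
}.

Section ComplexStructures.
Variables (R : realType) (m : nat).

(* (j^* sigma)(u) = sigma (j u), hence the transpose. *)
Definition J_ell (ell : R) : 'M[R]_((m + m) + (m + m)) :=
  block_mx (j_std R m) 0 0 (ell *: (j_std R m)^T).

Definition anticommute_J (ell : R) (A : 'M[R]_((m + m) + (m + m))) : Prop :=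
  J_ell ell *m A = - (A *m J_ell ell).

(* The matrix of the form beta_S (x, y) = b (S J_+ x, y), when A is S. *)
Definition beta_mx (A : 'M[R]_((m + m) + (m + m))) :
    'M[R]_((m + m) + (m + m)) :=
  J_ell 1 *m A *m b_mx R (m + m).

Definition beta_signature (n : nat) (A : 'M[R]_((m + m) + (m + m))) : Prop :=
  has_signature (beta_mx A) (2 * n) (4 * m - 2 * n).

Definition lambda_ell_op (lam ell : R) (A : 'M[R]_((m + m) + (m + m))) : Prop :=
  gen_structure_op lam A /\ anticommute_J ell A.

Definition one_one_op (n : nat) (A : 'M[R]_((m + m) + (m + m))) : Prop :=
  lambda_ell_op 1 1 A /\ beta_signature n A.

Variable M : complexManifold R m.

Definition integrable_lambda_ell (lam ell : R) (S : tensor_End M) : Prop :=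
  gen_structure lam S /\
  forall i p, dom i p -> anticommute_J ell (S i p).

Definition integrable_one_one (n : nat) (S : tensor_End M) : Prop :=
  integrable_lambda_ell 1 1 S /\
  forall i p, dom i p -> beta_signature n (S i p).

End ComplexStructures.

Arguments lambda_ell_op {R m} lam ell A.
Arguments one_one_op {R m} n A.
Arguments integrable_lambda_ell {R m} M lam ell S.
Arguments integrable_one_one {R m} M n S.

(* Main.v *)
(* Let L be the group of the b-isometries of TM + T*M that commute with J_ell.
   Since J_ell is symmetric for b when ell = 1 and skew when ell = -1, b is the
   real part of a complex bilinear, respectively Hermitian, form, so L is
   O(2m, C), respectively U(m, m).  The endomorphisms that satisfy the pointwise
   conditions form a single L-orbit: for each of them the space is an orthogonal
   sum of small invariant cells on which J, S and b have a normal form, and two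
   decompositions are matched by counting signs, with Sylvester's law of inertia
   for beta_S in the (1,1;n) case and for b in the case lambda = ell = -1.

   The orbit of S0 is a manifold on which L acts with smooth local sections: the
   Cayley transform Y = (S - S0)(S + S0)^-1 is a chart, and S = g S0 g^-1 with
   g = (1 - Y^2)^(-1/2) (1 + Y) in L.  Holomorphic transition functions act on
   TM + T*M through L, so the orbits over the points of M glue to a bundle.  The
   stabilizer of S0 is the real form of L cut out by an antilinear map, which is
   identified with H in a frame adapted to S0. *)
Require Import Defs.
From HB Require Import structures.
From mathcomp Require Import all_boot all_order all_algebra.
From mathcomp Require Import all_classical all_reals all_analysis.
From mathcomp Require Import complex ring lra.

Set Implicit Arguments.
Unset Strict Implicit.
Unset Printing Implicit Defensive.

Import Order.TTheory GRing.Theory Num.Theory.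
Import numFieldNormedType.Exports.

Local Open Scope classical_set_scope.
Local Open Scope ring_scope.

(** * Calculus of smooth maps at a point *)

Section Smooth.
Variable R : realType.
Implicit Types U V W : normedModType R.

(** [G/H] is not formed as an abstract quotient: the orbit, a set of real matrices, is itself the
    manifold, and [g] is sent to [g S0 g^-1]. Since smoothness on matrix groups and on bundles of
    endomorphisms is stated by local extension to an ambient vector space, every chart of the orbit
    is a smooth map on an open set of matrices; following it by its parametrization gives a local
    retraction onto the orbit, which supplies the required extensions. No implicit function theorem
    intervenes, because the tangent conditions at [S0] are linear and the Cayley transform is
    rational; only the square root in the lift to the group needs analysis. Its uniqueness,
    smoothness, commutation and adjointness properties all come from one estimate, the injectivity
    of [D |-> X D + D X] for [X] near 1. In a complex frame an operator anticommuting with [J] is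
    antilinear, [x |-> conj(x) K] on row vectors with [K = P + i Q], so that each of the four cases
    amounts to a choice of [K], and the stabilizer of the standard operator is given by
    [conj(g) K = K g]. *)

Fixpoint ck_at V W (k : nat) (f : V -> W) (x : V) : Prop :=
  if k is k'.+1 then
    (\forall y \near x, differentiable f y) /\ forall v, ck_at k' ('D_v f) x
  else \forall y \near x, {for y, continuous f}.

(** The neighbourhood is chosen before [k]. With the order reversed the neighbourhoods could shrink
    as [k] grows, whereas in this form smoothness is an open condition and passes to nearby
    points. *)
Definition smooth_at V W (f : V -> W) (x : V) : Prop :=
  \forall y \near x, forall k, ck_at k f y.

Lemma Ck_point V W k (f : V -> W) (A : set V) :
  (forall x, A x -> ck_at k f x) -> Ck k A f.
Proof.
elim: k f => [|k IH] f h /=.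
  by move=> x /h; apply: nbhs_singleton.
split=> [x /h[/nbhs_singleton]//|v].
by apply: IH => x /h [_]; apply.
Qed.

Lemma Ck_open V W k (f : V -> W) (A : set V) x :
  open A -> Ck k A f -> A x -> ck_at k f x.
Proof.
move=> oA; elim: k f => [|k IH] f /=.
  move=> h Ax; have : nbhs x A by apply: open_nbhs_nbhs.
  by apply: filterS => y; apply: h.
move=> [h1 h2] Ax; split; last by move=> v; apply: IH.
have : nbhs x A by apply: open_nbhs_nbhs.
by apply: filterS => y; apply: h1.
Qed.

Lemma smooth_onP V W (f : V -> W) (A : set V) :
  open A -> smooth_on A f <-> forall x, A x -> smooth_at f x.
Proof.
move=> oA; split=> [h x Ax|h k].
  have : nbhs x A by apply: open_nbhs_nbhs.
  by apply: filterS => y Ay k; apply: Ck_open Ay.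
by apply: Ck_point => x /h /nbhs_singleton; apply.
Qed.

Lemma smooth_on_at V W (f : V -> W) (A : set V) :
  (forall x, A x -> smooth_at f x) -> smooth_on A f.
Proof. by move=> h k; apply: Ck_point => x /h /nbhs_singleton; apply. Qed.

Lemma differentiable_estimate V W (f : V -> W) (L : {linear V -> W}) x :
  continuous L ->
  (forall e, 0 < e -> \forall h \near 0, `|f (h + x) - f x - L h| <= e * `|h|) ->
  is_diff x f L.
Proof.
move=> cL h.
have e : f \o shift x = cst (f x) + L +o_ 0 id.
  apply/eqaddoP => _/posnumP[e].
  apply: filterS (h _ (gt0 e)) => y.
  by rewrite !fctE /= opprD addrA.
have dL : 'd f x = L :> (V -> W) by exact: diff_unique.
by apply: DiffDef => //; apply/diff_locallyP; rewrite dL.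
Qed.

Lemma differentiable_near V W (f g : V -> W) x :
  (\near x, f x = g x) -> differentiable f x -> differentiable g x.
Proof.
move=> fg df; have [c e] := (diff_locallyP x f).1 df.
suff : is_diff x g ('d f x) by case.
apply: differentiable_estimate => // d d0.
have /eqaddoP/(_ _ d0) := e.
have fg0 : \forall h \near (0 : V), f (h + x) = g (h + x).
  by move: fg; rewrite (near_shift 0) subr0.
apply: filterS2 fg0 => y /= <-.
by rewrite !fctE /= (nbhs_singleton fg) opprD addrA.
Qed.

Lemma ck_at_near V W k (f g : V -> W) x :
  (\near x, f x = g x) -> ck_at k f x -> ck_at k g x.
Proof.
elim: k f g => [|k IH] f g fg /=.
  have := near_join fg; apply: filterS2 => y fgy.
  move=> h; suff : g z @[z --> y] --> g y by [].
  rewrite -(nbhs_singleton fgy); exact: cvg_trans (near_eq_cvg fgy) h.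
move=> [d h]; split.
  by have := near_join fg; apply: filterS2 d => y dfy fgy; exact: differentiable_near dfy.
move=> v; apply: IH (h v).
by have := near_join fg; apply: filterS => y; exact: near_eq_derive.
Qed.

Lemma smooth_at_near V W (f g : V -> W) x :
  (\near x, f x = g x) -> smooth_at f x -> smooth_at g x.
Proof.
move=> fg; have := near_join fg; apply: filterS2 => y fgy h k.
exact: ck_at_near (h k).
Qed.

Lemma smooth_at_ext V W (f g : V -> W) x :
  f =1 g -> smooth_at f x -> smooth_at g x.
Proof. by move=> /funext ->. Qed.

Lemma ck_at_continuous V W k (f : V -> W) x : ck_at k f x ->
  \forall y \near x, {for y, continuous f}.
Proof.
case: k => // k [+ _]; apply: filterS => y; exact: differentiable_continuous.
Qed.

Lemma smooth_at_continuous V W (f : V -> W) x : smooth_at f x ->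
  {for x, continuous f}.
Proof. by move=> /nbhs_singleton/(_ 0%N)/nbhs_singleton. Qed.

Lemma ck_atW V W k (f : V -> W) x : ck_at k.+1 f x -> ck_at k f x.
Proof.
elim: k f => [|k IH] f; first exact: ck_at_continuous.
by move=> [d h]; split=> // v; apply: IH; apply: h.
Qed.

Lemma ck_at_derive V W k (f : V -> W) v x :
  ck_at k.+1 f x -> ck_at k ('D_v f) x.
Proof. by case=> _; apply. Qed.

Lemma smooth_at_derive V W (f : V -> W) v x :
  smooth_at f x -> smooth_at ('D_v f) x.
Proof. by apply: filterS => y h k; apply: ck_at_derive. Qed.

Lemma smooth_at_differentiable V W (f : V -> W) x :
  smooth_at f x -> differentiable f x.
Proof. by move=> /nbhs_singleton/(_ 1%N)[/nbhs_singleton]. Qed.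

Lemma ck_at_cst V W k (c : W) x : ck_at k (fun _ : V => c) x.
Proof.
elim: k c => [|k IH] c /=; first by apply: nearW => y; exact: cvg_cst.
split=> [|v]; first by apply: nearW => y; exact: differentiable_cst.
rewrite (_ : 'D_v _ = fun=> 0) //.
by apply/funext => y; rewrite derive_cst.
Qed.

Lemma smooth_at_cst V W (c : W) x : smooth_at (fun _ : V => c) x.
Proof. by apply: nearW => y k; exact: ck_at_cst. Qed.

Lemma ck_atD V W k (f g : V -> W) x :
  ck_at k f x -> ck_at k g x -> ck_at k (f \+ g) x.
Proof.
elim: k f g => [|k IH] f g /=.
  by apply: filterS2 => y cf cg; exact: cvgD.
move=> [df hf] [dg hg]; split.
  by apply: filterS2 df dg => y; exact: differentiableD.
move=> v; have := IH _ _ (hf v) (hg v).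
apply: ck_at_near; apply: filterS2 df dg => y df dg.
by rewrite deriveD //; exact: diff_derivable.
Qed.

Lemma ck_at_lin V W W' k (l : {linear W -> W'}) (f : V -> W) x :
  continuous l -> ck_at k f x -> ck_at k (l \o f) x.
Proof.
move=> cl; elim: k f => [|k IH] f /=.
  by apply: filterS => y cf; apply: continuous_comp => //; exact: cl.
move=> [df hf].
have dl y : differentiable l y by exact: linear_differentiable.
split; first by apply: filterS df => y df; exact: differentiable_comp.
move=> v; have := IH _ (hf v).
apply: ck_at_near; apply: filterS df => y df.
rewrite deriveE; last exact: differentiable_comp.
by rewrite diff_comp //= diff_lin // -deriveE.
Qed.

Lemma smooth_atD V W (f g : V -> W) x :
  smooth_at f x -> smooth_at g x -> smooth_at (fun y => f y + g y) x.
Proof. by apply: filterS2 => y hf hg k; apply: ck_atD. Qed.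

Lemma smooth_at_lin V W W' (l : {linear W -> W'}) (f : V -> W) x :
  continuous l -> smooth_at f x -> smooth_at (fun y => l (f y)) x.
Proof. by move=> cl; apply: filterS => y hf k; apply: ck_at_lin. Qed.

Lemma scale_is_bilinear W :
  bilinear_for
    (GRing.Scale.Law.clone _ _ *:%R _) (GRing.Scale.Law.clone _ _ *:%R _)
    (fun (c : R) (w : W) => c *: w).
Proof.
split=> [u'|u] a x y /=; first by rewrite scalerDl scalerA.
by rewrite scalerDr !scalerA mulrC.
Qed.

(** A named copy of scaling on which a bilinear structure can be declared, so that the general
    differential of bilinear maps gives the product rule. *)
Definition scale_fun W (c : R) (w : W) : W := c *: w.
HB.instance Definition _ W := bilinear_isBilinear.Build R R W W _ _ (@scale_fun W)
  (scale_is_bilinear W).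

Lemma scale_fun_diff V W (f : V -> R) (g : V -> W) x :
  differentiable f x -> differentiable g x ->
  differentiable (fun y => f y *: g y) x /\
  forall v, 'D_v (fun y => f y *: g y) x = f x *: 'D_v g x + 'D_v f x *: g x.
Proof.
move=> df dg.
have cs : continuous (fun p : R * W => scale_fun p.1 p.2).
  exact: scale_continuous.
have e : (fun y => f y *: g y) = (fun p => scale_fun p.1 p.2) \o (fun y => (f y, g y)).
  by [].
have dp : differentiable (fun y => (f y, g y)) x by exact: differentiable_pair.
have ds : differentiable (fun p : R * W => scale_fun p.1 p.2) (f x, g x).
  exact: differentiable_bilin.
have D : differentiable (fun y => f y *: g y) x.
  by rewrite e; exact: differentiable_comp.
split=> // v; rewrite deriveE // e diff_comp //= diff_pair // diff_bilin //=.
by rewrite -!deriveE.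
Qed.

(** The product rule puts each factor, undifferentiated, beside the derivative of the other; both
    are of class [k.+1], and [ck_atW] lowers them to the order of the induction hypothesis. *)
Lemma ck_atZ V W k (f : V -> R) (g : V -> W) x :
  ck_at k f x -> ck_at k g x -> ck_at k (fun y => f y *: g y) x.
Proof.
elim: k f g => [|k IH] f g /=.
  by apply: filterS2 => y cf cg; exact: cvgZ.
move=> cf cg; have [df hf] := cf; have [dg hg] := cg; split.
  by apply: filterS2 df dg => y df dg; have [] := scale_fun_diff df dg.
move=> v; have hfW := ck_atW cf; have hgW := ck_atW cg.
have := ck_atD (IH _ _ hfW (hg v)) (IH _ _ (hf v) hgW).
apply: ck_at_near; apply: filterS2 df dg => y df dg.
by have [_ ->] := scale_fun_diff df dg.
Qed.

Lemma smooth_atZ V W (f : V -> R) (g : V -> W) x :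
  smooth_at f x -> smooth_at g x -> smooth_at (fun y => f y *: g y) x.
Proof. by apply: filterS2 => y hf hg k; apply: ck_atZ. Qed.

Lemma ck_at_sum V W k (I : Type) (r : seq I) (F : I -> V -> W) x :
  (forall i, ck_at k (F i) x) -> ck_at k (fun y => \sum_(i <- r) F i y) x.
Proof.
move=> h; elim: r => [|i r IH].
  by rewrite (_ : (fun _ => _) = fun=> 0); [exact: ck_at_cst|apply/funext => y; rewrite big_nil].
rewrite (_ : (fun _ => _) = F i \+ (fun y => \sum_(j <- r) F j y)); first exact: ck_atD.
by apply/funext => y; rewrite big_cons.
Qed.

Lemma smooth_at_sum V W (I : finType) (F : I -> V -> W) x :
  (forall i, smooth_at (F i) x) -> smooth_at (fun y => \sum_i F i y) x.
Proof.
move=> h; have : \forall y \near x, forall i, forall k, ck_at k (F i) y by exact: filter_forall.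
by apply: filterS => y hf k; apply: ck_at_sum.
Qed.

(** The chain rule [D_v(f o g) = sum_i l_i(D_v g) (D_(e_i) f o g)] needs a basis: [ck_at] controls
    derivatives of [f] only along fixed directions, while [D_v g] varies with the point. *)
Definition has_basis (V : normedModType R) : Prop :=
  exists (I : finType) (e : I -> V) (l : I -> {linear V -> R^o}),
    (forall i, continuous (l i)) /\ forall x, x = \sum_i (l i x : R) *: e i.

Lemma has_basis_mx m n : has_basis 'M[R]_(m, n).
Proof.
pose l (ij : 'I_m * 'I_n) (M : 'M[R]_(m, n)) : R^o := M ij.1 ij.2.
have ll ij : linear (l ij) by move=> a u v; rewrite /l !mxE.
pose L ij : {linear 'M[R]_(m, n) -> R^o} :=
  HB.pack (l ij) (GRing.isLinear.Build _ _ _ _ _ (ll ij)).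
exists ('I_m * 'I_n)%type, (fun ij => delta_mx ij.1 ij.2), L; split.
  by move=> ij; exact: coord_continuous.
by move=> x; rewrite {1}(matrix_sum_delta x) pair_big.
Qed.

Lemma ck_at_comp U V W k (g : U -> V) (f : V -> W) x :
  has_basis V -> ck_at k g x -> ck_at k f (g x) -> ck_at k (f \o g) x.
Proof.
move=> [I [e [l [cl le]]]]; elim: k f g => [|k IH] f g /=.
  move=> cg cf; have cgx := nbhs_singleton cg.
  by have := cgx _ cf; apply: filterS2 cg => y cgy cfy; exact: continuous_comp.
move=> cg cf; have [dg hg] := cg; have [df hf] := cf.
have cgx := nbhs_singleton (@ck_at_continuous _ _ k.+1 _ _ cg).
have dfg := cgx _ df.
split.
  by apply: filterS2 dg dfg => y; exact: differentiable_comp.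
move=> v.
have := @ck_at_sum U W k I (index_enum I)
  (fun i y => (l i ('D_v g y) : R) *: 'D_(e i) f (g y)) x.
have h i : ck_at k (fun y => (l i ('D_v g y) : R) *: 'D_(e i) f (g y)) x.
  apply: ck_atZ; first exact: (@ck_at_lin _ _ R^o _ (l i)).
  by apply: (IH ('D_(e i) f) g) => //; exact: ck_atW.
move=> /(_ h); apply: ck_at_near; apply: filterS2 dg dfg => y dg' df'.
rewrite [RHS]deriveE; last exact: differentiable_comp.
rewrite diff_comp //=. rewrite -(deriveE v dg') [X in _ = _ X]le linear_sum.
by apply: eq_bigr => i _; rewrite linearZ -(deriveE (e i) df').
Qed.

Lemma smooth_at_comp U V W (g : U -> V) (f : V -> W) x :
  has_basis V -> smooth_at g x -> smooth_at f (g x) ->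
  smooth_at (fun y => f (g y)) x.
Proof.
move=> hV sg sf; have := smooth_at_continuous sg; move=> /(_ _ sf) /=.
by apply: filterS2 sg => y sg sf' k; apply: ck_at_comp.
Qed.

Lemma smooth_at_id V (x : V) : smooth_at id x.
Proof.
apply: nearW => y [|k] /=; first by apply: nearW => z; exact: cvg_id.
split; first by apply: nearW => z.
move=> v; rewrite (_ : 'D_v _ = fun=> v); first exact: ck_at_cst.
by apply/funext => z; rewrite derive_id.
Qed.

Lemma smooth_at_linear V W (l : {linear V -> W}) x :
  continuous l -> smooth_at l x.
Proof. by move=> cl; apply: (smooth_at_lin cl (smooth_at_id x)). Qed.

Lemma smooth_at_fst V W (x : V * W) : smooth_at fst x.
Proof. by apply: smooth_at_linear => z; exact: cvg_fst. Qed.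

Lemma smooth_at_snd V W (x : V * W) : smooth_at snd x.
Proof. by apply: smooth_at_linear => z; exact: cvg_snd. Qed.

Lemma ck_at_pair U V W k (f : U -> V) (g : U -> W) x :
  ck_at k f x -> ck_at k g x -> ck_at k (fun y => (f y, g y)) x.
Proof.
elim: k f g => [|k IH] f g /=.
  by apply: filterS2 => y cf cg; exact: cvg_pair.
move=> [df hf] [dg hg]; split.
  by apply: filterS2 df dg => y; exact: differentiable_pair.
move=> v; have := IH _ _ (hf v) (hg v); apply: ck_at_near.
apply: filterS2 df dg => y df dg.
rewrite [RHS]deriveE; last exact: differentiable_pair.
by rewrite diff_pair // -!deriveE.
Qed.

Lemma smooth_at_pair U V W (f : U -> V) (g : U -> W) x :
  smooth_at f x -> smooth_at g x -> smooth_at (fun y => (f y, g y)) x.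
Proof. by apply: filterS2 => y hf hg k; apply: ck_at_pair. Qed.

Lemma smooth_at_mx V m n (f : V -> 'M[R]_(m, n)) x :
  (forall i j, smooth_at (fun y => f y i j : R) x) -> smooth_at f x.
Proof.
move=> h; have e : f = fun y => \sum_i \sum_j f y i j *: delta_mx i j.
  by apply/funext => y; rewrite -matrix_sum_delta.
rewrite e; apply: smooth_at_sum => i; apply: smooth_at_sum => j.
by apply: smooth_atZ; [exact: h|exact: smooth_at_cst].
Qed.

Lemma smooth_at_coord V m n (f : V -> 'M[R]_(m, n)) x i j :
  smooth_at f x -> smooth_at (fun y => f y i j : R) x.
Proof.
pose l (M : 'M[R]_(m, n)) : R^o := M i j.
have ll : linear l by move=> a u v; rewrite /l !mxE.
pose L : {linear 'M[R]_(m, n) -> R^o} :=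
  HB.pack l (GRing.isLinear.Build _ _ _ _ _ ll).
by apply: (@smooth_at_lin _ _ R^o L); exact: coord_continuous.
Qed.

Lemma smooth_atM V (f g : V -> R) x :
  smooth_at f x -> smooth_at g x -> smooth_at (fun y => f y * g y) x.
Proof. exact: smooth_atZ. Qed.

Lemma smooth_at_mulmx V m n p (f : V -> 'M[R]_(m, n)) (g : V -> 'M[R]_(n, p)) x :
  smooth_at f x -> smooth_at g x -> smooth_at (fun y => f y *m g y) x.
Proof.
move=> hf hg; apply: smooth_at_mx => i j.
rewrite (_ : (fun _ => _) = fun y => \sum_k f y i k * g y k j); last first.
  by apply/funext => y; rewrite mxE.
by apply: smooth_at_sum => k; apply: smooth_atM; exact: smooth_at_coord.
Qed.

Lemma smooth_at_prod V (I : Type) (r : seq I) (F : I -> V -> R) x :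
  (forall i, smooth_at (F i) x) -> smooth_at (fun y => \prod_(i <- r) F i y) x.
Proof.
move=> h; elim: r => [|i r IH].
  rewrite (_ : (fun _ => _) = fun=> 1); first exact: smooth_at_cst.
  by apply/funext => y; rewrite big_nil.
rewrite (_ : (fun _ => _) = (fun y => F i y * \prod_(j <- r) F j y)).
  exact: smooth_atM.
by apply/funext => y; rewrite big_cons.
Qed.

Lemma smooth_at_det V n (f : V -> 'M[R]_n) x :
  smooth_at f x -> smooth_at (fun y => \det (f y)) x.
Proof.
move=> hf; rewrite /determinant; apply: smooth_at_sum => s.
apply: smooth_atM; first exact: smooth_at_cst.
by apply: smooth_at_prod => i; exact: smooth_at_coord.
Qed.

Lemma neq0_near V (f : V -> R) x : {for x, continuous f} -> f x != 0 ->
  \forall y \near x, f y != 0.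
Proof.
move=> cf fx0; apply: (cf [set z | z != 0]).
by apply: open_nbhs_nbhs; split=> //; exact: open_neq.
Qed.

Lemma ck_atV V k (f : V -> R) x : f x != 0 ->
  ck_at k f x -> ck_at k (fun y => (f y)^-1) x.
Proof.
move=> fx0; elim: k => [|k IH] cf.
  have cfx := nbhs_singleton cf.
  have : \forall y \near x, f y != 0.
    exact: neq0_near.
  by apply: filterS2 cf => y cf fy; exact: cvgV.
have cfW := ck_atW cf; have [df hf] := cf.
have cfx := nbhs_singleton (@ck_at_continuous _ _ k.+1 _ _ cf).
have n0 : \forall y \near x, f y != 0.
  exact: neq0_near.
split.
  by apply: filterS2 df n0 => y; exact: differentiableV.
move=> v.
(* This is [D_v(1/f) = - f^-2 D_v f], grouped so that both reciprocals fall under the induction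
   hypothesis. *)
have := ck_atZ (ck_atZ (ck_at_cst k (-1 : R) x) (IH cfW)) (ck_atZ (IH cfW) (hf v)).
apply: ck_at_near; apply: filterS2 df n0 => y df fy.
rewrite deriveV //; last exact: diff_derivable.
by rewrite /GRing.scale /=; field.
Qed.

Lemma smooth_atV V (f : V -> R) x : f x != 0 ->
  smooth_at f x -> smooth_at (fun y => (f y)^-1) x.
Proof.
move=> fx0 sf; have cfx := smooth_at_continuous sf.
have : \forall y \near x, f y != 0.
  exact: neq0_near.
by apply: filterS2 sf => y sf fy k; apply: ck_atV.
Qed.

Lemma unitmx_near V n (f : V -> 'M[R]_n) x : {for x, continuous f} ->
  f x \in unitmx -> \forall y \near x, f y \in unitmx.
Proof.
move=> cf ux; have cd : {for f x, continuous (@determinant R n)}.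
  exact: (smooth_at_continuous (smooth_at_det (smooth_at_id (f x)))).
have : {for x, continuous (fun y => \det (f y))} by exact: continuous_comp.
have d0 : \det (f x) != 0 by rewrite -unitfE -unitmxE.
move=> /neq0_near/(_ d0); apply: filterS => y /=.
by rewrite unitmxE unitfE.
Qed.

Lemma smooth_at_invmx V n (f : V -> 'M[R]_n) x : f x \in unitmx ->
  smooth_at f x -> smooth_at (fun y => invmx (f y)) x.
Proof.
move=> ux sf; have un := unitmx_near (smooth_at_continuous sf) ux.
(* [invmx] returns its argument off the invertible matrices, so Cramer's formula agrees with it only
   near [x]. *)
suff : smooth_at (fun y => (\det (f y))^-1 *: \adj (f y)) x.
  by apply: smooth_at_near; apply: filterS un => y uy; rewrite /invmx uy.
have d0 : \det (f x) != 0 by rewrite -unitfE -unitmxE.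
apply: smooth_atZ; first exact/smooth_atV/smooth_at_det.
apply: smooth_at_mx => i j.
rewrite (_ : (fun _ => _) = fun y => cofactor (f y) j i); last first.
  by apply/funext => y; rewrite mxE.
apply: smooth_atM; first exact: smooth_at_cst.
apply: smooth_at_det; apply: smooth_at_mx => a b.
rewrite (_ : (fun _ => _) = fun y => f y (lift j a) (lift i b)).
  exact: smooth_at_coord.
by apply/funext => y; rewrite !mxE.
Qed.

Lemma smooth_at_mxlin V m n p q (l : {linear 'M[R]_(m, n) -> 'M[R]_(p, q)})
    (f : V -> 'M[R]_(m, n)) x :
  smooth_at f x -> smooth_at (fun y => l (f y)) x.
Proof.
move=> sf; rewrite (_ : (fun _ => _) =
  fun y => \sum_i \sum_j f y i j *: l (delta_mx i j)); last first.
  apply/funext => y; rewrite {1}(matrix_sum_delta (f y)) linear_sum.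
  by apply: eq_bigr => i _; rewrite linear_sum; apply: eq_bigr => j _; rewrite linearZ.
apply: smooth_at_sum => i; apply: smooth_at_sum => j.
by apply: smooth_atZ; [exact: smooth_at_coord|exact: smooth_at_cst].
Qed.

End Smooth.

(** * Smooth square roots of matrices near 1 *)

HB.instance Definition _ (R : realType) (m n : nat) := Complete.on 'M[R]_(m, n).

Ltac mx_abel := repeat match goal with |- context [?a *m ?b] =>
  let z := fresh "z" in move: (a *m b) => z end;
  apply/matrixP => ? ?; rewrite !mxE; ring.

Section MatrixSqrt.
Variables (R : realType) (N : nat).
Implicit Types A X Y Z : 'M[R]_N.

Lemma mx_norm_entry m n (M : 'M[R]_(m, n)) i j : `|M i j| <= `|M|.
Proof.
rewrite [leRHS]/Num.norm /= mx_normrE.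
by apply/bigmax_geP; right; exists (i, j).
Qed.

Lemma mx_norm_le m n (M : 'M[R]_(m, n)) (c : R) :
  0 <= c -> (forall i j, `|M i j| <= c) -> `|M| <= c.
Proof.
move=> c0 h; rewrite /Num.norm /= mx_normrE; apply/bigmax_leP; split=> // ij _.
Qed.

(** For the entrywise maximum norm the product satisfies [|A B| <= N |A| |B|]; the successor keeps
    the constant positive when [N] is 0. *)
Let c : R := N.+1%:R.
Let c_gt0 : 0 < c. Proof. by rewrite ltr0n. Qed.

Lemma mx_normM (A B : 'M[R]_N) : `|A *m B| <= c * (`|A| * `|B|).
Proof.
apply: mx_norm_le; first by rewrite !mulr_ge0 // ltW.
move=> i j; rewrite mxE; apply: le_trans (ler_norm_sum _ _ _) _.
apply: (@le_trans _ _ (\sum_(k < N) `|A| * `|B|)).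
  apply: ler_sum => k _; rewrite normrM.
  by apply: ler_pM => //; exact: mx_norm_entry.
rewrite sumr_const card_ord -mulr_natl ler_wpM2r ?mulr_ge0 //.
by rewrite ler_nat.
Qed.

(** Chosen so that multiplication by a matrix of norm at most [r], on either side, shrinks norms by
    a factor of at least 4. *)
Let r : R := (4 * c)^-1.
Let r_gt0 : 0 < r. Proof. by rewrite invr_gt0 mulr_gt0. Qed.
Let cr : c * r = 4^-1. Proof. by rewrite /r; field; rewrite gt_eqF. Qed.

Lemma mx_normM_small (Z D : 'M[R]_N) : `|Z| <= r ->
  `|Z *m D| <= 4^-1 * `|D| /\ `|D *m Z| <= 4^-1 * `|D|.
Proof.
move=> Zr; split; apply: le_trans (mx_normM _ _) _; rewrite -cr -mulrA.
  by rewrite ler_pM2l // ler_wpM2r.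
by rewrite ler_pM2l // mulrC ler_wpM2r.
Qed.

(** Write [X D + D Y = 2 D + (X - 1) D + D (Y - 1)]: the last two terms have total norm at most
    [|D| / 2]. For suitable [D] this bound gives uniqueness of the square root near 1, its Lipschitz
    continuity, the solvability of its linearized equation and its commutation properties. *)
Lemma sylvester_lower_bound X Y D : `|X - 1%:M| <= r -> `|Y - 1%:M| <= r ->
  `|D| <= `|X *m D + D *m Y|.
Proof.
move=> hX hY.
have e : D + D = (X *m D + D *m Y) - ((X - 1%:M) *m D + D *m (Y - 1%:M)).
  rewrite mulmxBl mulmxBr mul1mx mulmx1.
  by rewrite addrACA -opprD opprB addrCA subrr addr0.
have n2 : `|D + D| = 2 * `|D| by rewrite -mulr2n -scaler_nat normrZ ger0_norm.
have := ler_normB (X *m D + D *m Y) ((X - 1%:M) *m D + D *m (Y - 1%:M)).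
rewrite -e n2.
have := ler_normD ((X - 1%:M) *m D) (D *m (Y - 1%:M)).
have [+ _] := mx_normM_small D hX; have [_] := mx_normM_small D hY.
have := normr_ge0 D.
lra.
Qed.

Let sqr_spec A Z := `|Z| <= r /\ (1%:M + Z) *m (1%:M + Z) = A.
(** The root within distance [r] of 1 is unique by [sylvester_lower_bound]. The default 0 makes the
    value 1 where no such root exists. *)
Definition sqrtmx A : 'M[R]_N := 1%:M + xget 0 (sqr_spec A).

(** The equation [(1 + Z)^2 = A] is [Z = (E - Z^2) / 2] with [E = A - 1], and the right-hand side
    maps the closed ball of radius [r] to itself and is a contraction there. *)
Lemma sqrtmx_exists A : `|A - 1%:M| <= r -> exists Z, sqr_spec A Z.
Proof.
move=> hA; pose E : 'M[R]_N := A - 1%:M.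
pose U : set 'M[R]_N := [set Z | `|Z| <= r].
pose f Z : 'M[R]_N := 2^-1 *: (E - Z *m Z).
have fU : set_fun U U f.
  move=> Z /= Zr; rewrite /U /f /= normrZ ger0_norm ?invr_ge0 //.
  have := ler_normB E (Z *m Z); have [+ _] := mx_normM_small Z Zr.
  have : `|E| <= r by [].
  move: (Zr : `|Z| <= r) r_gt0; lra.
pose F : {fun U >-> U} := HB.pack f (isFun.Build _ _ _ _ f fU).
have cF : is_contraction F.
  exists 2^-1%:nng; split=> /=; first by lra.
  move=> [Z W] [/= Zr Wr]; rewrite -scalerBr normrZ ger0_norm ?invr_ge0 //.
  rewrite ler_wpM2l ?invr_ge0 // opprB addrC addrA subrK.
  have -> : W *m W - Z *m Z = - (Z *m (Z - W) + (Z - W) *m W).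
    by rewrite mulmxBr mulmxBl addrA subrK opprB.
  rewrite normrN.
  have := ler_normD (Z *m (Z - W)) ((Z - W) *m W).
  have [+ _] := mx_normM_small (Z - W) Zr; have [_] := mx_normM_small (Z - W) Wr.
  have := normr_ge0 (Z - W); lra.
have clU : closed U.
  have -> : U = (fun Z => `|Z|) @^-1` [set x | x <= r] by [].
  apply: closed_comp; last exact: closed_le.
  by move=> Z _; exact: norm_continuous.
have [|Z Zr e] := banach_fixed_point cF clU; first by exists 0; rewrite /U /= normr0 ltW.
exists Z; split=> //; have e2 : Z + Z = E - Z *m Z.
  by rewrite {1 2}e /= /f -scalerDl -[X in X + X]mulr1 -mulrDr mulVf ?scale1r.
rewrite mulmxDl mul1mx mulmxDr mulmx1 addrA -(addrA 1%:M) e2.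
by rewrite -addrA subrK addrC subrK.
Qed.

Lemma sqrtmxP A : `|A - 1%:M| <= r ->
  `|sqrtmx A - 1%:M| <= r /\ sqrtmx A *m sqrtmx A = A.
Proof.
move=> hA; rewrite /sqrtmx.
have [Z hZ] := sqrtmx_exists hA.
case: xgetP => [W _ [Wr We]|/(_ Z)//].
by rewrite addrAC subrr add0r.
Qed.

(** With [X] and [Y] the two roots, [X (X - Y) + (X - Y) Y = A - B]. *)
Lemma sqrtmx_lipschitz A B : `|A - 1%:M| <= r -> `|B - 1%:M| <= r ->
  `|sqrtmx A - sqrtmx B| <= `|A - B|.
Proof.
move=> /sqrtmxP[hA eA] /sqrtmxP[hB eB].
apply: le_trans (sylvester_lower_bound (sqrtmx A - sqrtmx B) hA hB) _.
by rewrite mulmxBr mulmxBl addrA subrK eA eB.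
Qed.

(** The differential of squaring at [X], written on vectorized matrices; its inverse is the
    differential of the root. *)
Definition sylvester_mx X : 'M[R]_(N * N) := lin_mulmx X + lin_mulmxr X.

Lemma sylvester_mxE X D : mxvec D *m sylvester_mx X = mxvec (X *m D + D *m X).
Proof. by rewrite mulmxDr !mul_vec_lin linearD. Qed.

Lemma sylvester_unit X : `|X - 1%:M| <= r -> sylvester_mx X \in unitmx.
Proof.
move=> hX; rewrite -row_free_unit; apply: inj_row_free => v hv.
rewrite -[v]vec_mxK in hv *; move: (vec_mx v) hv => D.
rewrite sylvester_mxE => /(canRL mxvecK); rewrite linear0 => e.
have := sylvester_lower_bound D hX hX.
by rewrite e normr0 normr_le0 => /eqP ->; rewrite linear0.
Qed.

Definition sylvester_inv X (H : 'M[R]_N) : 'M[R]_N :=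
  vec_mx (mxvec H *m invmx (sylvester_mx X)).

Lemma sylvester_invE X H : `|X - 1%:M| <= r ->
  X *m sylvester_inv X H + sylvester_inv X H *m X = H.
Proof.
move=> hX; apply: (can_inj mxvecK).
by rewrite -sylvester_mxE vec_mxK mulmxKV // sylvester_unit.
Qed.

Lemma sylvester_inv_linear X : linear (sylvester_inv X).
Proof. by move=> a u v; rewrite /sylvester_inv linearP mulmxDl -scalemxAl linearP. Qed.

Lemma smooth_at_sylvester_inv X H : `|X - 1%:M| <= r ->
  smooth_at (fun X => sylvester_inv X H) X.
Proof.
move=> hX; apply: smooth_at_mxlin; apply: smooth_at_mulmx; first exact: smooth_at_cst.
apply: smooth_at_invmx; first exact: sylvester_unit.
have ll : linear sylvester_mx.
  move=> a u v; apply/row_matrixP => i.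
  rewrite !rowE -[delta_mx _ _]vec_mxK; move: (vec_mx _) => D.
  have E Z : mxvec D *m sylvester_mx Z = mxvec (Z *m D + D *m Z) by exact: sylvester_mxE.
  apply: etrans (E _) _; rewrite [RHS]mulmxDr -[in RHS]scalemxAr (E u) (E v) -linearP.
  congr (mxvec _).
  rewrite mulmxDl mulmxDr -scalemxAl -scalemxAr.
  by mx_abel.
pose L : {linear 'M[R]_N -> 'M[R]_(N * N)} :=
  HB.pack sylvester_mx (GRing.isLinear.Build _ _ _ _ _ ll).
exact: (@smooth_at_mxlin _ _ _ _ _ _ L _ _ (smooth_at_id X)).
Qed.

Lemma near0_norm (e : R) : 0 < e -> \forall H \near (0 : 'M[R]_N), `|H| < e.
Proof.
move=> e0; apply/nbhs_normP; exists e => // y /=.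
by rewrite sub0r normrN.
Qed.

(** With [X] and [Y] the roots of [A] and [H + A], the error [D = Y - X - L H] satisfies
    [X D + D X = - (Y - X)^2]. The lower bound and the Lipschitz estimate make it at most [c |H|^2],
    which is below [e |H|] once [|H| <= e / c]. *)
Lemma sqrtmx_diff A : `|A - 1%:M| < r ->
  is_diff A sqrtmx (sylvester_inv (sqrtmx A)).
Proof.
move=> hA; have [hX eX] := sqrtmxP (ltW hA); set X := sqrtmx A in hX eX *.
pose L : {linear 'M[R]_N -> 'M[R]_N} :=
  HB.pack (sylvester_inv X) (GRing.isLinear.Build _ _ _ _ _ (sylvester_inv_linear X)).
apply: (@differentiable_estimate _ _ _ _ L).
  by move=> H; apply/smooth_at_continuous/(@smooth_at_mxlin _ _ _ _ _ _ L)/smooth_at_id.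
move=> e e0; near=> H.
have hB : `|(H + A) - 1%:M| <= r.
  have h : `|H| < r - `|A - 1%:M|.
    by near: H; apply: near0_norm; rewrite subr_gt0.
  rewrite -addrA; apply: le_trans (ler_normD _ _) _; move: h; lra.
have [hY eY] := sqrtmxP hB; set Y := sqrtmx (H + A) in hY eY *.
have lip : `|Y - X| <= `|H|.
  by have := sqrtmx_lipschitz hB (ltW hA); rewrite addrK.
have E : X *m (Y - X - L H) + (Y - X - L H) *m X = - ((Y - X) *m (Y - X)).
  have sH := sylvester_invE H hX; rewrite -[sylvester_inv X H]/(L H) in sH.
  rewrite !(mulmxBr, mulmxBl) eX eY.
  move: (L H) sH => D sH; have -> : H + A = X *m D + D *m X + A by rewrite sH.
  by mx_abel.
have := sylvester_lower_bound (Y - X - L H) hX hX.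
rewrite E normrN => /le_trans; apply.
apply: le_trans (mx_normM _ _) _.
have hs : `|H| <= e / c.
  by apply: ltW; near: H; apply: near0_norm; rewrite divr_gt0.
apply: (@le_trans _ _ (c * (e / c * `|H|))).
  rewrite ler_pM2l //; apply: ler_pM => //; exact: le_trans lip _.
by rewrite mulrA [c * _]mulrC divfK // gt_eqF.
Unshelve. all: by end_near. Qed.

Lemma near_ball A d : `|A - 1%:M| < d -> \forall B \near A, `|B - 1%:M| < d.
Proof.
move=> hA; apply/nbhs_normP; exists (d - `|A - 1%:M|); first by rewrite /= subr_gt0.
move=> B /= hB; have := ler_distD A B 1%:M; rewrite (distrC B A).
by move: hB; lra.
Qed.

(** Bootstrapping: the derivative of [sqrtmx] along [V] is the smooth map [X |-> sylvester_inv X V]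
    composed with [sqrtmx], hence is of class [k] as soon as [sqrtmx] is. *)
Lemma ck_at_sqrtmx k A : `|A - 1%:M| < r -> ck_at k sqrtmx A.
Proof.
elim: k A => [|k IH] A hA /=.
  apply: filterS (near_ball hA) => B /sqrtmx_diff h.
  exact/differentiable_continuous/ex_diff.
split; first by apply: filterS (near_ball hA) => B /sqrtmx_diff[].
move=> V; have hX := (sqrtmxP (ltW hA)).1.
have := smooth_at_sylvester_inv V hX => /nbhs_singleton/(_ k).
move=> /(ck_at_comp (has_basis_mx _ _ _) (IH _ hA)).
apply: ck_at_near; apply: filterS (near_ball hA) => B /sqrtmx_diff h.
by rewrite deriveE ?diff_val.
Qed.

Lemma smooth_at_sqrtmx A : `|A - 1%:M| < r -> smooth_at sqrtmx A.
Proof. by move/near_ball; apply: filterS => B hB k; exact: ck_at_sqrtmx. Qed.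

Lemma sqrtmx1 : sqrtmx 1%:M = 1%:M.
Proof.
have h : `|1%:M - 1%:M : 'M[R]_N| <= r by rewrite subrr normr0 ltW.
have [hX eX] := sqrtmxP h.
apply/eqP; rewrite -subr_eq0 -normr_le0.
apply: le_trans (sylvester_lower_bound _ hX h) _.
by rewrite mulmxBr !mulmx1 eX addrA subrK subrr normr0.
Qed.

(** With [X] the root, the commutator [D = K X - X K] satisfies [X D + D X = K A - A K = 0], so it
    vanishes. *)
Lemma sqrtmx_comm A K : `|A - 1%:M| <= r -> K *m A = A *m K ->
  K *m sqrtmx A = sqrtmx A *m K.
Proof.
move=> /sqrtmxP[hX eX] e; apply/eqP; rewrite -subr_eq0 -normr_le0.
apply: le_trans (sylvester_lower_bound _ hX hX) _.
rewrite mulmxBr mulmxBl !mulmxA eX -[K *m _ *m _]mulmxA eX e.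
by rewrite addrC addrA subrK subrr normr0.
Qed.

(** [B X^T B^-1] is a second square root of [A] when [A B = B A^T]. Conjugation by [B] may enlarge
    norms, so [A] is taken close enough to 1, by continuity, that both roots lie in the ball of
    uniqueness. *)
Lemma sqrtmx_adjoint (B : 'M[R]_N) : B \in unitmx ->
  \forall A \near (1%:M : 'M[R]_N), A *m B = B *m A^T -> sqrtmx A *m B = B *m (sqrtmx A)^T.
Proof.
move=> uB; pose f A : 'M[R]_N := B *m (sqrtmx A)^T *m invmx B.
have h1 : `|1%:M - 1%:M : 'M[R]_N| < r by rewrite subrr normr0.
have cf : {for (1%:M : 'M[R]_N), continuous f}.
  apply: smooth_at_continuous; apply: smooth_at_mulmx; last exact: smooth_at_cst.
  apply: smooth_at_mulmx; first exact: smooth_at_cst.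
  exact/smooth_at_mxlin/smooth_at_sqrtmx.
have f1 : f 1%:M = 1%:M by rewrite /f sqrtmx1 trmx1 mulmx1 mulmxV.
have : \forall A \near (1%:M : 'M[R]_N), `|f A - 1%:M| < r.
  by apply: (cf [set Z | `|Z - 1%:M| < r]); rewrite f1; apply: near_ball.
apply: filterS2 (near_ball h1) => A hA hf e.
have [hX eX] := sqrtmxP (ltW hA).
suff e2 : sqrtmx A = f A by rewrite {1}e2 /f mulmxKV.
apply/eqP; rewrite -subr_eq0 -normr_le0.
apply: le_trans (sylvester_lower_bound _ hX (ltW hf)) _.
rewrite mulmxBr mulmxBl addrA subrK eX /f.
rewrite !mulmxA mulmxKV // -(mulmxA B) -trmx_mul eX -e mulmxK //.
by rewrite subrr normr0.
Qed.

Lemma sqrtmx_near1 (B : 'M[R]_N) : B \in unitmx ->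
  \forall A \near (1%:M : 'M[R]_N), [/\ sqrtmx A *m sqrtmx A = A, smooth_at sqrtmx A,
    forall K, K *m A = A *m K -> K *m sqrtmx A = sqrtmx A *m K &
    A *m B = B *m A^T -> sqrtmx A *m B = B *m (sqrtmx A)^T].
Proof.
move=> uB; have h1 : `|1%:M - 1%:M : 'M[R]_N| < r by rewrite subrr normr0.
apply: filterS2 (near_ball h1) (sqrtmx_adjoint uB) => A hA adj.
have [_ eX] := sqrtmxP (ltW hA); split=> //; first exact: smooth_at_sqrtmx.
by move=> K; apply: sqrtmx_comm; exact: ltW.
Qed.

End MatrixSqrt.

(** * Smooth maps between manifolds *)

Lemma continuous_near_open (X Y : topologicalType) (f : X -> Y) x (O : set Y) :
  {for x, continuous f} -> open O -> O (f x) -> \forall y \near x, O (f y).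
Proof. by move=> cf oO Ox; apply: (cf O); exact: open_nbhs_nbhs. Qed.

Lemma continuous_near (X Y : topologicalType) (f g : X -> Y) x :
  {near x, f =1 g} -> {for x, continuous g} -> {for x, continuous f}.
Proof.
move=> fg cg; suff : f y @[y --> x] --> f x by [].
rewrite (nbhs_singleton fg); apply: cvg_trans cg; apply: near_eq_cvg.
by apply: filterS fg => y ->.
Qed.

Lemma open_setI_preimage (X Y : topologicalType) (f : X -> Y) (A : set X) (O : set Y) :
  open A -> open O -> (forall x, A x -> {for x, continuous f}) ->
  open (A `&` f @^-1` O).
Proof.
move=> oA oO cf; rewrite openE => x [Ax Ofx].
apply: filterI; first exact: open_nbhs_nbhs.
exact: cf _ Ax _ (open_nbhs_nbhs (conj oO Ofx)).
Qed.

(** Listing the base as a sequence lets it be pulled back and paired index by index. *)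
Lemma second_countableP (T : topologicalType) :
  @second_countable T <-> exists b : nat -> set T, (forall k, open (b k)) /\
    forall x (U : set T), nbhs x U -> exists k, b k x /\ b k `<=` U.
Proof.
split=> [[B cB [oB nB]]|[b [ob nb]]].
  have : exists b : nat -> set T, B `<=` range b /\ forall k, open (b k).
    move/pfcard_geP: cB => [->|[f]]; first by exists (fun=> set0); split=> // k; exact: open0.
    exists f; split; last by move=> k; apply/oB/funS.
    by move=> U /(@surj _ _ _ _ f)[k _ <-]; exists k.
  move=> [b [Bb ob]]; exists b; split=> // x U /nB[V [/Bb[k _ <-] bx] bU].
  by exists k.
exists (range b); first exact: card_image_le.
split=> [_ [k _ <-]//|x U /nb[k [bx bU]]].
by exists (b k) => //; split=> //; exists k.
Qed.

Lemma second_countable_countType (T : topologicalType) (I : countType)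
    (b : I -> set T) : (forall k, open (b k)) ->
  (forall x (U : set T), nbhs x U -> exists k, b k x /\ b k `<=` U) ->
  @second_countable T.
Proof.
move=> ob nb; apply/second_countableP.
exists (fun k => if unpickle k is Some i then b i else set0); split.
  by move=> k; case: unpickle => [i|]; [exact: ob|exact: open0].
move=> x U /nb[i [bx bU]]; exists (pickle i); by rewrite pickleK.
Qed.

Section ManifoldMaps.
Variable R : realType.

Lemma second_countable_mx m n : @second_countable 'M[R]_(m, n).
Proof.
pose b (cq : 'M[rat]_(m, n) * rat) : set 'M[R]_(m, n) :=
  [set S | `|map_mx ratr cq.1 - S| < ratr cq.2].
apply: (@second_countable_countType _ _ b) => [k|x U].
  have -> : b k = ball (map_mx ratr k.1 : 'M[R]_(m, n)) (ratr k.2).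
    by rewrite -ball_normE.
  exact: ball_open.
move=> /nbhs_normP[e /= e0 eU].
(* A rational radius below [e / 2]: a ball of this radius whose center is within the same distance
   of [x] contains [x] and stays inside the ball of radius [e] about [x]. *)
have [q] := rat_in_itvoo (divr_gt0 e0 (ltr0n R 2)); rewrite in_itv /= => /andP[].
set d : R := ratr q => q0 qe.
have hc i j : {c : rat | `|ratr c - x i j| < d}.
  have h : x i j - d < x i j + d by lra.
  have [c] := cid (rat_in_itvoo h); rewrite in_itv /= => /andP[c1 c2].
  by exists c; rewrite ltr_distl c1 c2.
have hx : `|map_mx ratr (\matrix_(i, j) sval (hc i j)) - x| < d.
  rewrite /Num.norm /= mx_normrE; apply/bigmax_ltP; split=> // -[i j] _ /=.
  by rewrite !mxE; case: (hc i j).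
exists (\matrix_(i, j) sval (hc i j), q); split=> // S; rewrite /b /= -/d => hS.
apply: eU => /=; have := ler_distD (map_mx ratr (\matrix_(i, j) sval (hc i j))) x S.
rewrite distrC in hx; lra.
Qed.

Section OneManifold.
Variables (n : nat) (M : smoothManifold R n).
Implicit Types (i j : idx M) (p : M).

Lemma chartV_dom_near i p (U : set M) : nbhs p U -> dom i p ->
  \forall x \near chart i p, [/\ dom i (chartV i x), U (chartV i x) &
     chart i (chartV i x) = x].
Proof.
move=> pU dp.
have h1 : \forall x \near chart i p, (chart i @` dom i) x.
  by apply: open_nbhs_nbhs; split; [exact: chart_open|exists p].
have cV : chartV i x @[x --> chart i p] --> chartV i (chart i p).
  exact: chartV_continuous.
rewrite (chartK dp) in cV; have h2 := cV _ pU.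
by apply: filterS2 h1 h2 => x [q dq <-] /=; rewrite chartK.
Qed.

Lemma chart_image_open i (U : set M) : open U -> open (chart i @` (U `&` dom i)).
Proof.
move=> oU; rewrite openE => _ [p [Up dp] <-].
have := chartV_dom_near (open_nbhs_nbhs (conj oU Up)) dp.
by apply: filterS => x [dx Ux e]; exists (chartV i x).
Qed.

Lemma transition_smooth i j p : dom i p -> dom j p ->
  smooth_at (chart j \o chartV i) (chart i p).
Proof.
move=> di dj; have := @chart_smooth _ _ M i j.
move=> /smooth_onP; apply; last by exists p.
by rewrite setIC; apply: chart_image_open; exact: dom_open.
Qed.

(** One chart is enough, because smooth transition maps change it to any other chart around [p]. *)
Definition smooth_from_at (V : normedModType R) (f : M -> V) p :=
  exists i, dom i p /\ smooth_at (f \o chartV i) (chart i p).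

Lemma smooth_from_atE (V : normedModType R) (f : M -> V) p j :
  smooth_from_at f p -> dom j p -> smooth_at (f \o chartV j) (chart j p).
Proof.
move=> [i [di sf]] dj.
have : smooth_at (fun x => (f \o chartV i) ((chart i \o chartV j) x)) (chart j p).
  apply: smooth_at_comp; [exact: has_basis_mx|exact: transition_smooth|].
  by rewrite /= chartK.
apply: smooth_at_near.
have := chartV_dom_near (open_nbhs_nbhs (conj (dom_open i) di)) dj.
by apply: filterS => x [_ dx _] /=; rewrite chartK.
Qed.

Lemma smooth_from_atP (V : normedModType R) (f : M -> V) (U : set M) :
  (forall p, U p -> smooth_from_at f p) -> smooth_from U f.
Proof.
by move=> h i; apply: smooth_on_at => _ [p [Up dp] <-]; apply: smooth_from_atE; [exact: h|].
Qed.

Lemma smooth_from_open (V : normedModType R) (f : M -> V) (U : set M) p :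
  open U -> smooth_from U f -> U p -> smooth_from_at f p.
Proof.
move=> oU sf Up; have [i di] := dom_cover p; exists i; split=> //.
have := sf i => /smooth_onP; apply; last by exists p.
exact: chart_image_open.
Qed.

(** Asking that a whole neighbourhood land in one chart domain builds continuity in and excludes the
    junk values of the chart. *)
Definition smooth_into_at (V : normedModType R) (f : V -> M) x :=
  exists i, (\forall y \near x, dom i (f y)) /\ smooth_at (chart i \o f) x.

Lemma smooth_into_at_continuous (V : normedModType R) (f : V -> M) x :
  smooth_into_at f x -> {for x, continuous f}.
Proof.
move=> [i [di sf]]; have dx := nbhs_singleton di.
have cf : {for x, continuous (chartV i \o (chart i \o f))}.
  apply: continuous_comp; first exact: smooth_at_continuous.
  exact: chartV_continuous.
apply: continuous_near cf.
by apply: filterS di => y dy /=; rewrite chartK.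
Qed.

Lemma smooth_into_atE (V : normedModType R) (f : V -> M) x j :
  smooth_into_at f x -> dom j (f x) -> smooth_at (chart j \o f) x.
Proof.
move=> h dj; have cf := smooth_into_at_continuous h; have [i [di sf]] := h.
have dx := nbhs_singleton di.
have : smooth_at (fun y => (chart j \o chartV i) ((chart i \o f) y)) x.
  by apply: smooth_at_comp => //; [exact: has_basis_mx|exact: transition_smooth].
by apply: smooth_at_near; apply: filterS di => y dy /=; rewrite chartK.
Qed.

Lemma smooth_into_dom (V : normedModType R) (f : V -> M) x j :
  smooth_into_at f x -> dom j (f x) -> \forall y \near x, dom j (f y).
Proof.
move=> /smooth_into_at_continuous cf dj.
by apply: cf; apply: open_nbhs_nbhs; split=> //; exact: dom_open.
Qed.

Lemma smooth_into_atP (V : normedModType R) (f : V -> M) (U : set V) :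
  (forall x, U x -> smooth_into_at f x) -> smooth_into U f.
Proof.
move=> h; split=> [x /h/smooth_into_at_continuous//|j].
by apply: smooth_on_at => x [/h sx dx]; exact: smooth_into_atE.
Qed.

Lemma smooth_into_near (V : normedModType R) (f g : V -> M) x :
  (\near x, f x = g x) -> smooth_into_at f x -> smooth_into_at g x.
Proof.
move=> fg [i [di sf]]; exists i; split; first by apply: filterS2 fg di => y <-.
by apply: smooth_at_near sf; apply: filterS fg => y /= ->.
Qed.

Lemma smooth_into_chartV i p : dom i p -> smooth_into_at (chartV i) (chart i p).
Proof.
move=> di; have h := chartV_dom_near (@filterT _ _ (nbhs_filter p)) di.
exists i; split; first by apply: filterS h => x [].
apply: smooth_at_near (smooth_at_id _).
by apply: filterS h => x [_ _ /= ->].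
Qed.

Lemma smooth_into_comp (V W : normedModType R) (g : V -> W) (f : W -> M) x :
  has_basis W -> smooth_at g x -> smooth_into_at f (g x) ->
  smooth_into_at (f \o g) x.
Proof.
move=> hW sg [i [di sf]]; exists i; split.
  exact: smooth_at_continuous sg _ di.
exact: (@smooth_at_comp _ _ _ _ g (chart i \o f)).
Qed.

End OneManifold.

Section TwoManifolds.
Variables (n1 n2 : nat) (M : smoothManifold R n1) (Q : smoothManifold R n2).

Definition smooth_map_at (f : M -> Q) p :=
  exists i, dom i p /\ smooth_into_at (f \o chartV i) (chart i p).

Lemma smooth_map_atE (f : M -> Q) p j :
  smooth_map_at f p -> dom j p -> smooth_into_at (f \o chartV j) (chart j p).
Proof.
move=> [i [di sf]] dj.
have : smooth_into_at ((f \o chartV i) \o (chart i \o chartV j)) (chart j p).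
  apply: smooth_into_comp; [exact: has_basis_mx|exact: transition_smooth|].
  by rewrite /= chartK.
apply: smooth_into_near.
have := chartV_dom_near (open_nbhs_nbhs (conj (dom_open i) di)) dj.
by apply: filterS => x [_ dx _] /=; rewrite chartK.
Qed.

Lemma smooth_map_atP (f : M -> Q) (U : set M) :
  (forall p, U p -> smooth_map_at f p) -> smooth_map U f.
Proof.
move=> h i; apply: smooth_into_atP => _ [p [Up dp] <-].
by apply: smooth_map_atE => //; exact: h.
Qed.

End TwoManifolds.

End ManifoldMaps.

Lemma hausdorff_injective (X Y : topologicalType) (f : X -> Y) :
  continuous f -> injective f -> hausdorff_space Y -> hausdorff_space X.
Proof.
move=> cf fI; rewrite !open_hausdorff => hY x y xy.
have /hY[[A B] /= [xA yB] [oA oB AB0]] : f x != f y by apply: contra_neq xy => /fI.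
exists (f @^-1` A, f @^-1` B) => /=.
  by split; rewrite inE; [move: xA|move: yB]; rewrite inE.
split; [by apply: open_comp|by apply: open_comp|].
by rewrite -preimage_setI (eqP AB0) preimage_set0.
Qed.

(** * Subsets of matrix space as manifolds *)

Section Embedded.
Variables (R : realType) (N d : nat) (F : set 'M[R]_N).

(** The charts [amap] and the parametrizations [apar] are smooth on open sets of vector spaces, not
    merely on [F]. Continuity for the subspace topology and smoothness of transition maps thus
    reduce to ordinary calculus. *)
Record atlas := Atlas {
  aidx : Type;
  adom : aidx -> set 'M[R]_N;
  amap : aidx -> 'M[R]_N -> 'rV[R]_d;
  acod : aidx -> set 'rV[R]_d;
  apar : aidx -> 'rV[R]_d -> 'M[R]_N;
  adom_open : forall a, open (adom a);
  acod_open : forall a, open (acod a);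
  amap_smooth : forall a S, adom a S -> smooth_at (amap a) S;
  apar_smooth : forall a y, acod a y -> smooth_at (apar a) y;
  adom_cover : forall S, F S -> exists a, adom a S;
  amapP : forall a S, F S -> adom a S ->
    acod a (amap a S) /\ apar a (amap a S) = S;
  aparP : forall a y, acod a y ->
    [/\ F (apar a y), adom a (apar a y) & amap a (apar a y) = y]
}.

Variables (At : atlas) (S0 : 'M[R]_N) (FS0 : F S0).
Implicit Types (a : aidx At).

(** Off [F] the value is the base point [S0], which makes parametrizations total maps into [F]. *)
Definition fiber_pt (S : 'M[R]_N) : F := insubd (SigSub (mem_set FS0)) S.

Lemma fiber_ptK S : F S -> set_val (fiber_pt S) = S.
Proof. by move=> FS; rewrite set_valE /fiber_pt insubdK // inE. Qed.

Lemma fiber_valP (y : F) : F (set_val y).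
Proof. exact: set_valP. Qed.

Lemma fiber_valK (y : F) : fiber_pt (set_val y) = y.
Proof. by rewrite /fiber_pt set_valE valKd. Qed.

Let edom a : set F := [set y | adom a (set_val y)].
Let echart a (y : F) : 'rV[R]_d := amap a (set_val y).
Let echartV a (y : 'rV[R]_d) : F := fiber_pt (apar a y).

Let cval : continuous (set_val : F -> 'M[R]_N).
Proof. exact: initial_continuous. Qed.

Lemma continuous_fiber (X : topologicalType) (f : X -> F) x :
  {for x, continuous (set_val \o f)} -> {for x, continuous f}.
Proof.
move=> cf U [_ [[V oV <-] Vx] VU].
have h : \forall y \near x, V (set_val (f y)).
  exact: cf V (open_nbhs_nbhs (conj oV Vx)).
by change (\forall y \near x, U (f y)); apply: filterS h => y Vy; apply: VU.
Qed.

Lemma embedded_hausdorff : hausdorff_space F.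
Proof.
apply: (hausdorff_injective cval); last exact: norm_hausdorff.
by move=> x y; rewrite set_valE; exact: val_inj.
Qed.

Lemma embedded_second_countable : @second_countable F.
Proof.
have [b [ob nb]] := (second_countableP 'M[R]_N).1 (second_countable_mx R N N).
apply/second_countableP; exists (fun k => set_val @^-1` (b k)); split.
  by move=> k; apply: open_comp => //; move=> y _; exact: cval.
move=> x U [_ [[V oV <-] Vx] VU].
have [k [bk bV]] := nb _ _ (open_nbhs_nbhs (conj oV Vx)).
by exists k; split=> // y /bV/VU.
Qed.

Let edom_open a : open (edom a).
Proof. by apply: open_comp; [move=> y _; exact: cval|exact: adom_open]. Qed.

Let edom_cover y : exists a, edom a y.
Proof. exact/adom_cover/fiber_valP. Qed.

Let echart_image a : echart a @` edom a = acod a.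
Proof.
apply/seteqP; split=> [_ [y dy <-]|z az].
  by have [] := amapP (fiber_valP y) dy.
have [Fz dz ez] := aparP az; exists (fiber_pt (apar a z)).
  by rewrite /edom /= fiber_ptK.
by rewrite /echart fiber_ptK.
Qed.

Let echart_open a : open (echart a @` edom a).
Proof. by rewrite echart_image; exact: acod_open. Qed.

Let echartK a y : edom a y -> echartV a (echart a y) = y.
Proof.
move=> dy; have [_ e] := amapP (fiber_valP y) dy.
by rewrite /echartV /echart e fiber_valK.
Qed.

Let echart_continuous a y : edom a y -> {for y, continuous (echart a)}.
Proof.
move=> dy; apply: continuous_comp; first exact: cval.
exact/smooth_at_continuous/amap_smooth.
Qed.

Let apar_val_near a z : acod a z ->
  \forall z' \near z, set_val (echartV a z') = apar a z'.
Proof.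
move=> az; have := open_nbhs_nbhs (conj (@acod_open At a) az).
by apply: filterS => z' /aparP[Fz _ _]; rewrite fiber_ptK.
Qed.

Let echartV_continuous a y : edom a y -> {for echart a y, continuous (echartV a)}.
Proof.
move=> dy; apply: continuous_fiber; apply: smooth_at_continuous.
have az := (amapP (fiber_valP y) dy).1.
apply: smooth_at_near (apar_smooth az).
by apply: filterS (apar_val_near az).
Qed.

Let echart_smooth a b :
  smooth_on (echart a @` (edom a `&` edom b)) (echart b \o echartV a).
Proof.
apply: smooth_on_at => _ [y [dy dby] <-].
have [az e] := amapP (fiber_valP y) dy.
have : smooth_at (fun z => amap b (apar a z)) (echart a y).
  apply: smooth_at_comp; [exact: has_basis_mx|exact: apar_smooth|].
  by rewrite e; exact: amap_smooth.
by apply: smooth_at_near; apply: filterS (apar_val_near az) => z /= <-.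
Qed.

Definition embedded : smoothManifold R d :=
  SmoothManifold embedded_hausdorff embedded_second_countable edom_open
    edom_cover echart_open echartK echart_continuous echartV_continuous
    echart_smooth.

Definition fib_val (y : embedded) : 'M[R]_N := set_val (y : F).
Definition fib_pt (S : 'M[R]_N) : embedded := fiber_pt S.

Lemma fib_ptK S : F S -> fib_val (fib_pt S) = S.
Proof. exact: fiber_ptK. Qed.

Lemma fib_valP y : F (fib_val y).
Proof. exact: fiber_valP. Qed.

Lemma fib_valK y : fib_pt (fib_val y) = y.
Proof. exact: fiber_valK. Qed.

Lemma fib_val_smooth y : smooth_from_at fib_val y.
Proof.
have [a dy] := edom_cover y; exists a; split=> //.
have az := (amapP (fiber_valP y) dy).1.
apply: smooth_at_near (apar_smooth az).
by apply: filterS (apar_val_near az).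
Qed.

Lemma smooth_into_fib (V : normedModType R) (f : V -> embedded) x :
  smooth_at (fib_val \o f) x -> smooth_into_at f x.
Proof.
move=> sf; have [a dy] := edom_cover (f x); exists a; split.
  exact: (smooth_at_continuous sf (open_nbhs_nbhs (conj (@adom_open At a) dy))).
rewrite (_ : _ \o _ = fun y => amap a ((fib_val \o f) y)) //.
apply: smooth_at_comp => //; first exact: has_basis_mx.
exact: amap_smooth.
Qed.

(** The retraction is [apar o amap]. It turns ambient extensions of maps, whose values may leave
    [F], into maps with values in [F]. *)
Lemma fib_pt_retraction S : F S -> exists (W : set 'M[R]_N) (r : 'M[R]_N -> 'M[R]_N),
  [/\ open W, W S, forall S', W S' -> F (r S') /\ smooth_at r S' &
      forall S', W S' -> F S' -> r S' = S'].
Proof.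
move=> FS; have [a aS] := adom_cover At FS.
exists (adom a `&` amap a @^-1` acod a), (fun S => apar a (amap a S)); split.
- apply: open_setI_preimage; [exact: adom_open|exact: acod_open|].
  by move=> S' /amap_smooth/smooth_at_continuous.
- by split=> //; have [] := amapP FS aS.
- move=> S' [dS' cS']; have [FS' _ _] := aparP cS'; split=> //.
  by apply: smooth_at_comp; [exact: has_basis_mx|exact: amap_smooth|exact: apar_smooth].
- by move=> S' [dS' _] FS'; have [] := amapP FS' dS'.
Qed.

End Embedded.

(** * Manifolds and bundles obtained by gluing *)

Record gluing (R : realType) (d : nat) (T : choiceType) := Gluing {
  gidx : Type;
  gdom : gidx -> set T;
  gchart : gidx -> T -> 'rV[R]_d;
  gchartV : gidx -> 'rV[R]_d -> T;
  gcover : forall e, exists a, gdom a e;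
  gchartK : forall a e, gdom a e -> gchartV a (gchart a e) = e;
  gopen : forall a b, open (gchart a @` (gdom a `&` gdom b));
  gsmooth : forall a b,
    smooth_on (gchart a @` (gdom a `&` gdom b)) (gchart b \o gchartV a)
}.

Arguments gopen {R d T} g a b.
Arguments gsmooth {R d T} g a b _.

(** An alias of [T]: in the application [T] is a product of manifolds, whose product topology is not
    the wanted one, so the glued topology is attached to a separate name. *)
Definition glued (R : realType) (d : nat) (T : choiceType) (G : gluing R d T) : Type := T.

Section Glued.
Variables (R : realType) (d : nat) (T : choiceType) (G : gluing R d T).
Implicit Types (a b : gidx G).

(* The final topology for the inverses of the charts. *)
Definition glued_open : set (set T) :=
  [set U | forall a, open (gchart a @` (U `&` gdom a))].

Lemma gchart_image_open a : open (gchart a @` gdom a).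
Proof. by have := gopen G a a; rewrite setIid. Qed.

Lemma glued_openT : glued_open setT.
Proof. by move=> a; rewrite setTI; exact: gchart_image_open. Qed.

Lemma glued_openI : setI_closed glued_open.
Proof.
move=> U V oU oV a.
suff -> : gchart a @` (U `&` V `&` gdom a) =
    (gchart a @` (U `&` gdom a)) `&` (gchart a @` (V `&` gdom a)) by exact: openI.
apply/seteqP; split=> [_ [e [[Ue Ve] de] <-]|_ [[e [Ue de] <-] [f [Vf df] ef]]].
  by split; exists e.
have fe : f = e by rewrite -(gchartK df) ef gchartK.
by exists e => //; split=> //; split=> //; rewrite -fe.
Qed.

Lemma glued_open_bigU (I : Type) (f : I -> set T) :
  (forall i, glued_open (f i)) -> glued_open (\bigcup_i f i).
Proof.
move=> of_ a; rewrite setI_bigcupl image_bigcup.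
by apply: bigcup_open => i _; exact: of_.
Qed.

HB.instance Definition _ := Choice.copy (glued G) T.
HB.instance Definition _ :=
  isOpenTopological.Build (glued G) glued_openT glued_openI glued_open_bigU.

Lemma glued_openE (U : set (glued G)) :
  open U <-> forall a, open (gchart a @` (U `&` gdom a)).
Proof. by []. Qed.

Let tdom a : set (glued G) := gdom a.
Let tchart a : glued G -> 'rV[R]_d := gchart a.
Let tchartV a : 'rV[R]_d -> glued G := gchartV a.

Lemma gluing_transition a b e : gdom a e -> gdom b e ->
  smooth_at (gchart b \o gchartV a) (gchart a e).
Proof.
move=> da db; have := gsmooth G a b.
by move=> /(smooth_onP _ (gopen G a b)); apply; exists e.
Qed.

Lemma tdom_open a : open (tdom a).
Proof. by move=> b; rewrite setIC; exact: gopen. Qed.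

Lemma chart_preimage_open a (O : set 'rV[R]_d) : open O ->
  open (tdom a `&` tchart a @^-1` O).
Proof.
move=> oO; apply/glued_openE => b.
(* Seen in chart [b], the set is the part of the domain of the transition map to [a] that is sent
   into [O]. *)
rewrite [X in open X](_ : _ = (gchart b @` (gdom b `&` gdom a)) `&`
    (gchart a \o gchartV b) @^-1` O); last first.
  apply/seteqP; split=> [_ [e [[da Oe] db] <-]|_ [[e [db da] <-] /=]].
    by split; [exists e|rewrite /= gchartK].
  by rewrite gchartK // => Oe; exists e.
apply: open_setI_preimage => //; first exact: gopen.
by move=> _ [e [db da] <-]; exact/smooth_at_continuous/gluing_transition.
Qed.

Lemma tchart_continuous a e : tdom a e -> {for e, continuous (tchart a)}.
Proof.
move=> de U; rewrite nbhsE => -[W [oW We] WU].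
have := open_nbhs_nbhs (conj (@chart_preimage_open a _ oW) (conj de We)).
move=> h; change (\forall y \near e, U (tchart a y)).
by apply: filterS h => y [_ /WU].
Qed.

Lemma tchartV_continuous a e : tdom a e ->
  {for tchart a e, continuous (tchartV a)}.
Proof.
move=> de U; rewrite /tchartV /tchart gchartK // nbhsE => -[W [oW We] WU].
have oI : open (gchart a @` (W `&` gdom a)) by move/glued_openE: oW; apply.
have h := open_nbhs_nbhs (conj oI (imageP (gchart a) (conj We de))).
change (\forall y \near gchart a e, U (gchartV a y)).
by apply: filterS h => _ [y [Wy dy] <-]; rewrite gchartK //; exact: WU.
Qed.

Definition glued_manifold (hT : hausdorff_space (glued G))
    (cT : @second_countable (glued G)) : smoothManifold R d :=
  @SmoothManifold R d (glued G) hT cT (gidx G) tdom tchart tchartV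
    tdom_open (@gcover _ _ _ G) gchart_image_open (@gchartK _ _ _ G)
    tchart_continuous tchartV_continuous (@gsmooth _ _ _ G).

End Glued.

Lemma smooth_at_row_mx (R : realType) (V : normedModType R) m n1 n2
    (f : V -> 'M[R]_(m, n1)) (g : V -> 'M[R]_(m, n2)) x :
  smooth_at f x -> smooth_at g x -> smooth_at (fun y => row_mx (f y) (g y)) x.
Proof.
move=> sf sg.
have : smooth_at (fun y => f y *m row_mx 1%:M 0 + g y *m row_mx 0 1%:M) x.
  by apply: smooth_atD; apply: smooth_at_mulmx => //; exact: smooth_at_cst.
apply: smooth_at_ext => y.
by rewrite !mul_mx_row !mulmx1 !mulmx0 add_row_mx addr0 add0r.
Qed.

Lemma smooth_at_lsubmx (R : realType) m n1 n2 (x : 'M[R]_(m, n1 + n2)) :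
  smooth_at lsubmx x.
Proof. exact: (@smooth_at_mxlin _ _ _ _ _ _ lsubmx _ _ (smooth_at_id x)). Qed.

Lemma smooth_at_rsubmx (R : realType) m n1 n2 (x : 'M[R]_(m, n1 + n2)) :
  smooth_at rsubmx x.
Proof. exact: (@smooth_at_mxlin _ _ _ _ _ _ rsubmx _ _ (smooth_at_id x)). Qed.

Lemma invmx_mulmx (K : comUnitRingType) N (A B : 'M[K]_N) :
  A \in unitmx -> B \in unitmx -> invmx (A *m B) = invmx B *m invmx A.
Proof.
move=> uA uB; have uAB : A *m B \in unitmx by rewrite unitmx_mul uA.
by rewrite -[RHS]mulmx1 -(mulmxV uAB) !mulmxA mulmxKV // mulVmx // mul1mx.
Qed.

(** Row vectors of components satisfy [X_j = X_i t], so the components of an endomorphism change by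
    [S_j = t^-1 S_i t]. *)
Definition conjmx_by (R : realType) N (A S : 'M[R]_N) := invmx A *m S *m A.

(** * Fiber bundles glued along conjugation by a cocycle *)

Section Bundle.
Variables (R : realType) (n : nat) (M : smoothManifold R n).
Variables (N d : nat) (F : set 'M[R]_N) (At : atlas d F).
Variables (S0 : 'M[R]_N) (FS0 : F S0).
Variable t : idx M -> idx M -> M -> 'M[R]_N.
Hypothesis t_unit : forall i j p, dom i p -> dom j p -> t i j p \in unitmx.
Hypothesis t_cocycle : forall i j k p, dom i p -> dom j p -> dom k p ->
  t i j p *m t j k p = t i k p.
Hypothesis t_smooth : forall i j p, dom i p -> dom j p ->
  smooth_at (t i j \o chartV i) (chart i p).
Hypothesis t_stable : forall i j p S, dom i p -> dom j p -> F S ->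
  F (conjmx_by (t i j p) S).

Let Q := embedded At FS0.

Lemma t_id i p : dom i p -> t i i p = 1%:M.
Proof.
move=> di; have := t_cocycle di di di.
by move/(congr1 (mulmx (invmx (t i i p)))); rewrite mulKmx ?mulVmx // t_unit.
Qed.

Lemma conjmx_byM (A B S : 'M[R]_N) : A \in unitmx -> B \in unitmx ->
  conjmx_by B (conjmx_by A S) = conjmx_by (A *m B) S.
Proof. by move=> uA uB; rewrite /conjmx_by invmx_mulmx // !mulmxA. Qed.

(* A point over p is recorded by its matrix in the arbitrarily chosen chart
   home p. *)
Definition home (p : M) : idx M := sval (cid (dom_cover p)).

Lemma homeP p : dom (home p) p.
Proof. exact: (svalP (cid (dom_cover p))). Qed.

Let T : choiceType := (M * Q)%type.

Definition bcomp (i : idx M) (e : T) : 'M[R]_N :=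
  conjmx_by (t (home e.1) i e.1) (fib_val e.2).

Definition bpoint (i : idx M) (p : M) (S : 'M[R]_N) : T :=
  (p, fib_pt At FS0 (conjmx_by (t i (home p) p) S)).

Lemma bcompF i e : dom i e.1 -> F (bcomp i e).
Proof. by move=> di; apply: t_stable => //; [exact: homeP|exact: fib_valP]. Qed.

Lemma bpointK i p S : dom i p -> F S -> bcomp i (bpoint i p S) = S.
Proof.
move=> di FS; have dh := homeP p; rewrite /bcomp /=.
rewrite (@fib_ptK _ _ _ _ At S0 FS0 _ (t_stable di dh FS)).
rewrite conjmx_byM ?t_unit // t_cocycle // t_id //.
by rewrite /conjmx_by invmx1 mul1mx mulmx1.
Qed.

Lemma bcompK i e : dom i e.1 -> bpoint i e.1 (bcomp i e) = e.
Proof.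
case: e => p y /= di; have dh := homeP p; rewrite /bpoint /bcomp /=; congr pair.
rewrite conjmx_byM ?t_unit // t_cocycle // t_id //.
by rewrite /conjmx_by invmx1 mul1mx mulmx1; exact: fib_valK.
Qed.

Lemma bcomp_transition i j e : dom i e.1 -> dom j e.1 ->
  bcomp j e = conjmx_by (t i j e.1) (bcomp i e).
Proof.
move=> di dj; have dh := homeP e.1.
by rewrite /bcomp conjmx_byM ?t_unit // t_cocycle.
Qed.

Let bidx := (idx M * aidx At)%type.
Definition bdom (k : bidx) : set T :=
  [set e | dom k.1 e.1 /\ adom k.2 (bcomp k.1 e)].
Definition bchart (k : bidx) (e : T) : 'rV[R]_(n + d) :=
  row_mx (chart k.1 e.1) (amap k.2 (bcomp k.1 e)).
Definition bchartV (k : bidx) (z : 'rV[R]_(n + d)) : T :=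
  bpoint k.1 (chartV k.1 (lsubmx z)) (apar k.2 (rsubmx z)).

Lemma bchartK k e : bdom k e -> bchartV k (bchart k e) = e.
Proof.
move=> [di da]; rewrite /bchartV /bchart row_mxKl row_mxKr chartK //.
by have [_ ->] := amapP (bcompF di) da; exact: bcompK.
Qed.

(** Gathers what holds for all coordinates near a chart image, so that later proofs can ignore the
    values of charts outside their domains. *)
Lemma bchartV_near k e (U : set M) : bdom k e -> nbhs e.1 U ->
  \forall z \near bchart k e, [/\ dom k.1 (bchartV k z).1, U (bchartV k z).1,
    bcomp k.1 (bchartV k z) = apar k.2 (rsubmx z) &
    bdom k (bchartV k z) /\ bchart k (bchartV k z) = z].
Proof.
move=> [di da] nU; have [ca _] := amapP (bcompF di) da.
have h1 : \forall z \near bchart k e, [/\ dom k.1 (chartV k.1 (lsubmx z)),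
    U (chartV k.1 (lsubmx z)) & chart k.1 (chartV k.1 (lsubmx z)) = lsubmx z].
  have cl : {for bchart k e, continuous (@lsubmx R 1 n d)}.
    exact/smooth_at_continuous/smooth_at_lsubmx.
  apply: (cl [set x | [/\ dom k.1 (chartV k.1 x), U (chartV k.1 x) &
    chart k.1 (chartV k.1 x) = x]]).
  by rewrite /bchart row_mxKl; exact: chartV_dom_near.
have h2 : \forall z \near bchart k e, acod k.2 (rsubmx z).
  have cr : {for bchart k e, continuous (@rsubmx R 1 n d)}.
    exact/smooth_at_continuous/smooth_at_rsubmx.
  by apply: (cr (acod k.2)); rewrite /bchart row_mxKr; apply: open_nbhs_nbhs; split=> //; exact: acod_open.
apply: filterS2 h1 h2 => z [d1 U1 e1] c2; have [Fz az ez] := aparP c2.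
have e3 : bcomp k.1 (bchartV k z) = apar k.2 (rsubmx z) by exact: bpointK.
split=> //; split; first by split=> //; rewrite e3.
by rewrite /bchart e3 ez /= e1 hsubmxK.
Qed.

(** In coordinates the components in chart [j] are [t^-1 S t], with [t] the transition matrix over
    the base coordinate and [S] the parametrized fiber coordinate, a product of smooth factors. *)
Lemma bcomp_smooth k e j : bdom k e -> dom j e.1 ->
  smooth_at (bcomp j \o bchartV k) (bchart k e).
Proof.
move=> dk dj; have [di da] := dk; have [ca ea] := amapP (bcompF di) da.
pose f (z : 'rV[R]_(n + d)) := (t k.1 j \o chartV k.1) (lsubmx z).
have st : smooth_at f (bchart k e).
  apply: smooth_at_comp; first exact: has_basis_mx.
    exact: smooth_at_lsubmx.
  by rewrite /bchart row_mxKl; exact: t_smooth.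
have sp : smooth_at (fun z => apar k.2 (rsubmx z)) (bchart k e).
  apply: smooth_at_comp; first exact: has_basis_mx.
    exact: smooth_at_rsubmx.
  by rewrite /bchart row_mxKr; exact: apar_smooth.
have ut : f (bchart k e) \in unitmx.
  by rewrite /f /= /bchart row_mxKl chartK // t_unit.
have := smooth_at_mulmx (smooth_at_mulmx (smooth_at_invmx ut st) sp) st.
apply: smooth_at_near.
have := bchartV_near dk (open_nbhs_nbhs (conj (@dom_open _ _ M j) dj)).
apply: filterS => z [d1 d2 e1 _].
by rewrite /= (bcomp_transition d1 d2) e1.
Qed.

Lemma bpr_smooth k e : bdom k e ->
  smooth_into_at (fst \o bchartV k) (bchart k e).
Proof.
move=> dk; have [di da] := dk.
have : smooth_into_at (chartV k.1 \o (@lsubmx R 1 n d)) (bchart k e).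
  apply: smooth_into_comp; first exact: has_basis_mx.
    exact: smooth_at_lsubmx.
  by rewrite /bchart row_mxKl; exact: smooth_into_chartV.
exact.
Qed.

Lemma bdom_near k l e : bdom k e -> bdom l e ->
  \forall z \near bchart k e, bdom l (bchartV k z).
Proof.
move=> dk [dl al].
have s1 := smooth_at_continuous (bcomp_smooth dk dl).
have h1 : \forall z \near bchart k e, adom l.2 (bcomp l.1 (bchartV k z)).
  by apply: (s1 (adom l.2)); rewrite /= bchartK //; apply: open_nbhs_nbhs; split=> //; exact: adom_open.
have := bchartV_near dk (open_nbhs_nbhs (conj (@dom_open _ _ M l.1) dl)).
by apply: filterS2 h1 => z az [_ d2 _ _].
Qed.

Lemma bopen k l : open (bchart k @` (bdom k `&` bdom l)).
Proof.
rewrite openE => _ [e [dk dl] <-].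
have := bchartV_near dk (@filterT _ _ (nbhs_filter e.1)).
apply: filterS2 (bdom_near dk dl) => z dl' [_ _ _ [dk' ez]].
by exists (bchartV k z).
Qed.

Lemma bchart_smooth (V : normedModType R) (f : V -> T) x k :
  smooth_into_at (fst \o f) x -> dom k.1 (f x).1 -> smooth_at (bcomp k.1 \o f) x ->
  adom k.2 (bcomp k.1 (f x)) -> smooth_at (bchart k \o f) x.
Proof.
move=> s1 d1 s2 a2; apply: smooth_at_row_mx.
  exact: (smooth_into_atE s1).
apply: (@smooth_at_comp _ _ _ _ (bcomp k.1 \o f) (amap k.2)) => //; first exact: has_basis_mx.
exact: amap_smooth.
Qed.

Lemma bsmooth k l :
  smooth_on (bchart k @` (bdom k `&` bdom l)) (bchart l \o bchartV k).
Proof.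
apply: smooth_on_at => _ [e [dk dl] <-]; have [dl1 dl2] := dl.
apply: bchart_smooth; [exact: bpr_smooth|by rewrite bchartK| |by rewrite bchartK].
exact: bcomp_smooth.
Qed.

Lemma bcover e : exists k, bdom k e.
Proof.
have [i di] := dom_cover e.1; have [a da] := adom_cover At (bcompF di).
by exists (i, a).
Qed.

Definition bundle_gluing : gluing R (n + d) T :=
  @Gluing _ _ T bidx bdom bchart bchartV bcover bchartK bopen bsmooth.

Let G := glued bundle_gluing.

Lemma glued_bdom_open k : open (bdom k : set G).
Proof. exact: (@tdom_open _ _ _ bundle_gluing k). Qed.

Lemma glued_bdom_near k (e : G) : bdom k e -> \forall f \near e, bdom k f.
Proof. by move=> de; apply: open_nbhs_nbhs; split=> //; exact: glued_bdom_open. Qed.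

Lemma glued_bchart_continuous k (e : G) : bdom k e -> {for e, continuous (bchart k : G -> _)}.
Proof. exact: (@tchart_continuous _ _ _ bundle_gluing k). Qed.

Lemma glued_pr_continuous : continuous (fst : G -> M).
Proof.
move=> e; have [k dk] := bcover e.
have c : {for e, continuous ((fst \o bchartV k) \o (bchart k : G -> _))}.
  apply: continuous_comp; first exact: glued_bchart_continuous.
  exact/smooth_into_at_continuous/bpr_smooth.
have h : {near (e : G), (fst : G -> M) =1 (fst \o bchartV k) \o (bchart k : G -> _)}.
  by apply: filterS (glued_bdom_near dk) => f df; rewrite -[in LHS](bchartK df).
exact: continuous_near h c.
Qed.

Lemma glued_comp_continuous i (e : G) : dom i e.1 ->
  {for e, continuous (bcomp i : G -> _)}.
Proof.
move=> di; have [k dk] := bcover e.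
have c : {for e, continuous ((bcomp i \o bchartV k) \o (bchart k : G -> _))}.
  apply: continuous_comp; first exact: glued_bchart_continuous.
  exact/smooth_at_continuous/bcomp_smooth.
have h : {near (e : G), (bcomp i : G -> _) =1 (bcomp i \o bchartV k) \o (bchart k : G -> _)}.
  by apply: filterS (glued_bdom_near dk) => f df; rewrite -[in LHS](bchartK df).
exact: continuous_near h c.
Qed.

(** Points over different base points are separated in [M]; points over the same base point are
    separated by their component matrices in a common chart. *)
Lemma bundle_hausdorff : hausdorff_space G.
Proof.
rewrite open_hausdorff => e f ef.
have [e1|n1] := eqVneq (e : T).1 (f : T).1; last first.
  have := @points_hausdorff _ _ M; rewrite open_hausdorff.
  move=> /(_ _ _ n1)[[A B] /= [eA fB] [oA oB /eqP AB]].
  exists ((fst : G -> M) @^-1` A, (fst : G -> M) @^-1` B) => /=.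
    by split; rewrite inE; [move: eA|move: fB]; rewrite inE.
  split; [apply: open_comp => //; move=> z _; exact: glued_pr_continuous
         |apply: open_comp => //; move=> z _; exact: glued_pr_continuous|].
  by apply/eqP; rewrite -preimage_setI AB preimage_set0.
have [i di] := dom_cover (e : T).1; have di' : dom i (f : T).1 by rewrite -e1.
have n2 : bcomp i e != bcomp i f.
  by apply: contra_neq ef => h; rewrite -(bcompK di) -(bcompK di') h e1.
have := @norm_hausdorff R 'M[R]_N; rewrite open_hausdorff.
move=> /(_ _ _ n2)[[A B] /= [eA fB] [oA oB /eqP AB]].
pose D : set G := (fst : G -> M) @^-1` dom i.
have oD : open D.
  by apply: open_comp; [move=> z _; exact: glued_pr_continuous|exact: dom_open].
exists (D `&` (bcomp i : G -> _) @^-1` A, D `&` (bcomp i : G -> _) @^-1` B) => /=.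
  by split; rewrite inE; split=> //; [move: eA|move: fB]; rewrite inE.
split.
- by apply: (open_setI_preimage oD oA) => z; exact: glued_comp_continuous.
- by apply: (open_setI_preimage oD oB) => z; exact: glued_comp_continuous.
- apply/eqP; rewrite setIACA setIid -preimage_setI AB preimage_set0.
  by rewrite setI0.
Qed.

(** The set of charts may be uncountable, so one chart is chosen for each member of a countable base
    of [M] that lies in some chart domain. Boxes formed from a base set inside that domain and a
    base set of matrices are countable in number and refine every neighbourhood. *)
Lemma bundle_second_countable : @second_countable G.
Proof.
have [b [ob nb]] := (second_countableP M).1 (@points_second_countable _ _ M).
have [c [oc nc]] := (second_countableP 'M[R]_N).1 (second_countable_mx R N N).
pose sub u i := b u `<=` dom i.
pose ch u : option (idx M) :=
  if pselect (exists i, sub u i) is left h then Some (sval (cid h)) else None.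
have chP u i : ch u = Some i -> sub u i.
  by rewrite /ch; case: pselect => // h [<-]; exact: (svalP (cid h)).
pose box (i : idx M) (U : set M) (V : set 'M[R]_N) : set G :=
  ((fst : G -> M) @^-1` U) `&` (bcomp i : G -> _) @^-1` V.
pose B (uvw : nat * nat * nat) : set G :=
  if ch uvw.1.1 is Some i then box i (b uvw.1.1 `&` b uvw.1.2) (c uvw.2) else set0.
apply: (@second_countable_countType _ _ B) => [[[u v] w]|e U nU].
  rewrite /B /=; case E : (ch u) => [i|]; last exact: open0.
  have oU : open ((fst : G -> M) @^-1` (b u `&` b v)).
    by apply: open_comp; [move=> z _; exact: glued_pr_continuous|exact: openI].
  apply: (open_setI_preimage oU (oc w)) => z [bz _].
  by apply: glued_comp_continuous; exact: (chP _ _ E).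
have [i0 di0] := dom_cover (e : T).1.
have [u [bu su]] := nb _ _ (open_nbhs_nbhs (conj (dom_open i0) di0)).
have [i E] : exists i, ch u = Some i.
  rewrite /ch; case: pselect => [h|]; first by exists (sval (cid h)).
  by case; exists i0.
have ui := chP _ _ E; have di := ui _ bu.
have [a da] := adom_cover At (bcompF di).
have dk : bdom (i, a) e by [].
have cV : nbhs (bchart (i, a) e) [set z | U (bchartV (i, a) z)].
  have := @tchartV_continuous _ _ _ bundle_gluing (i, a) e dk U.
  rewrite /= bchartK //; exact.
(* The bundle chart is a continuous function of the base point and the component matrix, so the
   inverse image of a neighbourhood contains a product [P1 x P2] of neighbourhoods. *)
pose h (pS : M * 'M[R]_N) : 'rV[R]_(n + d) := row_mx (chart i pS.1) (amap a pS.2).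
have ch2 : {for ((e : T).1, bcomp i e), continuous h}.
  have crow : continuous (fun z : 'rV[R]_n * 'rV[R]_d => row_mx z.1 z.2).
    move=> z; apply/smooth_at_continuous/smooth_at_row_mx.
      exact: smooth_at_fst.
    exact: smooth_at_snd.
  have c1 : {for ((e : T).1, bcomp i e), continuous (chart i \o (@fst M 'M[R]_N))}.
    by apply: continuous_comp; [exact: cvg_fst|exact: chart_continuous].
  have c2 : {for ((e : T).1, bcomp i e), continuous (amap a \o (@snd M 'M[R]_N))}.
    by apply: continuous_comp; [exact: cvg_snd|exact/smooth_at_continuous/amap_smooth].
  exact: continuous_comp (cvg_pair c1 c2) (crow _).
have nA : nbhs (bcomp i e) (adom a).
  by apply: open_nbhs_nbhs; split=> //; exact: adom_open.
have [[P1 P2] /= [nP1 nP2] PU] := ch2 _ cV.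
have [v [bv sv]] := nb _ _ nP1.
have [w [cw sw]] := nc _ _ (filterI nP2 nA).
exists (u, v, w); rewrite /B /= E; split; first by split.
move=> f [[fu fv] /sw[f2 fa]].
have df : bdom (i, a) f by split=> //; exact: ui.
by have := PU ((f : T).1, bcomp i f) (conj (sv _ fv) f2); rewrite /= -/(bchart (i, a) f) bchartK.
Qed.

Definition bundle : smoothManifold R (n + d) :=
  glued_manifold bundle_hausdorff bundle_second_countable.

Definition bundle_pr (e : bundle) : M := (e : T).1.
Definition bundle_comp (i : idx M) (e : bundle) : 'M[R]_N := bcomp i e.
Definition bundle_point (i : idx M) (p : M) (S : 'M[R]_N) : bundle := bpoint i p S.

Lemma smooth_into_bundle (V : normedModType R) (f : V -> bundle) x i :
  smooth_into_at (bundle_pr \o f) x -> dom i (bundle_pr (f x)) ->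
  smooth_at (bundle_comp i \o f) x -> smooth_into_at f x.
Proof.
move=> s1 di s2; have [a da] := adom_cover At (bcompF di).
exists ((i, a) : idx bundle); split; last exact: (@bchart_smooth _ f x (i, a)).
have h := continuous_near_open (smooth_at_continuous s2) (@adom_open _ _ _ _ At a) da.
by apply: filterS2 (smooth_into_dom s1 di) h => y.
Qed.

Lemma bundle_pr_smooth e : smooth_map_at bundle_pr e.
Proof.
have [k dk] := bcover e; exists (k : idx bundle); split=> //.
exact: bpr_smooth.
Qed.

Lemma bundle_comp_smooth i e : dom i (bundle_pr e) ->
  smooth_from_at (bundle_comp i) e.
Proof.
move=> di; have [k dk] := bcover e; exists (k : idx bundle); split=> //.
exact: bcomp_smooth.
Qed.

Lemma bundle_compF i e : dom i (bundle_pr e) -> F (bundle_comp i e).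
Proof. exact: bcompF. Qed.

Lemma bundle_pointK i p S : dom i p -> F S -> bundle_comp i (bundle_point i p S) = S.
Proof. exact: bpointK. Qed.

Lemma bundle_compK i e : dom i (bundle_pr e) ->
  bundle_point i (bundle_pr e) (bundle_comp i e) = e.
Proof. exact: bcompK. Qed.

Lemma bundle_comp_transition i j e : dom i (bundle_pr e) -> dom j (bundle_pr e) ->
  bundle_comp j e = conjmx_by (t i j (bundle_pr e)) (bundle_comp i e).
Proof. exact: bcomp_transition. Qed.

Lemma bundle_fiber_bundle : fiber_bundle Q bundle_pr.
Proof.
split; first by apply: smooth_map_atP => e _; exact: bundle_pr_smooth.
move=> p; have [i di] := dom_cover p.
exists (dom i), (fun e => fib_pt At FS0 (bundle_comp i e)),
  (fun p y => bundle_point i p (fib_val y)); split.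
- by split=> //; exact: dom_open.
- apply: smooth_map_atP => e /= de.
  have [k dk] := bcover e; exists (k : idx bundle); split=> //.
  apply: smooth_into_fib.
  have := bcomp_smooth dk de; apply: smooth_at_near.
  have := bchartV_near dk (open_nbhs_nbhs (conj (@dom_open _ _ M i) de)).
  by apply: filterS => z [_ d2 _ _]; rewrite /= fib_ptK //; exact: bcompF.
- move=> k a; apply: smooth_into_atP => -[x y] [/= [q [dq dk] ex] [y' dy' ey]].
  have sx : smooth_into_at (chartV k \o (@fst 'rV[R]_n 'rV[R]_d)) (x, y).
    apply: smooth_into_comp; [exact: has_basis_mx|exact: smooth_at_fst|].
    by rewrite /= -ex; exact: smooth_into_chartV.
  have sy : smooth_at (fun z : 'rV[R]_n * 'rV[R]_d => (@fib_val _ _ _ _ At _ FS0 \o chartV a) z.2) (x, y).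
    apply: smooth_at_comp; [exact: has_basis_mx|exact: smooth_at_snd|].
    rewrite /= -ey; exact: (smooth_from_atE (fib_val_smooth (y' : Q)) dy').
  have ekq : chartV k x = q by rewrite -ex chartK.
  apply: (@smooth_into_bundle _ _ _ i).
  + exact: sx.
  + by rewrite /bundle_pr /= ekq.
  + apply: smooth_at_near sy.
    have : \forall z \near (x, y), dom i ((chartV k \o (@fst 'rV[R]_n 'rV[R]_d)) z).
      by apply: smooth_into_dom sx _; rewrite /= ekq.
    by apply: filterS => z dz; rewrite /= bundle_pointK //; exact: fib_valP.
- by move=> q y dq; split=> //; rewrite bundle_pointK ?fib_valK //; exact: fib_valP.
- move=> e de; rewrite fib_ptK; last exact: bundle_compF.
  exact: bundle_compK.
Qed.

Lemma bundle_retraction e i : dom i (bundle_pr e) ->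
  exists (W : set ('rV[R]_n * 'M[R]_N)) (r : 'rV[R]_n * 'M[R]_N -> bundle),
    [/\ open W, W (chart i (bundle_pr e), bundle_comp i e), smooth_into W r &
      forall e', dom i (bundle_pr e') -> W (chart i (bundle_pr e'), bundle_comp i e') ->
        r (chart i (bundle_pr e'), bundle_comp i e') = e'].
Proof.
move=> di; have [W [r [oW We sr rW]]] := fib_pt_retraction At (bundle_compF di).
exists ((chart i @` dom i) `*` W),
  (fun z => bundle_point i (chartV i z.1) (r z.2)); split.
- rewrite openE => -[x A] [/= xi WA]; exists (chart i @` dom i, W) => //=.
  by split; apply: open_nbhs_nbhs; split=> //; exact: chart_open.
- by split=> //; exists (bundle_pr e).
- apply: smooth_into_atP => -[x A] [/= [q dq ex] WA].
  have [FrA srA] := sr _ WA.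
  have sx : smooth_into_at (chartV i \o (@fst 'rV[R]_n 'M[R]_N)) (x, A).
    apply: smooth_into_comp; [exact: has_basis_mx|exact: smooth_at_fst|].
    by rewrite /= -ex; exact: smooth_into_chartV.
  have sA : smooth_at (fun z : 'rV[R]_n * 'M[R]_N => r z.2) (x, A).
    by apply: smooth_at_comp; [exact: has_basis_mx|exact: smooth_at_snd|].
  have dx : dom i (chartV i x) by rewrite -ex chartK.
  apply: (@smooth_into_bundle _ _ _ i) => //.
  apply: smooth_at_near sA.
  have hW : \forall z \near (x, A), W (snd z).
    by apply: (@cvg_snd _ _ (nbhs x) (nbhs A)); apply: open_nbhs_nbhs.
  apply: filterS2 (smooth_into_dom sx dx) hW => z dz Wz.
  by rewrite /= bundle_pointK //; have [] := sr _ Wz.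
- move=> e' de' [_ /= We']; rewrite chartK // rW //; last exact: bundle_compF.
  exact: bundle_compK.
Qed.

Lemma bundle_section (S : idx M -> M -> 'M[R]_N) :
  (forall i j p, dom i p -> dom j p -> S j p = conjmx_by (t i j p) (S i p)) ->
  (forall i p, dom i p -> F (S i p)) ->
  (forall i, smooth_from (dom i) (S i)) ->
  exists2 s : M -> bundle, smooth_section bundle_pr s &
    forall i p, dom i p -> bundle_comp i (s p) = S i p.
Proof.
move=> trS FS smS; pose s p : bundle := bundle_point (home p) p (S (home p) p).
have sE i p : dom i p -> bundle_comp i (s p) = S i p.
  move=> di; have dh := homeP p.
  rewrite (@bundle_comp_transition (home p)) // bundle_pointK ?FS //.
    by rewrite -trS.
  exact: FS.
exists s; last exact: sE.
split; last by [].
apply: smooth_map_atP => p _.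
have [i di] := dom_cover p; exists i; split=> //.
apply: (@smooth_into_bundle _ _ _ i); first exact: smooth_into_chartV.
  by rewrite /= chartK.
have := smooth_from_atE (smooth_from_open (dom_open i) (smS i) di) di.
apply: smooth_at_near.
have := chartV_dom_near (open_nbhs_nbhs (conj (dom_open i) di)) di.
by apply: filterS => x [_ dx _] /=; rewrite sE.
Qed.

End Bundle.

(** * Orbits as homogeneous spaces *)

Definition re_im (R : realType) n (g : 'M[R[i]]_n) := (Re_mx g, Im_mx g).

Lemma re_imK (R : realType) n : cancel (@re_im R n) (@cplx_mx R n n).
Proof. by move=> g; apply/matrixP => i j; rewrite !mxE; case: (g i j). Qed.

Lemma cplx_mxK (R : realType) n : cancel (@cplx_mx R n n) (@re_im R n).
Proof. by case=> X Y; congr pair; apply/matrixP => i j; rewrite !mxE. Qed.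

Section Orbit.
Variables (R : realType) (N : nat) (B J S0 : 'M[R]_N) (lam : R).
Hypotheses (uB : B \in unitmx) (lam0 : lam != 0) (S0S0 : S0 *m S0 = lam%:M).
Hypotheses (S0J : S0 *m J = - (J *m S0)) (S0B : S0 *m B = - (B *m S0^T)).

Definition isom_group : set 'M[R]_N :=
  [set g | [/\ g \in unitmx, g *m B *m g^T = B & g *m J = J *m g]].

Definition orbit_set : set 'M[R]_N :=
  [set S | exists2 g, isom_group g & S = g *m S0 *m invmx g].

Lemma isom_group1 : isom_group 1%:M.
Proof. by split; rewrite ?unitmx1 ?trmx1 ?mulmx1 ?mul1mx. Qed.

Lemma isom_groupM g h : isom_group g -> isom_group h -> isom_group (g *m h).
Proof.
move=> [ug gB gJ] [uh hB hJ]; split; first by rewrite unitmx_mul ug.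
  by rewrite trmx_mul !mulmxA -2!(mulmxA g) hB.
by rewrite -mulmxA hJ !mulmxA gJ.
Qed.

Lemma isom_groupV g : isom_group g -> isom_group (invmx g).
Proof.
move=> [ug gB gJ]; split; first by rewrite unitmx_inv.
  rewrite -[X in _ *m X *m _]gB trmx_inv !mulmxA mulVmx // mul1mx.
  by rewrite mulmxK // unitmx_tr.
by apply: (canRL (mulmxK ug)); rewrite -mulmxA -gJ mulKmx.
Qed.

Lemma orbit_self : orbit_set S0.
Proof. by exists 1%:M; [exact: isom_group1|rewrite invmx1 mul1mx mulmx1]. Qed.

Lemma orbit_conj g S : isom_group g -> orbit_set S ->
  orbit_set (g *m S *m invmx g).
Proof.
move=> Lg [h Lh ->]; exists (g *m h); first exact: isom_groupM.
by have [ug _ _] := Lg; have [uh _ _] := Lh; rewrite invmx_mulmx // !mulmxA.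
Qed.

Lemma orbit_conjV g S : isom_group g -> orbit_set S ->
  orbit_set (invmx g *m S *m g).
Proof. by move=> /isom_groupV Lg FS; have := orbit_conj Lg FS; rewrite invmxK. Qed.

Lemma S0_unit : S0 \in unitmx.
Proof.
have : S0 *m S0 \in unitmx by rewrite S0S0 unitmxE det_scalar unitfE expf_neq0.
by rewrite unitmx_mul => /andP[].
Qed.

Lemma orbit_square S : orbit_set S -> S *m S = lam%:M.
Proof.
move=> [g [ug _ _] ->]; rewrite !mulmxA mulmxKV // -(mulmxA g S0) S0S0.
by rewrite scalar_mxC -mulmxA mulmxV // mulmx1.
Qed.

Lemma orbit_J S : orbit_set S -> S *m J = - (J *m S).
Proof.
move=> [g Lg ->]; have [ug _ gJ] := Lg; have [_ _ gJ'] := isom_groupV Lg.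
by rewrite -mulmxA gJ' !mulmxA -(mulmxA g) S0J mulmxN !mulmxA gJ !mulNmx.
Qed.

Lemma orbit_B S : orbit_set S -> S *m B = - (B *m S^T).
Proof.
move=> [g Lg ->]; have [ug gB _] := Lg.
have ugT : g^T \in unitmx by rewrite unitmx_tr.
have hB : invmx g *m B = B *m g^T.
  by rewrite -[X in _ *m X = _]gB !mulmxA mulVmx // mul1mx.
have hB' : g *m B = B *m invmx g^T by rewrite -[X in _ = X *m _]gB mulmxK.
rewrite -mulmxA hB !mulmxA -(mulmxA g) S0B mulmxN !mulmxA hB' !mulNmx.
by rewrite !trmx_mul trmx_inv !mulmxA.
Qed.

(* The Cayley chart centred at S0 takes its values in the tangent space of the
   orbit. *)
Definition cayley (S : 'M[R]_N) : 'M[R]_N := (S - S0) *m invmx (S + S0).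
Definition cayleyV (Y : 'M[R]_N) : 'M[R]_N :=
  (1%:M + Y) *m S0 *m invmx (1%:M + Y).

Definition tangent : set 'M[R]_N :=
  [set Y | [/\ Y *m J = J *m Y, Y *m S0 = - (S0 *m Y) & Y *m B = - (B *m Y^T)]].

(** Since [S^2 = S0^2], the difference [D] and the sum [T] anticommute, so [Y = D T^-1] anticommutes
    with both and hence with [S0 = (T - D) / 2]. Both [D] and [T] anticommute with [J], so [Y]
    commutes with it; both are skew for [B], and reordering the factors of the adjoint makes [Y]
    skew as well. *)
Lemma cayley_tangent S : orbit_set S -> S + S0 \in unitmx -> tangent (cayley S).
Proof.
move=> FS uT; have SS := orbit_square FS; have SJ := orbit_J FS; have SB := orbit_B FS.
set D := S - S0; set T := S + S0 in uT *.
have DT : D *m T = - (T *m D).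
  by rewrite /D /T !(mulmxDl, mulmxDr, mulmxN, mulNmx) SS S0S0; mx_abel.
have iTD : invmx T *m D = - (D *m invmx T).
  apply: (canLR (mulKmx uT)); rewrite mulmxN mulmxA.
  by rewrite -mulNmx -DT mulmxK.
have DJ : D *m J = - (J *m D) by rewrite /D mulmxBl mulmxBr SJ S0J opprB addrC opprK.
have TJ : T *m J = - (J *m T) by rewrite /T mulmxDl mulmxDr SJ S0J opprD.
have iTJ : invmx T *m J = - (J *m invmx T).
  apply: (canLR (mulKmx uT)); rewrite mulmxN mulmxA TJ mulNmx opprK.
  by rewrite mulmxK.
have DB : D *m B = - (B *m D^T).
  by rewrite /D linearB /= mulmxBl mulmxBr SB S0B opprB addrC opprK.
have TB : T *m B = - (B *m T^T).
  by rewrite /T linearD /= mulmxDl mulmxDr SB S0B opprD.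
have uTT : T^T \in unitmx by rewrite unitmx_tr.
have iTB : invmx T *m B = - (B *m invmx T^T).
  apply: (canLR (mulKmx uT)); rewrite mulmxN mulmxA TB mulNmx opprK.
  by rewrite mulmxK.
have e0 : S0 = 2^-1 *: (T - D).
  by apply/matrixP => i j; rewrite /T /D !mxE; field.
have -> : cayley S = D *m invmx T by [].
clearbody D T; split.
- by rewrite -mulmxA iTJ mulmxN !mulmxA DJ mulNmx opprK.
- have TiTD : T *m D *m invmx T = - D by rewrite -[T *m D]opprK -DT mulNmx mulmxK.
  rewrite e0 -scalemxAr -scalemxAl -scalerN; congr (_ *: _).
  have h : D *m invmx T *m D = - (D *m D *m invmx T) by rewrite -mulmxA iTD mulmxN mulmxA.
  by rewrite mulmxBr mulmxBl mulmxKV // !mulmxA TiTD h; mx_abel.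
- rewrite -mulmxA iTB mulmxN !mulmxA DB mulNmx opprK.
  have := congr1 trmx iTD; rewrite linearN /= !trmx_mul trmx_inv => h.
  by rewrite -mulmxA h mulmxN.
Qed.

Lemma cayley_half S : S + S0 \in unitmx ->
  1%:M + cayley S = (S + S) *m invmx (S + S0).
Proof.
move=> uT; rewrite -(mulmxK uT (1%:M + cayley S)); congr (_ *m _).
by rewrite mulmxDl mul1mx mulmxKV // addrACA subrr addr0.
Qed.

Lemma double_unit (S : 'M[R]_N) : S \in unitmx -> S + S \in unitmx.
Proof. by move=> uS; rewrite -mulr2n -scaler_nat unitmxZ // unitfE pnatr_eq0. Qed.

(** With [Y] the Cayley image, [S0 (S + S0) = (S + S0) S] and [1 + Y = 2 S (S + S0)^-1] give
    [(1 + Y) S0 = S (1 + Y)]. *)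
Lemma cayleyK S : orbit_set S -> S + S0 \in unitmx ->
  1%:M + cayley S \in unitmx /\ cayleyV (cayley S) = S.
Proof.
move=> FS uT; have SS := orbit_square FS.
have uS : S \in unitmx.
  have : S *m S \in unitmx by rewrite SS unitmxE det_scalar unitfE expf_neq0.
  by rewrite unitmx_mul => /andP[].
have u1 : 1%:M + cayley S \in unitmx.
  by rewrite cayley_half // unitmx_mul unitmx_inv uT double_unit.
split=> //; apply: (canLR (mulmxK u1)).
rewrite cayley_half // mulmxA; apply: (canRL (mulmxK uT)).
rewrite -[_ *m (S + S0)]mulmxA.
have -> : S0 *m (S + S0) = (S + S0) *m S.
  by rewrite mulmxDl mulmxDr SS S0S0 addrC.
by rewrite mulmxA mulmxKV // mulmxDl mulmxDr.
Qed.

Lemma cayleyVK Y : tangent Y -> 1%:M + Y \in unitmx ->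
  cayleyV Y + S0 \in unitmx /\ cayley (cayleyV Y) = Y.
Proof.
move=> [_ YS _] u1; have uS := S0_unit.
(* Anticommutation turns [Y S0] into [- S0 Y], so the sum times [1 + Y] is [2 S0] and the difference
   times [1 + Y] is [2 Y S0]. *)
have e1 : (cayleyV Y + S0) *m (1%:M + Y) = S0 + S0.
  rewrite mulmxDl mulmxKV // mulmxDl mulmxDr mul1mx mulmx1 YS.
  by mx_abel.
have e2 : (cayleyV Y - S0) *m (1%:M + Y) = Y *m (S0 + S0).
  rewrite mulmxBl mulmxKV // mulmxDl !mulmxDr mul1mx mulmx1 -[S0 *m Y]opprK -YS.
  by mx_abel.
have uT : cayleyV Y + S0 \in unitmx.
  have := double_unit uS; rewrite -e1 unitmx_mul => /andP[]//.
split=> //; apply: (canLR (mulmxK uT)).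
by apply: (can_inj (mulmxK u1)); rewrite e2 -mulmxA e1.
Qed.

(* Conjugation by 1 + Y carries S0 to its Cayley image; dividing by the square
   root of (1 + Y)(1 - Y), which commutes with S0, makes 1 + Y isometric. *)
Definition lift (Y : 'M[R]_N) : 'M[R]_N :=
  invmx (sqrtmx (1%:M - Y *m Y)) *m (1%:M + Y).

Definition good_sqrt (A : 'M[R]_N) : Prop :=
  [/\ sqrtmx A *m sqrtmx A = A, smooth_at (@sqrtmx R N) A,
    forall K, K *m A = A *m K -> K *m sqrtmx A = sqrtmx A *m K &
    A *m B = B *m A^T -> sqrtmx A *m B = B *m (sqrtmx A)^T].

(** Conditions on ambient matrices under which the lift is defined and smooth; the interior
    [small_int] is taken because chart domains must be open. *)
Definition small (Y : 'M[R]_N) : Prop :=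
  [/\ 1%:M + Y \in unitmx, 1%:M - Y *m Y \in unitmx & good_sqrt (1%:M - Y *m Y)].

Definition small_int : set 'M[R]_N := [set Y | \forall Z \near Y, small Z].

Lemma small_int_open : open small_int.
Proof. exact: (open_interior (small : set 'M[R]_N)). Qed.

Lemma smooth_at_sqr (Y : 'M[R]_N) : smooth_at (fun Y => 1%:M - Y *m Y) Y.
Proof.
have := smooth_atD (smooth_at_cst (1%:M : 'M[R]_N) Y)
  (smooth_at_mulmx (smooth_at_cst (- 1%:M : 'M[R]_N) Y)
    (smooth_at_mulmx (smooth_at_id Y) (smooth_at_id Y))).
by apply: smooth_at_ext => Z; rewrite mulNmx mul1mx.
Qed.

Lemma smooth_at_1D (Y : 'M[R]_N) : smooth_at (fun Y => 1%:M + Y) Y.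
Proof. exact: smooth_atD (smooth_at_cst _ _) (smooth_at_id _). Qed.

Lemma small0 : small_int 0.
Proof.
have c1 := smooth_at_continuous (smooth_at_1D 0).
have c2 := smooth_at_continuous (smooth_at_sqr 0).
have h1 : \forall Y \near (0 : 'M[R]_N), 1%:M + Y \in unitmx.
  by apply: (unitmx_near c1); rewrite addr0 unitmx1.
have h2 : \forall Y \near (0 : 'M[R]_N), 1%:M - Y *m Y \in unitmx.
  by apply: (unitmx_near c2); rewrite mulmx0 subr0 unitmx1.
have h3 : \forall Y \near (0 : 'M[R]_N), good_sqrt (1%:M - Y *m Y).
  by apply: (c2 good_sqrt); rewrite mulmx0 subr0; exact: sqrtmx_near1.
by rewrite /small_int /=; near=> Y; split; near: Y.
Unshelve. all: by end_near. Qed.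

(** Skewness of [Y] gives [B (1 + Y)^T = (1 - Y) B], so [1 + Y] carries [B] to [A B] with
    [A = (1 + Y) (1 - Y)]. Since [Y^2] commutes with [J] and [S0] and is self-adjoint for [B], the
    same holds for [A] and for its root [s], and [s^-1 A s^-1 = 1]. *)
Lemma lift_isom Y : tangent Y -> small Y ->
  isom_group (lift Y) /\ lift Y *m S0 *m invmx (lift Y) = cayleyV Y.
Proof.
move=> [YJ YS YB] [u1 u2 [sq _ comm adj]].
set A := 1%:M - Y *m Y in u2 sq comm adj.
have YY K : K *m (Y *m Y) = Y *m Y *m K -> K *m A = A *m K.
  by move=> h; rewrite /A mulmxBr mulmxBl mulmx1 mul1mx h.
have sY : Y *m sqrtmx A = sqrtmx A *m Y by apply/comm/YY; rewrite mulmxA.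
have sJ : J *m sqrtmx A = sqrtmx A *m J.
  by apply/comm/YY; rewrite mulmxA -YJ -mulmxA -YJ mulmxA.
have sS : S0 *m sqrtmx A = sqrtmx A *m S0.
  have S0Y : S0 *m Y = - (Y *m S0) by rewrite YS opprK.
  by apply/comm/YY; rewrite mulmxA S0Y mulNmx -(mulmxA Y S0) S0Y mulmxN opprK mulmxA.
have YYB : Y *m Y *m B = B *m (Y *m Y)^T.
  by rewrite -mulmxA YB mulmxN mulmxA YB mulNmx opprK trmx_mul mulmxA.
have sB : sqrtmx A *m B = B *m (sqrtmx A)^T.
  by apply: adj; rewrite /A mulmxBl mul1mx YYB linearB /= trmx1 mulmxBr mulmx1.
have us : sqrtmx A \in unitmx.
  by have : sqrtmx A *m sqrtmx A \in unitmx; [rewrite sq|rewrite unitmx_mul => /andP[]].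
rewrite /lift /cayleyV -/A; set s := sqrtmx A in sq sY sJ sS sB us *.
have usT : s^T \in unitmx by rewrite unitmx_tr.
have iJ : invmx s *m J = J *m invmx s.
  by apply: (canLR (mulKmx us)); rewrite !mulmxA -sJ mulmxK.
have iS : invmx s *m S0 = S0 *m invmx s.
  by apply: (canLR (mulKmx us)); rewrite !mulmxA -sS mulmxK.
have iY : invmx s *m Y = Y *m invmx s.
  by apply: (canLR (mulKmx us)); rewrite !mulmxA -sY mulmxK.
have iB : invmx s *m B = B *m (invmx s)^T.
  by apply: (canLR (mulKmx us)); rewrite trmx_inv !mulmxA sB mulmxK.
have ug : invmx s *m (1%:M + Y) \in unitmx by rewrite unitmx_mul unitmx_inv us.
split; last first.
  rewrite invmx_mulmx // ?unitmx_inv // invmxK.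
  have -> : invmx s *m (1%:M + Y) = (1%:M + Y) *m invmx s.
    by rewrite mulmxDr mulmxDl mul1mx mulmx1 iY.
  rewrite -(mulmxA _ (invmx s)) iS !mulmxA.
  have -> : (1%:M + Y) *m S0 *m invmx s *m invmx (1%:M + Y) *m s =
     (1%:M + Y) *m S0 *m (invmx s *m invmx (1%:M + Y) *m s) by rewrite !mulmxA.
  congr (_ *m _).
  have e : (1%:M + Y) *m s = s *m (1%:M + Y).
    by rewrite mulmxDr mulmxDl mul1mx mulmx1 sY.
  have e' : invmx (1%:M + Y) *m s = s *m invmx (1%:M + Y).
    by apply: (canLR (mulKmx u1)); rewrite mulmxA e mulmxK.
  by rewrite -mulmxA e' mulKmx.
split=> //.
  have YB' : B *m (1%:M + Y)^T = (1%:M - Y) *m B.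
    by rewrite linearD /= trmx1 mulmxDr mulmx1 mulmxBl mul1mx YB opprK.
  rewrite trmx_mul !mulmxA -[_ *m B *m _]mulmxA YB' -!mulmxA -iB !mulmxA.
  have -> : invmx s *m (1%:M + Y) *m (1%:M - Y) = invmx s *m A.
    rewrite -mulmxA; congr (_ *m _); rewrite /A mulmxDl mul1mx mulmxBr mulmx1.
    by mx_abel.
  by rewrite -sq mulmxA mulVmx // mul1mx mulmxV // mul1mx.
have e : (1%:M + Y) *m J = J *m (1%:M + Y) by rewrite mulmxDl mulmxDr mul1mx mulmx1 YJ.
by rewrite -mulmxA e !mulmxA iJ.
Qed.

Lemma lift0 : lift 0 = 1%:M.
Proof. by rewrite /lift mulmx0 subr0 sqrtmx1 addr0 invmx1 mulmx1. Qed.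

Lemma lift_smooth Y : small Y -> smooth_at lift Y.
Proof.
move=> [u1 u2 [sq ss _ _]]; apply: smooth_at_mulmx; last exact: smooth_at_1D.
apply: smooth_at_invmx.
  have : sqrtmx (1%:M - Y *m Y) *m sqrtmx (1%:M - Y *m Y) \in unitmx by rewrite sq.
  by rewrite unitmx_mul => /andP[].
by apply: smooth_at_comp; [exact: has_basis_mx|exact: smooth_at_sqr|].
Qed.

Lemma cayley_smooth S : S + S0 \in unitmx -> smooth_at cayley S.
Proof.
move=> uT; apply: smooth_at_mulmx.
  exact: smooth_atD (smooth_at_id _) (smooth_at_cst _ _).
apply: smooth_at_invmx => //; exact: smooth_atD (smooth_at_id _) (smooth_at_cst _ _).
Qed.

Lemma cayleyV_smooth Y : 1%:M + Y \in unitmx -> smooth_at cayleyV Y.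
Proof.
move=> u1; apply: smooth_at_mulmx.
  by apply: smooth_at_mulmx; [exact: smooth_at_1D|exact: smooth_at_cst].
by apply: smooth_at_invmx => //; exact: smooth_at_1D.
Qed.

(** The tangent conditions become the kernel of one linear map; a basis of it provides the dimension
    and the linear coordinates of the orbit. *)
Definition tangent_defect (Y : 'M[R]_N) : 'M[R]_N * 'M[R]_N * 'M[R]_N :=
  (Y *m J - J *m Y, Y *m S0 + S0 *m Y, Y *m B + B *m Y^T).

Lemma tangent_defect_linear : linear tangent_defect.
Proof.
move=> a u v; rewrite /tangent_defect.
congr (_, _, _).
- rewrite -[RHS]/(a *: (u *m J - J *m u) + (v *m J - J *m v)).
  by rewrite mulmxDl mulmxDr -scalemxAl -scalemxAr; mx_abel.
- rewrite -[RHS]/(a *: (u *m S0 + S0 *m u) + (v *m S0 + S0 *m v)).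
  by rewrite mulmxDl mulmxDr -scalemxAl -scalemxAr; mx_abel.
- rewrite -[RHS]/(a *: (u *m B + B *m u^T) + (v *m B + B *m v^T)).
  by rewrite linearP /= mulmxDl mulmxDr -scalemxAl -scalemxAr; mx_abel.
Qed.

HB.instance Definition _ :=
  GRing.isLinear.Build R 'M[R]_N ('M[R]_N * 'M[R]_N * 'M[R]_N)%type _
    tangent_defect tangent_defect_linear.

Definition tangent_space : {vspace 'M[R]_N} := lker (linfun tangent_defect).

Lemma tangent_spaceP Y : reflect (tangent Y) (Y \in tangent_space).
Proof.
rewrite memv_ker lfunE /=; apply: (iffP eqP) => [[]|[YJ YS YB]].
  by move=> /subr0_eq YJ /eqP; rewrite addr_eq0 => /eqP YS /eqP; rewrite addr_eq0 => /eqP.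
by rewrite /tangent_defect YJ YS YB !addNr subrr.
Qed.

Definition odim : nat := \dim tangent_space.
Definition tcoord (Y : 'M[R]_N) : 'rV[R]_odim :=
  \row_i coord (vbasis tangent_space) i Y.
Definition tvec (y : 'rV[R]_odim) : 'M[R]_N :=
  \sum_i y 0 i *: (vbasis tangent_space)`_i.

Lemma tvec_tangent y : tangent (tvec y).
Proof.
apply/tangent_spaceP; apply: memv_suml => i _; apply: memvZ.
by apply: vbasis_mem; apply: mem_nth; rewrite size_tuple.
Qed.

Lemma tcoordK Y : tangent Y -> tvec (tcoord Y) = Y.
Proof.
move=> /tangent_spaceP/coord_vbasis e; rewrite [RHS]e.
by apply: eq_bigr => i _; rewrite mxE.
Qed.

Lemma tvecK y : tcoord (tvec y) = y.
Proof.
apply/rowP => i; rewrite mxE coord_sum_free //.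
exact/basis_free/vbasisP.
Qed.

Lemma tcoord_smooth Y : smooth_at tcoord Y.
Proof.
have ll : linear tcoord by move=> a u v; apply/rowP => i; rewrite !mxE linearP.
pose L : {linear 'M[R]_N -> 'rV[R]_odim} :=
  HB.pack tcoord (GRing.isLinear.Build _ _ _ _ _ ll).
exact: (@smooth_at_mxlin _ _ _ _ _ _ L _ _ (smooth_at_id Y)).
Qed.

Lemma tvec_smooth y : smooth_at tvec y.
Proof.
apply: smooth_at_sum => i; apply: smooth_atZ; last exact: smooth_at_cst.
exact: smooth_at_coord (smooth_at_id _).
Qed.

Lemma tvec0 : tvec 0 = 0.
Proof. by rewrite /tvec big1 // => i _; rewrite mxE scale0r. Qed.

(** One chart for each group element [a]: the Cayley chart at [S0] translated to [a S0 a^-1], so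
    that every point of the orbit is the centre of a chart. *)
Let oidx := {g | isom_group g}.
Let back (a : oidx) (S : 'M[R]_N) := invmx (sval a) *m S *m sval a.
Let oproj (a : oidx) (S : 'M[R]_N) : 'rV[R]_odim := tcoord (cayley (back a S)).
(** Off the orbit the Cayley image need not be tangent, so smallness is asked of its projection
    [tvec (oproj a S)]; this is literally membership of the coordinates in [ocod a]. *)
Let odom (a : oidx) : set 'M[R]_N :=
  [set S | back a S + S0 \in unitmx] `&` (tvec \o oproj a) @^-1` small_int.
Let ocod (a : oidx) : set 'rV[R]_odim := tvec @^-1` small_int.
Let opar (a : oidx) (y : 'rV[R]_odim) :=
  sval a *m cayleyV (tvec y) *m invmx (sval a).

Let ounit (a : oidx) : sval a \in unitmx.
Proof. by have [] := svalP a. Qed.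

Lemma small_of_int Y : small_int Y -> small Y.
Proof. exact: nbhs_singleton. Qed.

Let back_smooth a S : smooth_at (back a) S.
Proof.
apply: smooth_at_mulmx; last exact: smooth_at_cst.
by apply: smooth_at_mulmx; [exact: smooth_at_cst|exact: smooth_at_id].
Qed.

Let oproj_smooth a S : back a S + S0 \in unitmx -> smooth_at (oproj a) S.
Proof.
move=> uT; apply: smooth_at_comp; [exact: has_basis_mx| |exact: tcoord_smooth].
by apply: smooth_at_comp; [exact: has_basis_mx|exact: back_smooth|exact: cayley_smooth].
Qed.

Let odom_open a : open (odom a).
Proof.
apply: open_setI_preimage; [|exact: small_int_open|].
  rewrite openE => S /= uT.
  have sT : smooth_at (fun S => back a S + S0) S.
    by apply: smooth_atD; [exact: back_smooth|exact: smooth_at_cst].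
  exact: (unitmx_near (smooth_at_continuous sT) uT).
move=> S uT; apply: smooth_at_continuous.
by apply: smooth_at_comp; [exact: has_basis_mx|exact: oproj_smooth|exact: tvec_smooth].
Qed.

Let ocod_open a : open (ocod a).
Proof.
apply: open_comp; last exact: small_int_open.
by move=> y _; exact/smooth_at_continuous/tvec_smooth.
Qed.

Let opar_smooth a y : ocod a y -> smooth_at (opar a) y.
Proof.
move=> /small_of_int[u1 _ _]; apply: smooth_at_mulmx; last exact: smooth_at_cst.
apply: smooth_at_mulmx; first exact: smooth_at_cst.
by apply: smooth_at_comp; [exact: has_basis_mx|exact: tvec_smooth|exact: cayleyV_smooth].
Qed.

Let back_center (a : oidx) : back a (sval a *m S0 *m invmx (sval a)) = S0.
Proof. by rewrite /back !mulmxA mulVmx ?ounit // mul1mx mulmxKV ?ounit. Qed.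

Let cayley0 : cayley S0 = 0.
Proof. by rewrite /cayley subrr mul0mx. Qed.

Let tcoord0 : tcoord 0 = 0.
Proof. by rewrite -{1}tvec0 tvecK. Qed.

Let odom_center (a : oidx) : odom a (sval a *m S0 *m invmx (sval a)).
Proof.
split; first by rewrite /= back_center double_unit // S0_unit.
by rewrite /= /oproj back_center cayley0 tcoord0 tvec0; exact: small0.
Qed.

Let odom_cover S : orbit_set S -> exists a, odom a S.
Proof.
by move=> [g Lg ->]; exists (exist _ g Lg); exact: (odom_center (exist _ g Lg)).
Qed.

Let oprojP a S : orbit_set S -> odom a S ->
  ocod a (oproj a S) /\ opar a (oproj a S) = S.
Proof.
move=> FS [uT sS]; split=> //.
have FS' : orbit_set (back a S) by apply: orbit_conjV => //; exact: svalP.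
rewrite /opar /oproj tcoordK; last exact: cayley_tangent.
have [_ ->] := cayleyK FS' uT.
by rewrite /back !mulmxA mulmxV ?ounit // mul1mx mulmxK ?ounit.
Qed.

Let oparP a y : ocod a y ->
  [/\ orbit_set (opar a y), odom a (opar a y) & oproj a (opar a y) = y].
Proof.
move=> sy; have tY := tvec_tangent y; have smy := small_of_int sy.
have [LY eY] := lift_isom tY smy; have [u1 _ _] := smy.
have [uT cK] := cayleyVK tY u1.
have bk : back a (opar a y) = cayleyV (tvec y).
  by rewrite /back /opar !mulmxA mulVmx ?ounit // mul1mx mulmxKV ?ounit.
have pk : oproj a (opar a y) = y by rewrite /oproj bk cK tvecK.
split=> //.
  apply: orbit_conj; first exact: svalP.
  by rewrite -eY; exists (lift (tvec y)).
by split; rewrite /= ?bk // pk.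
Qed.

Definition orbit_atlas : atlas odim orbit_set :=
  @Atlas R N odim orbit_set oidx odom oproj ocod opar odom_open ocod_open
    (fun a S h => @oproj_smooth a S h.1) opar_smooth odom_cover oprojP oparP.

Definition orbit_manifold : smoothManifold R odim := embedded orbit_atlas orbit_self.

Section HomogeneousSpace.
Variables (NG : nat) (G H : set 'M[R[i]]_NG).
Variables (Phi : 'M[R]_NG * 'M[R]_NG -> 'M[R]_N) (Psi : 'M[R]_N -> 'M[R]_NG * 'M[R]_NG).
Hypothesis Phi_smooth : forall z, smooth_at Phi z.
Hypothesis Psi_smooth : forall z, smooth_at Psi z.
Hypothesis PhiG : forall g, G g -> isom_group (Phi (re_im g)).
Hypothesis PsiG : forall a, isom_group a -> G (cplx_mx (Psi a)) /\ Phi (Psi a) = a.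
Hypothesis PhiK : forall g, G g -> Psi (Phi (re_im g)) = re_im g.
Hypothesis GVM : forall g h, G g -> G h -> G (invmx g *m h) /\
  Phi (re_im (invmx g *m h)) = invmx (Phi (re_im g)) *m Phi (re_im h).
Hypothesis HE : forall g, G g -> (H g <-> Phi (re_im g) *m S0 = S0 *m Phi (re_im g)).

Let orb (z : 'M[R]_NG * 'M[R]_NG) := Phi z *m S0 *m invmx (Phi z).

Definition orbit_map (g : 'M[R[i]]_NG) : orbit_manifold :=
  fib_pt orbit_atlas orbit_self (orb (re_im g)).

Let orbF g : G g -> orbit_set (orb (re_im g)).
Proof. by move=> /PhiG Lg; exists (Phi (re_im g)). Qed.

(** The fibers of the orbit map are cosets because [g^-1 h] commutes with [S0] exactly when it lies
    in [H]; smooth local sections come from [lift], translated by [g]. *)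
Lemma orbit_homogeneous_space : homogeneous_space G H orbit_map.
Proof.
split.
- move=> y; have [a La ea] := fib_valP y.
  have [Ga PPa] := PsiG La; exists (cplx_mx (Psi a)) => //.
  by rewrite /orbit_map cplx_mxK /orb PPa -ea fib_valK.
- move=> g h Gg Gh; have [Ggh egh] := GVM Gg Gh.
  have [ug _ _] := PhiG Gg; have [uh _ _] := PhiG Gh.
  have -> : orbit_map g = orbit_map h <-> orb (re_im g) = orb (re_im h).
    split=> [/(congr1 (@fib_val _ _ _ _ orbit_atlas _ orbit_self))|e].
      by rewrite !fib_ptK //; exact: orbF.
    by rewrite /orbit_map e.
  rewrite (HE Ggh) egh /orb; split=> e.
    rewrite -mulmxA; apply: (canLR (mulKmx ug)); rewrite !mulmxA e.
    by rewrite mulmxKV.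
  have e2 : Phi (re_im h) *m S0 =
      Phi (re_im g) *m (S0 *m (invmx (Phi (re_im g)) *m Phi (re_im h))).
    by rewrite -e !mulmxA mulmxV // mul1mx.
  by rewrite e2 !mulmxA mulmxK.
- move=> g Gg; have ug : Phi (re_im g) \in unitmx by have [] := PhiG Gg.
  have [W0 [r [oW0 W0g sr rW]]] := fib_pt_retraction orbit_atlas (orbF Gg).
  pose A : set ('M[R]_NG * 'M[R]_NG) := [set z | Phi z \in unitmx].
  have oA : open A.
    by rewrite openE => z uz; exact: (unitmx_near (smooth_at_continuous (Phi_smooth z)) uz).
  have so z : A z -> smooth_at orb z.
    move=> uz; apply: smooth_at_mulmx; last exact: smooth_at_invmx.
    by apply: smooth_at_mulmx => //; exact: smooth_at_cst.
  (* For [z] outside the group, [orb z] may leave the orbit, so it is followed by the local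
     retraction [r]. *)
  exists (A `&` orb @^-1` W0), (fun z => fib_pt orbit_atlas orbit_self (r (orb z))); split.
  + by apply: (open_setI_preimage oA oW0) => z Az; exact/smooth_at_continuous/so.
  + by [].
  + apply: smooth_into_atP => z [Az Wz]; apply: smooth_into_fib.
    have [Fr srz] := sr _ Wz.
    have : smooth_at (fun z => r (orb z)) z.
      by apply: smooth_at_comp; [exact: has_basis_mx|exact: so|].
    apply: smooth_at_near.
    have := continuous_near_open (smooth_at_continuous (so _ Az)) oW0 Wz.
    by apply: filterS => z' Wz'; rewrite /= fib_ptK //; have [] := sr _ Wz'.
  + by move=> z [Az Wz] Gz; rewrite /orbit_map cplx_mxK rW // -(cplx_mxK z); exact: orbF.
(* The chart centred at [g S0 g^-1] is used: at its centre the lift is 1 and the section takes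
   exactly the value [g]. *)
- move=> g Gg; pose a : aidx orbit_atlas := exist _ _ (PhiG Gg).
  pose s (y : orbit_manifold) := Psi (Phi (re_im g) *m lift (tvec (amap a (fib_val y)))).
  have eg : fib_val (orbit_map g) = orb (re_im g) by rewrite fib_ptK //; exact: orbF.
  exists (dom (a : idx orbit_manifold)), s; split.
  + split; first exact: dom_open.
    by rewrite -[dom _ _]/(adom a (fib_val (orbit_map g))) eg; exact: odom_center.
  + apply: smooth_from_atP => y dy; exists a; split=> //.
    have FY := fib_valP y; have [cy ey] := @amapP _ _ _ _ orbit_atlas a _ FY dy.
    have sY := small_of_int cy.
    have : smooth_at (fun z => Psi (Phi (re_im g) *m lift (tvec z))) (amap a (fib_val y)).
      apply: smooth_at_comp; [exact: has_basis_mx| |exact: Psi_smooth].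
      apply: smooth_at_mulmx; first exact: smooth_at_cst.
      by apply: smooth_at_comp; [exact: has_basis_mx|exact: tvec_smooth|exact: lift_smooth].
    apply: smooth_at_near.
    have := open_nbhs_nbhs (conj (@acod_open _ _ _ _ orbit_atlas a) cy).
    apply: filterS => z cz; have [Fz dz ez] := @aparP _ _ _ _ orbit_atlas a _ cz.
    rewrite /comp /s.
    have -> : fib_val (chartV (a : idx orbit_manifold) z) = apar a z by exact: fib_ptK.
    by rewrite ez.
  + rewrite /s eg.
    have -> : amap a (orb (re_im g)) = 0.
      by rewrite /= /oproj (back_center a) cayley0 tcoord0.
    by rewrite tvec0 lift0 mulmx1 PhiK // re_imK.
  + move=> y dy; have FY := fib_valP y.
    have [cy ey] := @amapP _ _ _ _ orbit_atlas a _ FY dy.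
    have [LY eY] := lift_isom (tvec_tangent _) (small_of_int cy).
    have La := isom_groupM (PhiG Gg) LY.
    have [Gs Ps] := PsiG La; split=> //.
    rewrite /orbit_map cplx_mxK /orb Ps -[RHS]fib_valK; congr fib_pt.
    have [ug _ _] := PhiG Gg; have [uL _ _] := LY.
    rewrite -[RHS]ey; move: (lift _) uL eY => l uL eY.
    have -> : apar a (amap a (fib_val y)) =
        Phi (re_im g) *m (l *m S0 *m invmx l) *m invmx (Phi (re_im g)) by rewrite eY.
    by rewrite invmx_mulmx // !mulmxA.
Qed.

End HomogeneousSpace.

End Orbit.

(** * Transition maps and the bundle of an orbit *)

Lemma derive_comp (R : realType) (U V W : normedModType R) (f : U -> V) (g : V -> W) x v :
  differentiable f x -> differentiable g (f x) ->
  'D_v (g \o f) x = 'D_('D_v f x) g (f x).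
Proof.
move=> df dg; have dfg : differentiable (g \o f) x by exact: differentiable_comp.
by rewrite (deriveE _ dfg) (deriveE _ dg) (deriveE _ df) diff_comp.
Qed.

Section TransitionMaps.
Variables (R : realType) (n : nat) (M : smoothManifold R n).
Implicit Types (i j k : idx M) (p : M).

Lemma mul_trans_jac i j p (v : 'rV[R]_n) : dom i p -> dom j p ->
  v *m trans_jac i j p = 'D_v (chart j \o chartV i) (chart i p).
Proof.
move=> di dj; rewrite deriveEjacobian //.
exact/smooth_at_differentiable/transition_smooth.
Qed.

Lemma trans_jac_cocycle i j k p : dom i p -> dom j p -> dom k p ->
  trans_jac i j p *m trans_jac j k p = trans_jac i k p.
Proof.
move=> di dj dk; have d1 := smooth_at_differentiable (transition_smooth di dj).
have d2 := smooth_at_differentiable (transition_smooth dj dk).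
have e : \forall x \near chart i p, (chart k \o chartV i) x =
    ((chart k \o chartV j) \o (chart j \o chartV i)) x.
  have := chartV_dom_near (open_nbhs_nbhs (conj (dom_open j) dj)) di.
  by apply: filterS => x [_ dx _] /=; rewrite chartK.
have ep : (chart j \o chartV i) (chart i p) = chart j p by rewrite /= chartK.
suff h (v : 'rV[R]_n) : 'D_('D_v (chart j \o chartV i) (chart i p))
    (chart k \o chartV j) (chart j p) = 'D_v (chart k \o chartV i) (chart i p).
  have e3 v := mul_trans_jac v di dk; have e2 v := mul_trans_jac v dj dk.
  have e1 v := mul_trans_jac v di dj.
  move: (trans_jac i j p) (trans_jac j k p) (trans_jac i k p) e1 e2 e3 => A B C e1 e2 e3.
  by apply/row_matrixP => a; rewrite !rowE mulmxA e1 e2 e3.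
rewrite (near_eq_derive _ e); move: (chart j \o chartV i) (chart k \o chartV j) d1 d2 ep.
move: (chart i p) (chart j p) => x y f g d1 d2 ep.
by rewrite (derive_comp v d1) ep.
Qed.

Lemma trans_jac_id i p : dom i p -> trans_jac i i p = 1%:M.
Proof.
move=> di; apply/row_matrixP => a; rewrite !rowE mulmx1.
apply: etrans (mul_trans_jac _ di di) _.
have e : \forall x \near chart i p, (chart i \o chartV i) x = id x.
  have := chartV_dom_near (open_nbhs_nbhs (conj (dom_open i) di)) di.
  by apply: filterS => x [_ _ /= ->].
by rewrite (near_eq_derive _ e) derive_id.
Qed.

Lemma trans_jacV i j p : dom i p -> dom j p ->
  trans_jac i j p \in unitmx.
Proof.
move=> di dj; have := trans_jac_cocycle di dj di; rewrite (trans_jac_id di).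
by case/mulmx1_unit => u _; exact: u.
Qed.

(** The entries of the Jacobian are, near the point, coordinates of directional derivatives of the
    transition map, which are smooth. *)
Lemma trans_jac_smooth i j p : dom i p -> dom j p ->
  smooth_at (trans_jac i j \o chartV i) (chart i p).
Proof.
move=> di dj; apply: smooth_at_mx => a b.
have sf := transition_smooth di dj.
have := smooth_at_coord 0 b (smooth_at_derive (delta_mx 0 a) sf).
apply: smooth_at_near.
have := chartV_dom_near (open_nbhs_nbhs (conj (dom_open j) dj)) di.
apply: filterS => x [d1 d2 ex].
have e := mul_trans_jac (delta_mx 0 a) d1 d2; rewrite ex in e.
by rewrite -e -rowE mxE.
Qed.

Lemma smooth_at_block_diag (V : normedModType R) n1 n2 (f : V -> 'M[R]_n1)
    (g : V -> 'M[R]_n2) x : smooth_at f x -> smooth_at g x ->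
  smooth_at (fun y => block_mx (f y) 0 0 (g y)) x.
Proof.
move=> sf sg.
have : smooth_at (fun y => col_mx 1%:M 0 *m f y *m row_mx 1%:M 0 +
    col_mx 0 1%:M *m g y *m row_mx 0 1%:M : 'M[R]_(n1 + n2)) x.
  apply: smooth_atD; apply: smooth_at_mulmx; try exact: smooth_at_cst.
    by apply: smooth_at_mulmx => //; exact: smooth_at_cst.
  by apply: smooth_at_mulmx => //; exact: smooth_at_cst.
apply: smooth_at_ext => y.
rewrite !mul_col_mx !mul1mx !mul0mx !mul_mx_row !mulmx1 !mulmx0.
by rewrite add_col_mx addr0 add0r.
Qed.

Lemma trans_TT_smooth i j p : dom i p -> dom j p ->
  smooth_at (trans_TT i j \o chartV i) (chart i p).
Proof.
move=> di dj; apply: smooth_at_block_diag; first exact: trans_jac_smooth.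
apply: smooth_at_mxlin.
apply: (@smooth_at_invmx _ _ _ (trans_jac i j \o chartV i)).
  by rewrite /= chartK // trans_jacV.
exact: trans_jac_smooth.
Qed.

Lemma trans_TT_unit i j p : dom i p -> dom j p -> trans_TT i j p \in unitmx.
Proof.
move=> di dj; rewrite unitmxE det_ublock unitrM -!unitmxE.
by rewrite unitmx_tr unitmx_inv trans_jacV.
Qed.

Lemma trans_TT_cocycle i j k p : dom i p -> dom j p -> dom k p ->
  trans_TT i j p *m trans_TT j k p = trans_TT i k p.
Proof.
move=> di dj dk; rewrite /trans_TT mulmx_block !mulmx0 !mul0mx !addr0 add0r.
rewrite -trmx_mul -invmx_mulmx ?trans_jacV // trans_jac_cocycle //.
Qed.

Lemma trans_TT_isometry i j p : dom i p -> dom j p ->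
  trans_TT i j p *m b_mx R n *m (trans_TT i j p)^T = b_mx R n.
Proof.
move=> di dj; rewrite /trans_TT /b_mx tr_block_mx !mulmx_block.
rewrite !trmx0 trmxK !mulmx0 !mul0mx !mulmx1 !addr0 !add0r.
rewrite !mul0mx mulmxV ?trans_jacV //.
by rewrite -trmx_mul mulmxV ?trans_jacV // trmx1.
Qed.

Lemma b_mx_unit : b_mx R n \in unitmx.
Proof.
have : b_mx R n *m b_mx R n = 1%:M.
  rewrite /b_mx mulmx_block !mulmx0 !mul0mx !mulmx1 !addr0 !add0r.
  by rewrite -scalar_mx_block.
by case/mulmx1_unit.
Qed.

Section OrbitBundle.
Variables (I : tensor_End M -> Prop) (P : 'M[R]_(n + n) -> Prop).
Variables (NG : nat) (G H : set 'M[R[i]]_NG).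
Variables (J S0 : 'M[R]_(n + n)) (lam : R).
Hypotheses (lam0 : lam != 0) (S0S0 : S0 *m S0 = lam%:M).
Hypothesis S0J : S0 *m J = - (J *m S0).
Hypothesis S0B : S0 *m b_mx R n = - (b_mx R n *m S0^T).
Let L := isom_group (b_mx R n) J.
Hypothesis transJ : forall i j p, dom i p -> dom j p ->
  trans_TT i j p *m J = J *m trans_TT i j p.
Hypothesis PE : forall A, P A <-> orbit_set (b_mx R n) J S0 A.
Hypothesis IP : forall S, I S -> section_End S /\ forall i p, dom i p -> P (S i p).
Variables (Phi : 'M[R]_NG * 'M[R]_NG -> 'M[R]_(n + n)).
Variables (Psi : 'M[R]_(n + n) -> 'M[R]_NG * 'M[R]_NG).
Hypothesis Phi_smooth : forall z, smooth_at Phi z.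
Hypothesis Psi_smooth : forall z, smooth_at Psi z.
Hypothesis PhiG : forall g, G g -> L (Phi (re_im g)).
Hypothesis PsiG : forall a, L a -> G (cplx_mx (Psi a)) /\ Phi (Psi a) = a.
Hypothesis PhiK : forall g, G g -> Psi (Phi (re_im g)) = re_im g.
Hypothesis GVM : forall g h, G g -> G h -> G (invmx g *m h) /\
  Phi (re_im (invmx g *m h)) = invmx (Phi (re_im g)) *m Phi (re_im h).
Hypothesis HE : forall g, G g -> (H g <-> Phi (re_im g) *m S0 = S0 *m Phi (re_im g)).

Let transL i j p : dom i p -> dom j p -> L (trans_TT i j p).
Proof.
by move=> di dj; split; [exact: trans_TT_unit|exact: trans_TT_isometry|exact: transJ].
Qed.

Let transF i j p S : dom i p -> dom j p -> orbit_set (b_mx R n) J S0 S ->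
  orbit_set (b_mx R n) J S0 (conjmx_by (trans_TT i j p) S).
Proof. by move=> di dj; apply: orbit_conjV; exact: transL. Qed.

Lemma endo_atE p (A : idx M -> 'M[R]_(n + n)) : endo_at p A <->
  forall i j, dom i p -> dom j p -> A j = conjmx_by (trans_TT i j p) (A i).
Proof.
split=> h i j di dj; have ut := trans_TT_unit di dj.
  by rewrite /conjmx_by -mulmxA h // mulKmx.
by rewrite (h i j) // /conjmx_by !mulmxA mulmxV // mul1mx.
Qed.

Lemma sections_of_orbit_bundle : sections_of_bundle I P G H.
Proof.
pose At := orbit_atlas b_mx_unit lam0 S0S0 S0J S0B.
pose FS0 := orbit_self (b_mx R n) J S0.
pose E := bundle At FS0 trans_TT_unit trans_TT_cocycle trans_TT_smooth transF.
pose ev (e : E) (i : idx M) : 'M[R]_(n + n) := bundle_comp i e.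
exists _, (orbit_manifold b_mx_unit lam0 S0S0 S0J S0B),
  (@orbit_map _ _ _ _ _ _ b_mx_unit lam0 S0S0 S0J S0B _ Phi),
  _, E, (fun e : E => bundle_pr e), ev; split.
- exact: orbit_homogeneous_space.
- exact: bundle_fiber_bundle.
- split.
  + move=> e; split; last by move=> i di; apply/PE; exact: bundle_compF.
    by apply/endo_atE => i j di dj; exact: bundle_comp_transition.
  + move=> e e' ee' h; have [i di] := dom_cover (bundle_pr e).
    have di' : dom i (bundle_pr e') by rewrite -ee'.
    have ci : bundle_comp i e = bundle_comp i e' by exact: h.
    apply: etrans (esym (bundle_compK di)) _; rewrite ci ee'.
    exact: bundle_compK.
  + move=> p A /endo_atE hA PA; have [i di] := dom_cover p.
    have FA : orbit_set (b_mx R n) J S0 (A i) by apply/PE/PA.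
    exists (bundle_point At FS0 trans_TT_unit trans_TT_cocycle trans_TT_smooth transF i p (A i)) => // j dj.
    rewrite /ev (@bundle_comp_transition _ _ _ _ _ _ _ _ _ _ _ _ _ _ i j) //.
    by rewrite bundle_pointK // -hA.
  + by move=> i; apply: smooth_from_atP => e de; exact: bundle_comp_smooth.
  + by move=> e i di; exact: bundle_retraction.
- move=> S /IP[[eS sS] PS].
  have [||s ss es] := bundle_section At FS0 trans_TT_unit trans_TT_cocycle trans_TT_smooth transF _ _ sS.
  + by move=> i j p di dj; have /endo_atE := eS p; exact.
  + by move=> i p di; exact/PE/PS.
  + by exists s.
Qed.

End OrbitBundle.
End TransitionMaps.

(** * Transitivity by decomposition into cells *)

Lemma injective_of_card (T T0 : finType) : (#|T| <= #|T0|)%N ->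
  exists g : T -> T0, injective g.
Proof.
move=> h; exists (fun x => enum_val (widen_ord h (enum_rank x))) => x y.
by move=> /enum_val_inj/(congr1 val) /= /val_inj/enum_rank_inj.
Qed.

(** The two sign classes are embedded separately. An injection is all that is asked for, since the
    isometry built from it is invertible by nondegeneracy. *)
Lemma injective_preserving_sign (I I0 : finType) (e : pred I) (e0 : pred I0) :
  (#|e| <= #|e0|)%N -> (#|predC e| <= #|predC e0|)%N ->
  exists2 f : I -> I0, injective f & forall i, e0 (f i) = e i.
Proof.
move=> h1 h2.
have [g gI] : exists g : {i | e i} -> {i | e0 i}, injective g.
  by apply: injective_of_card; rewrite !card_sig.
have [g' gI'] : exists g : {i | predC e i} -> {i | predC e0 i}, injective g.
  by apply: injective_of_card; rewrite !card_sig.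
have ch i : exists y, (exists h : e i, y = val (g (exist _ i h))) \/
    (exists h : predC e i, y = val (g' (exist _ i h))).
  have [h|/negP h] := pselect (e i).
    by exists (val (g (exist _ i h))); left; exists h.
  by exists (val (g' (exist _ i (h : predC e i)))); right; exists h.
have [f fP] := choice ch.
have fe i : e0 (f i) = e i.
  case: (fP i) => -[h ->]; first by rewrite h; exact: valP (g _).
  by rewrite (negbTE h); apply: negbTE; exact: valP (g' _).
exists f => // i j fij; have := fe i; rewrite fij fe => eij.
case: (fP i) => -[hi]; case: (fP j) => -[hj]; rewrite fij => ->.
- by move=> /val_inj/gI/(congr1 val).
- by have := hj; rewrite /= eij hi.
- by have := hj; rewrite eij (negbTE hi).
- by move=> /val_inj/gI'/(congr1 val).
Qed.

Section Cells.
Variables (R : realType) (N : nat) (B J : 'M[R]_N) (ell : R).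
Hypotheses (uB : B \in unitmx) (B_sym : B^T = B).
Hypothesis JB : J *m B = ell *: (B *m J^T).

Variables (c' : nat) (TJ TS Gam : 'M[R]_c'.+1) (pos : bool).
Let c := c'.+1.
Hypotheses (uG : Gam \in unitmx) (G_sym : Gam^T = Gam).

Definition sg (e : bool) : R := if e then 1 else -1.

Lemma sg_sqr e : sg e * sg e = 1.
Proof. by case: e; rewrite /sg ?mulr1 // mulrNN mulr1. Qed.

(* A cell spans a nondegenerate J- and S-stable subspace on which everything is
   prescribed, up to the sign of the form. *)
Definition cell (S : 'M[R]_N) (e : bool) (w : 'M[R]_(c, N)) : Prop :=
  [/\ w *m J = TJ *m w, w *m S = TS *m w, w *m B *m w^T = sg e *: Gam & pos -> e].

Definition stable_nondegenerate (S U : 'M[R]_N) : Prop :=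
  [/\ (U *m J <= U)%MS, (U *m S <= U)%MS &
    forall x : 'rV[R]_N, (x <= U)%MS ->
      (forall y : 'rV[R]_N, (y <= U)%MS -> x *m B *m y^T = 0) -> x = 0].

Definition has_cells (S : 'M[R]_N) : Prop := forall U : 'M[R]_N,
  stable_nondegenerate S U -> U != 0 ->
  exists e w, cell S e w /\ (w <= U)%MS.

(** For [w' = w] this is the orthogonal projection onto the row span of the cell, since
    [sg e *: invmx Gam] inverts its Gram matrix; in general it sends [w] to [w'] row by row and
    kills what is orthogonal to [w]. *)
Definition cell_proj (e : bool) (w w' : 'M[R]_(c, N)) : 'M[R]_N :=
  B *m w^T *m (sg e *: invmx Gam) *m w'.

Definition orthogonal_cells (S U : 'M[R]_N) (I : finType) (e : I -> bool)
    (w : I -> 'M[R]_(c, N)) : Prop :=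
  [/\ forall i, cell S (e i) (w i), forall i, (w i <= U)%MS,
      forall i j, i != j -> w i *m B *m (w j)^T = 0 &
      forall x : 'rV[R]_N, (x <= U)%MS -> x *m (\sum_i cell_proj (e i) (w i) (w i)) = x].

Lemma gram_sign e w : w *m B *m w^T = sg e *: Gam ->
  w *m B *m w^T *m (sg e *: invmx Gam) = 1%:M :> 'M[R]_c.
Proof.
by move=> ->; rewrite -scalemxAl -scalemxAr scalerA sg_sqr scale1r mulmxV.
Qed.

(** Induction on the rank: split off one cell and pass to its orthogonal complement [U'] in [U]. By
    adjointness [J] and [S] carry [K = B w0^T] into its own column span, so [U'] stays stable; it
    stays nondegenerate because its vectors are already orthogonal to [w0]. *)
Lemma orthogonal_decomposition S U : S *m B = - (B *m S^T) -> has_cells S ->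
  stable_nondegenerate S U ->
  exists (I : finType) (e : I -> bool) (w : I -> 'M[R]_(c, N)),
    orthogonal_cells S U e w.
Proof.
move=> SB hc; have [r] := ubnP (\rank U); elim: r U => // r IH U rU nU.
have [U0|U0] := eqVneq U 0.
  exists void, (fun=> true), (fun=> 0); split=> [[]|[]|[]|x].
  by rewrite U0 submx0 => /eqP ->; rewrite mul0mx.
have [UJ US ndU] := nU; have [e0 [w0 [cw0 w0U]]] := hc U nU U0.
have [w0J w0S w0B w0p] := cw0.
pose K : 'M[R]_(N, c) := B *m w0^T.
pose U' := (U :&: kermx K)%MS.
have inU' m (x : 'M[R]_(m, N)) : (x <= U')%MS = (x <= U)%MS && (x *m K == 0).
  by rewrite sub_capmx sub_kermx.
pose pi0 := cell_proj e0 w0 w0.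
have w0K : w0 *m K *m (sg e0 *: invmx Gam) = 1%:M by rewrite /K mulmxA gram_sign.
have proj (x : 'rV[R]_N) : (x <= U)%MS -> (x - x *m pi0 <= U')%MS.
  move=> xU; rewrite inU'; apply/andP; split.
    apply: addmx_sub => //; rewrite eqmx_opp.
    by rewrite /pi0 /cell_proj mulmxA; apply: mulmx_sub.
  rewrite mulmxBl /pi0 /cell_proj -/K -!mulmxA.
  by rewrite (mulmx1C w0K) mulmx1 subrr.
have rU' : (\rank U' < r)%N.
  apply: leq_trans _ (rU : (\rank U <= r)%N).
  apply: rank_ltmx; rewrite /ltmx capmxSl /=; apply/negP => UU'.
  have := submx_trans w0U UU'; rewrite inU' => /andP[_ /eqP w00].
  move: w0K; rewrite w00 mul0mx => /(congr1 (fun A : 'M[R]_c => A 0 0)).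
  by rewrite !mxE => /eqP; rewrite eq_sym oner_eq0.
have nU' : stable_nondegenerate S U'.
  have KJ : J *m K = K *m (ell *: TJ^T).
    by rewrite /K mulmxA JB -!scalemxAl -scalemxAr -!mulmxA -!trmx_mul w0J.
  have KS : S *m K = - (K *m TS^T).
    by rewrite /K mulmxA SB mulNmx -!mulmxA -!trmx_mul w0S.
  have UU' : (U' <= U)%MS by exact: capmxSl.
  have U'K : U' *m K = 0 by apply/eqP; have := submx_refl U'; rewrite inU' => /andP[].
  split.
  - rewrite inU' -mulmxA KJ mulmxA U'K mul0mx eqxx andbT.
    exact: submx_trans (submxMr _ UU') UJ.
  - rewrite inU' -mulmxA KS mulmxN mulmxA U'K mul0mx oppr0 eqxx andbT.
    exact: submx_trans (submxMr _ UU') US.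
  - move=> x; rewrite inU' => /andP[xU /eqP xK] hx.
    apply: ndU => // y yU; rewrite -[y](subrK (y *m pi0)) linearD /= mulmxDr.
    rewrite hx ?proj // add0r.
    have -> : y *m pi0 = y *m K *m (sg e0 *: invmx Gam) *m w0.
      by rewrite /pi0 /cell_proj -/K !mulmxA.
    by rewrite trmx_mul mulmxA -(mulmxA x) -/K xK mul0mx.
have [I [e [w [cw wU' ow pw]]]] := IH _ rU' nU'.
exists (unit + I)%type, (fun i => if i is inr i then e i else e0),
  (fun i => if i is inr i then w i else w0); split.
- by case.
- by case=> // i; apply: submx_trans (wU' i) (capmxSl _ _).
- have ow0 i : w i *m K = 0.
    by apply/eqP; have := wU' i; rewrite inU' => /andP[].
  case=> [[]|i] [[]|j] //= ij.
  + by apply: trmx_inj; rewrite !trmx_mul trmxK trmx0 B_sym; exact: ow0.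
  + by rewrite -mulmxA ow0.
  + by apply: ow; apply: contra_neq ij => ->.
- move=> x xU; rewrite big_sumType /= (big_pred1 tt) /=; last by case.
  have := pw _ (proj _ xU); set P := \sum_i _ => e1.
  rewrite mulmxDr -/pi0 -[RHS](subrK (x *m pi0)) addrC; congr (_ + _).
  have pP : pi0 *m P = 0.
    rewrite /P mulmx_sumr big1 // => i _.
    have w0i : w0 *m B *m (w i)^T = 0.
      apply: trmx_inj; rewrite !trmx_mul trmxK trmx0 B_sym.
      by apply/eqP; have := wU' i; rewrite inU' => /andP[].
    by rewrite /pi0 /cell_proj -!mulmxA (mulmxA w0) (mulmxA (w0 *m B)) w0i !(mul0mx, mulmx0).
  by rewrite -[RHS]e1 mulmxBl -mulmxA pP mulmx0 subr0.
Qed.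

Lemma full_stable_nondegenerate S : stable_nondegenerate S 1%:M.
Proof.
split; rewrite ?submx1 // => x _ h.
apply: (can_inj (mulmxK uB)); rewrite mul0mx; apply/rowP => k.
have := h (delta_mx 0 k) (submx1 _); rewrite trmx_delta => /matrixP/(_ 0 0).
by rewrite -colE !mxE.
Qed.

Lemma full_decomposition S : S *m B = - (B *m S^T) -> has_cells S ->
  exists (I : finType) (e : pred I) (w : I -> 'M[R]_(c, N)),
  [/\ forall i, cell S (e i) (w i),
      forall i j, i != j -> w i *m B *m (w j)^T = 0,
      \sum_i cell_proj (e i) (w i) (w i) = 1%:M & (#|I| * c)%N = N].
Proof.
move=> SB hc.
have [I [e [w [cw _ ow pw]]]] := orthogonal_decomposition SB hc (full_stable_nondegenerate S).
have P1 : \sum_i cell_proj (e i) (w i) (w i) = 1%:M.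
  by apply/row_matrixP => k; rewrite !rowE mulmx1 pw // submx1.
exists I, e, w; split=> //.
(* Each projection has trace [c] and their sum is the identity, so comparing traces counts the
   cells. *)
have := congr1 mxtrace P1; rewrite mxtrace1 raddf_sum /=.
rewrite (eq_bigr (fun=> c%:R)); last first.
  move=> i _; rewrite /cell_proj mxtrace_mulC !mulmxA.
  by have [_ _ wB _] := cw i; rewrite gram_sign // mxtrace1.
rewrite sumr_const -mulrnA mulnC => /eqP.
by rewrite eqr_nat => /eqP.
Qed.

(** [X] acts on the cell as [T], so its relation with the [B]-adjoint descends to [T] and [Gam]; the
    sign [sg e] cancels. *)
Lemma cell_adjoint (X : 'M[R]_N) (T : 'M[R]_c) (k : R) e w :
  X *m B = k *: (B *m X^T) -> w *m X = T *m w -> w *m B *m w^T = sg e *: Gam ->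
  k *: (T^T *m invmx Gam) = invmx Gam *m T.
Proof.
move=> XB wX wB.
have h : T *m Gam = k *: (Gam *m T^T).
  have : sg e *: (T *m Gam) = sg e *: (k *: (Gam *m T^T)).
    rewrite scalerA mulrC -scalerA [in RHS]scalemxAl -wB scalemxAr -wB.
    by rewrite !mulmxA -wX -!(mulmxA w) XB -scalemxAl -scalemxAr -!mulmxA -!trmx_mul wX.
  by move/(congr1 (fun A => sg e *: A)); rewrite !scalerA sg_sqr !scale1r mulrA sg_sqr mul1r.
apply: (canRL (mulKmx uG)); rewrite -scalemxAr mulmxA scalemxAl -h.
by rewrite mulmxK.
Qed.

Lemma intertwining_sum (X X0 : 'M[R]_N) (T : 'M[R]_c) (k : R) (I : finType)
    (e : pred I) (w w0 : I -> 'M[R]_(c, N)) :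
  X *m B = k *: (B *m X^T) ->
  (forall i, w i *m X = T *m w i) -> (forall i, w0 i *m X0 = T *m w0 i) ->
  (forall i, w i *m B *m (w i)^T = sg (e i) *: Gam) ->
  let h := \sum_i cell_proj (e i) (w i) (w0 i) in X *m h = h *m X0.
Proof.
move=> XB wX w0X wB /=; rewrite mulmx_sumr mulmx_suml; apply: eq_bigr => i _.
rewrite /cell_proj -[RHS]mulmxA w0X !mulmxA XB -!scalemxAl -(mulmxA B) -trmx_mul wX.
rewrite trmx_mul mulmxA -!scalemxAr -!scalemxAl -!(mulmxA _ T^T) -(mulmxA _ _ T).
by rewrite -(cell_adjoint XB (wX i) (wB i)) -scalemxAr -scalemxAl scalerA mulrC -scalerA.
Qed.

(** The map [h] sends each cell of [S] to the cell of [S0] assigned by [f]. Equal normal forms make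
    it commute with [J] and intertwine [S] with [S0]; equal signs and orthogonality of distinct
    target cells make it an isometry, hence invertible. *)
Lemma intertwiner S S0 (I I0 : finType) (e : pred I) (e0 : pred I0)
    (w : I -> 'M[R]_(c, N)) (w0 : I0 -> 'M[R]_(c, N)) (f : I -> I0) :
  S *m B = - (B *m S^T) ->
  (forall i, cell S (e i) (w i)) -> (forall i, cell S0 (e0 i) (w0 i)) ->
  (forall i j, i != j -> w0 i *m B *m (w0 j)^T = 0) ->
  \sum_i cell_proj (e i) (w i) (w i) = 1%:M ->
  injective f -> (forall i, e0 (f i) = e i) -> orbit_set B J S0 S.
Proof.
move=> SB cw cw0 ow0 P1 fI fe.
pose h := \sum_i cell_proj (e i) (w i) (w0 (f i)).
have wB i : w i *m B *m (w i)^T = sg (e i) *: Gam by have [] := cw i.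
have SB1 : S *m B = -1 *: (B *m S^T) by rewrite SB scaleN1r.
have hS : S *m h = h *m S0.
  apply: (@intertwining_sum S S0 TS _ _ _ _ _ SB1 _ _ wB) => i.
    by have [_ ->] := cw i.
  by have [_ ->] := cw0 (f i).
have hJ : J *m h = h *m J.
  apply: (@intertwining_sum J J TJ _ _ _ _ _ JB _ _ wB) => i.
    by have [->] := cw i.
  by have [->] := cw0 (f i).
have hB : h *m B *m h^T = B.
  rewrite /h [in X in _ *m X]linear_sum /= mulmx_suml mulmx_suml -[RHS]mul1mx -P1 mulmx_suml.
  apply: eq_bigr => i _; rewrite mulmx_sumr (bigD1 i) //= big1 ?addr0; last first.
    move=> j ji; rewrite /cell_proj !trmx_mul trmxK -!mulmxA.
    rewrite (mulmxA (w0 (f i))) (mulmxA (w0 (f i) *m B)) ow0 ?mul0mx ?mulmx0 //.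
    by apply: contra_neq ji => /fI ->.
  have [_ _ w0B _] := cw0 (f i); rewrite fe in w0B.
  have GT : (sg (e i) *: invmx Gam)^T = sg (e i) *: invmx Gam.
    by rewrite linearZ /= trmx_inv G_sym.
  rewrite /cell_proj !trmx_mul trmxK B_sym GT.
  rewrite -!mulmxA; do 2!congr (_ *m _).
  rewrite (mulmxA (w0 (f i))) (mulmxA (w0 (f i) *m B)) w0B.
  have GG : (sg (e i) *: Gam) *m (sg (e i) *: invmx Gam) = 1%:M.
    by rewrite -scalemxAl -scalemxAr scalerA sg_sqr scale1r mulmxV.
  by rewrite (mulmxA (sg (e i) *: Gam)) GG mul1mx.
have uh : h \in unitmx.
  by have : h *m B *m h^T \in unitmx; [rewrite hB|rewrite !unitmx_mul => /andP[/andP[]]].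
by exists h; [split|rewrite -hS mulmxK].
Qed.

Lemma gram_entry m1 m2 (A : 'M[R]_(m1, N)) (Q : 'M[R]_N) (D : 'M[R]_(m2, N)) k l :
  (A *m Q *m D^T) k l = (row k A *m Q *m (row l D)^T) 0 0.
Proof. by rewrite tr_row -row_mul !mxE; apply: eq_bigr => j _; rewrite !mxE. Qed.

(** All rows of the cells of one sign are stacked into one matrix, the input of [inertia]. *)
Lemma signed_stack (Q : 'M[R]_N) (I : finType) (e p : pred I) (s : bool)
    (w : I -> 'M[R]_(c, N)) :
  (forall i, w i *m Q *m (w i)^T = sg (e i) *: 1%:M) ->
  (forall i j, i != j -> w i *m Q *m (w j)^T = 0) ->
  (forall i, p i -> e i = s) ->
  exists A : 'M[R]_(#|{: {i | p i} * 'I_c}|, N), A *m Q *m A^T = sg s *: 1%:M.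
Proof.
move=> wQ oQ pe.
pose A : 'M[R]_(#|{: {i | p i} * 'I_c}|, N) :=
  \matrix_(k, j) w (val (enum_val k).1) (enum_val k).2 j.
exists A; apply/matrixP => k l.
have Ar x : row x A = row (enum_val x).2 (w (val (enum_val x).1)).
  by apply/rowP => j; rewrite !mxE.
rewrite gram_entry !Ar -gram_entry [RHS]mxE [X in _ = _ * X]mxE.
rewrite -(inj_eq enum_val_inj).
case: (enum_val k) (enum_val l) => [[i pi] a] [[j pj] b] /=.
have [eij|nij] := eqVneq i j.
  subst j; rewrite wQ [LHS]mxE [X in _ * X = _]mxE (pe _ pi).
  have -> : ((exist _ i pi, a) == (exist _ i pj, b) :> {i | p i} * 'I_c) = (a == b).
    by rewrite -pair_eqE /pair_eq /= -val_eqE /= eqxx.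
  by [].
by rewrite oQ // mxE -pair_eqE /pair_eq /= -val_eqE /= (negbTE nij) mulr0.
Qed.

Lemma mul_tr_eq0 m (z : 'rV[R]_m) : (z *m z^T) 0 0 <= 0 -> z = 0.
Proof.
rewrite mxE => h; apply/rowP => k; rewrite mxE.
have h0 : \sum_j z 0 j * z^T j 0 == 0.
  by rewrite eq_le h sumr_ge0 // => j _; rewrite mxE -expr2 sqr_ge0.
move: h0; rewrite psumr_eq0; last by move=> j _; rewrite mxE -expr2 sqr_ge0.
move=> /allP/(_ k (mem_index_enum k)); rewrite mxE -expr2 sqrf_eq0.
by move/eqP.
Qed.

(** The half of Sylvester's law that is used: if [x A + y D = 0], then [x x^T = - y y^T], so both
    vanish and the [a + b] rows are independent. *)
Lemma inertia (Q : 'M[R]_N) a b (A : 'M[R]_(a, N)) (D : 'M[R]_(b, N)) :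
  A *m Q *m A^T = 1%:M -> D *m Q *m D^T = - 1%:M -> (a + b <= N)%N.
Proof.
move=> AQ DQ; have : row_free (col_mx A D).
  apply: inj_row_free => v; rewrite -[v]hsubmxK mul_row_col.
  move: (lsubmx v) (rsubmx v) => x y /eqP; rewrite addr_eq0 => /eqP e.
  have ex : x *m x^T = (x *m A) *m Q *m (x *m A)^T.
    by rewrite trmx_mul !mulmxA -(mulmxA x A) -(mulmxA x) AQ mulmx1.
  have ey : y *m y^T = - ((y *m D) *m Q *m (y *m D)^T).
    by rewrite trmx_mul !mulmxA -(mulmxA y D) -(mulmxA y) DQ mulmxN mulmx1 mulNmx opprK.
  have exy : x *m x^T = - (y *m y^T).
    by rewrite ex ey e opprK linearN /= mulmxN !mulNmx opprK.
  have sqge m (z : 'rV[R]_m) : 0 <= (z *m z^T) 0 0.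
    by rewrite mxE sumr_ge0 // => j _; rewrite mxE -expr2 sqr_ge0.
  have x0 : x = 0 by apply: mul_tr_eq0; rewrite exy mxE oppr_le0 sqge.
  have y0 : y = 0.
    by apply: mul_tr_eq0; rewrite -[y *m _]opprK -exy mxE oppr_le0 sqge.
  by rewrite x0 y0 row_mx0.
by move/eqP => <-; exact: rank_leq_col.
Qed.

(** The positive cells of [S] for [Q] and the negative cells of [S0] for [Q0], transported by [T],
    are together independent, and both operators have the same number of cells; so [S] has at most
    as many positive cells as [S0]. Exchanging signs bounds the negative ones. Two forms appear
    because [beta_S] depends on [S]. *)
Lemma orbit_of_cells S S0 : S *m B = - (B *m S^T) -> S0 *m B = - (B *m S0^T) ->
  has_cells S -> has_cells S0 ->
  pos \/ (exists Q Q0 T : 'M[R]_N, [/\ Q0 = T *m Q *m T^T, T \in unitmx,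
    forall e w, cell S e w -> w *m Q *m w^T = sg e *: 1%:M,
    forall e w, cell S0 e w -> w *m Q0 *m w^T = sg e *: 1%:M &
    (forall e w e' w', cell S e w -> cell S e' w' ->
      w *m B *m w'^T = 0 -> w *m Q *m w'^T = 0) /\
    (forall e w e' w', cell S0 e w -> cell S0 e' w' ->
      w *m B *m w'^T = 0 -> w *m Q0 *m w'^T = 0)]) ->
  orbit_set B J S0 S.
Proof.
move=> SB S0B hc hc0 sgn.
have [I [e [w [cw ow P1 nI]]]] := full_decomposition SB hc.
have [I0 [e0 [w0 [cw0 ow0 _ nI0]]]] := full_decomposition S0B hc0.
have card_eq : (#|I| = #|I0|)%N.
  by apply/eqP; rewrite -(eqn_pmul2r (ltn0Sn c')) nI nI0.
have cardC (K : finType) (p : pred K) : (#|p| + #|predC p| = #|K|)%N.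
  exact: cardC.
have le_of (K K0 : finType) (p : pred K) (p0 : pred K0) : (#|K| = #|K0|)%N ->
    (#|p| * c + #|predC p0| * c <= N)%N -> (#|K0| * c = N)%N -> (#|p| <= #|p0|)%N.
  move=> _; rewrite -mulnDl => h hN; move: h; rewrite -hN leq_pmul2r //.
  by rewrite -(cardC _ p0) leq_add2r.
have sz (K : finType) (p : pred K) : #|{: {i | p i} * 'I_c}| = (#|p| * c)%N.
  by rewrite card_prod card_sig card_ord.
suff [f fI fe] : exists2 f : I -> I0, injective f & forall i, e0 (f i) = e i.
  exact: intertwiner cw cw0 ow0 P1 fI fe.
case: sgn => [hp|[Q [Q0 [T [Q0E uT cQ cQ0 [oQ oQ0]]]]]].
  have et i : e i by have [_ _ _] := cw i; apply.
  have et0 i : e0 i by have [_ _ _] := cw0 i; apply.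
  apply: injective_preserving_sign.
    rewrite (eq_card (B := I)); last by move=> i; exact: et.
    by rewrite card_eq (eq_card (B := e0)) //; move=> i; rewrite [RHS]et0.
  by rewrite eq_card0 // => i; rewrite !inE et.
have wQ i : w i *m Q *m (w i)^T = sg (e i) *: 1%:M by exact: cQ.
have wQ0 i : w0 i *m Q0 *m (w0 i)^T = sg (e0 i) *: 1%:M by exact: cQ0.
have owQ i j : i != j -> w i *m Q *m (w j)^T = 0.
  by move=> ij; apply: (oQ _ _ _ _ (cw i) (cw j)); exact: ow.
have owQ0 i j : i != j -> w0 i *m Q0 *m (w0 j)^T = 0.
  by move=> ij; apply: (oQ0 _ _ _ _ (cw0 i) (cw0 j)); exact: ow0.
have transport a (A : 'M[R]_(a, N)) : (A *m T) *m Q *m (A *m T)^T = A *m Q0 *m A^T.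
  by rewrite Q0E trmx_mul !mulmxA.
apply: injective_preserving_sign; apply: (le_of _ _ _ _ card_eq) => //.
  have [A AQ] := signed_stack (p := e) (s := true) wQ owQ (fun i h => h).
  have [D DQ] := signed_stack (p := predC e0) (s := false) wQ0 owQ0 (fun i => @negbTE _).
  rewrite -!sz; apply: (@inertia Q _ _ A (D *m T)).
    by rewrite AQ scale1r.
  by rewrite transport DQ scaleN1r.
have [A AQ] := signed_stack (p := predC e) (s := false) wQ owQ (fun i => @negbTE _).
have [D DQ] := signed_stack (p := e0) (s := true) wQ0 owQ0 (fun i h => h).
have -> : #|predC (predC e0)| = #|e0| by apply: eq_card => i; rewrite !inE negbK.
rewrite -!sz addnC; apply: (@inertia Q _ _ (D *m T) A).
  by rewrite transport DQ scale1r.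
by rewrite AQ scaleN1r.
Qed.

End Cells.

(** * Existence of cells in each of the four sign patterns *)

Section CellExistence.
Variables (R : realType) (N : nat) (B J S : 'M[R]_N) (ell lam : R).
Hypotheses (B_sym : B^T = B) (J2 : J *m J = - 1%:M) (JB : J *m B = ell *: (B *m J^T)).
Hypotheses (S2 : S *m S = lam%:M) (SB : S *m B = - (B *m S^T)) (SJ : S *m J = - (J *m S)).
Implicit Types x y v : 'rV[R]_N.

Definition bil x y : R := (x *m B *m y^T) 0 0.

Lemma bilE x y : x *m B *m y^T = (bil x y)%:M.
Proof. exact: mx11_scalar. Qed.

Lemma bilC x y : bil x y = bil y x.
Proof.
rewrite /bil -[in LHS]B_sym -[x *m _]trmxK trmx_mul trmxK -trmx_mul mxE.
by rewrite mulmxA.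
Qed.

Lemma bilDl x y z : bil (x + y) z = bil x z + bil y z.
Proof. by rewrite /bil !mulmxDl mxE. Qed.

Lemma bilDr x y z : bil z (x + y) = bil z x + bil z y.
Proof. by rewrite !(bilC z) bilDl. Qed.

Lemma bilZl a x z : bil (a *: x) z = a * bil x z.
Proof. by rewrite /bil -!scalemxAl mxE. Qed.

Lemma bilZr a x z : bil z (a *: x) = a * bil z x.
Proof. by rewrite !(bilC z) bilZl. Qed.

Lemma bilNl x z : bil (- x) z = - bil x z.
Proof. by rewrite -scaleN1r bilZl mulN1r. Qed.

Lemma bilNr x z : bil z (- x) = - bil z x.
Proof. by rewrite !(bilC z) bilNl. Qed.

Lemma bilJ x y : bil (x *m J) y = ell * bil x (y *m J).
Proof. by rewrite /bil -(mulmxA x) JB -scalemxAr -scalemxAl mxE trmx_mul !mulmxA. Qed.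

Lemma bilS x y : bil (x *m S) y = - bil x (y *m S).
Proof. by rewrite /bil -(mulmxA x) SB mulmxN mulNmx mxE trmx_mul !mulmxA. Qed.

Lemma mulJJ x : x *m J *m J = - x.
Proof. by rewrite -mulmxA J2 mulmxN mulmx1. Qed.

Lemma mulSS x : x *m S *m S = lam *: x.
Proof. by rewrite -mulmxA S2 mul_mx_scalar. Qed.

Lemma mulSJ x : x *m S *m J = - (x *m J *m S).
Proof. by rewrite -!mulmxA SJ mulmxN. Qed.

(** The candidates for [v] are recorded because linear conditions on [x] and [y], such as being
    fixed by [S], must pass to [v]. *)
Lemma polarization (f : 'rV[R]_N -> 'rV[R]_N -> R) (U : 'M[R]_N) x y :
  (forall x y z, f (x + y) z = f x z + f y z) -> (forall x y, f x y = f y x) ->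
  (x <= U)%MS -> (y <= U)%MS -> f x y != 0 ->
  exists v, [/\ (v <= U)%MS, f v v != 0 & v = x \/ v = y \/ v = x + y].
Proof.
move=> fD fC xU yU xy.
have [x0|x0] := eqVneq (f x x) 0; last by exists x; split=> //; left.
have [y0|y0] := eqVneq (f y y) 0; last by exists y; split=> //; right; left.
exists (x + y); split; [exact: addmx_sub| |by right; right].
rewrite fD !(fC _ (x + y)) !fD x0 y0 (fC y x) add0r addr0 -mulr2n.
by rewrite mulrn_eq0.
Qed.

Lemma nondegenerate_pair U : stable_nondegenerate B J S U -> U != 0 ->
  exists x y, [/\ (x <= U)%MS, (y <= U)%MS & bil x y != 0].
Proof.
move=> [_ _ nd] U0; apply: contrapT => h; case/negP: U0; apply/eqP.
apply/row_matrixP => i; rewrite row0; apply: nd; first exact: row_sub.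
move=> y yU; rewrite bilE; have [->|xy] := eqVneq (bil (row i U) y) 0.
  by rewrite raddf0.
by case: h; exists (row i U), y; split=> //; exact: row_sub.
Qed.

Lemma stableJ U x : stable_nondegenerate B J S U -> (x <= U)%MS -> (x *m J <= U)%MS.
Proof. by move=> [UJ _ _] xU; apply: submx_trans UJ; exact: submxMr. Qed.

Lemma stableS U x : stable_nondegenerate B J S U -> (x <= U)%MS -> (x *m S <= U)%MS.
Proof. by move=> [_ US _] xU; apply: submx_trans US; exact: submxMr. Qed.

Lemma gram_col a b (x z : 'M[R]_(a, N)) (y t : 'M[R]_(b, N)) :
  col_mx x y *m B *m (col_mx z t)^T =
  block_mx (x *m B *m z^T) (x *m B *m t^T) (y *m B *m z^T) (y *m B *m t^T).
Proof. by rewrite mul_col_mx tr_col_mx mul_col_row. Qed.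

Section Quaternionic.
Hypothesis lamE : lam = -1.

(** The images of [v] under the quaternion units: [J] and [S] anticommute and both have square
    -1. *)
Definition quat_cell v : 'M[R]_((1 + 1) + (1 + 1), N) :=
  col_mx (col_mx v (v *m J)) (col_mx (v *m S) (v *m J *m S)).
Definition quat_TJ : 'M[R]_((1 + 1) + (1 + 1)) :=
  block_mx (block_mx 0 1%:M (- 1%:M) 0) 0 0 (block_mx 0 (- 1%:M) 1%:M 0).
Definition quat_TS : 'M[R]_((1 + 1) + (1 + 1)) := block_mx 0 1%:M (- 1%:M) 0.

Lemma quat_cellJ v : quat_cell v *m J = quat_TJ *m quat_cell v.
Proof.
rewrite /quat_cell /quat_TJ !mul_block_col !mul0mx !mulNmx !mul1mx !mul_col_mx.
rewrite !addr0 !add0r; congr col_mx; congr col_mx => //.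
- exact: mulJJ.
- exact: mulSJ.
- by rewrite mulSJ mulJJ mulNmx opprK.
Qed.

Lemma quat_cellS v : quat_cell v *m S = quat_TS *m quat_cell v.
Proof.
rewrite /quat_cell /quat_TS !mul_block_col !mul0mx !mulNmx !mul1mx !mul_col_mx.
by rewrite !addr0 !add0r !mulSS lamE !scaleN1r opp_col_mx.
Qed.

Lemma quat_gram v : quat_cell v *m B *m (quat_cell v)^T =
  block_mx (block_mx (bil v v)%:M (bil v (v *m J))%:M
                     (bil (v *m J) v)%:M (bil (v *m J) (v *m J))%:M)
           (block_mx (bil v (v *m S))%:M (bil v (v *m J *m S))%:M
                     (bil (v *m J) (v *m S))%:M (bil (v *m J) (v *m J *m S))%:M)
           (block_mx (bil (v *m S) v)%:M (bil (v *m S) (v *m J))%:M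
                     (bil (v *m J *m S) v)%:M (bil (v *m J *m S) (v *m J))%:M)
           (block_mx (bil (v *m S) (v *m S))%:M (bil (v *m S) (v *m J *m S))%:M
             (bil (v *m J *m S) (v *m S))%:M (bil (v *m J *m S) (v *m J *m S))%:M).
Proof.
by rewrite /quat_cell !gram_col !bilE.
Qed.

Lemma bil_vS v : bil v (v *m S) = 0.
Proof. by have := bilS v v; rewrite bilC => h; lra. Qed.

Lemma bilSS x y : bil (x *m S) (y *m S) = bil x y.
Proof. by rewrite bilS mulSS lamE scaleN1r bilNr opprK. Qed.

Definition quat_diag (a b : R) : 'M[R]_((1 + 1) + (1 + 1)) :=
  block_mx (block_mx a%:M 0 0 b%:M) 0 0 (block_mx a%:M 0 0 b%:M).

(** [S] is both skew and isometric for [B], so [v] is orthogonal to [vS] and the second pair of rows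
    repeats the Gram matrix of the first; only the two assumed orthogonality relations remain. *)
Lemma quat_gram_diag v : bil v (v *m J) = 0 -> bil v (v *m J *m S) = 0 ->
  quat_cell v *m B *m (quat_cell v)^T =
  quat_diag (bil v v) (bil (v *m J) (v *m J)).
Proof.
move=> vJ vJS.
have vSvJ : bil (v *m S) (v *m J) = 0 by rewrite bilS vJS oppr0.
have vSvJS : bil (v *m S) (v *m J *m S) = 0 by rewrite bilSS.
rewrite quat_gram !bilSS !bil_vS vJ vJS vSvJ.
rewrite (bilC (v *m J) v) vJ (bilC (v *m J *m S) v) vJS (bilC (v *m J) (v *m S)) vSvJ.
rewrite (bilC (v *m S) v) bil_vS (bilC (v *m J *m S) (v *m J)) bil_vS.
by rewrite !raddf0 block_mx0.
Qed.

Lemma quat_cell_sub U v : stable_nondegenerate B J S U -> (v <= U)%MS ->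
  (quat_cell v <= U)%MS.
Proof.
move=> nU vU; have vJ := stableJ nU vU.
by rewrite !col_mx_sub vU vJ !stableS.
Qed.

(** For [ell = -1] all of [J], [S] and [J S] are skew for [B], so [v], [vJ], [vS], [vJS] are
    orthogonal for every [v] and only the length needs scaling. The sign of [bil v v] survives
    scaling and becomes the sign of the cell. *)
Lemma hermitian_has_cells : ell = -1 ->
  has_cells B J quat_TJ quat_TS 1%:M false S.
Proof.
move=> ellE U nU U0; have [x [y [xU yU xy]]] := nondegenerate_pair nU U0.
have [v [vU vv _]] := polarization bilDl bilC xU yU xy.
pose k := (Num.sqrt `|bil v v|)^-1; pose e := 0 < bil v v.
have kk : k * k * bil v v = sg R e.
  have n0 : Num.sqrt `|bil v v| != 0 by rewrite sqrtr_eq0 -ltNge normr_gt0.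
  rewrite /k -invfM -expr2 sqr_sqrtr // /sg /e.
  by case: ltrgt0P vv => // h _; rewrite ?mulVf ?gt_eqF // ?invrN ?mulNr mulVf ?lt_eqF.
exists e, (quat_cell (k *: v)); split; last by apply: quat_cell_sub => //; exact: scalemx_sub.
set w := k *: v; have ww : bil w w = sg R e by rewrite /w bilZl bilZr mulrA.
have wJ : bil w (w *m J) = 0.
  by have := bilJ w w; rewrite ellE bilC => h; lra.
have wJJ : bil (w *m J) (w *m J) = bil w w.
  by rewrite bilJ ellE mulJJ bilNr mulN1r opprK.
have wJS : bil w (w *m J *m S) = 0.
  have := bilS w (w *m J); have := bilJ (w *m S) w; rewrite ellE mulSJ bilNl.
  by rewrite (bilC (w *m J *m S)) => h1 h2; lra.
split=> //; [exact: quat_cellJ|exact: quat_cellS|].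
rewrite quat_gram_diag // wJJ ww /quat_diag -!scalar_mx_block.
by rewrite scale_scalar_mx mulr1.
Qed.

Lemma complex_square_root (P Q : R) :
  exists a b : R, a ^+ 2 - b ^+ 2 = P /\ 2 * (a * b) = Q.
Proof.
have [a b] : {ab : R * R | (ab.1 +i* ab.2)%C ^+ 2 = (P +i* Q)%C}.
  by case E : (sqrtc (P +i* Q)%C) => [a b]; exists (a, b); rewrite -E sqr_sqrtc.
exists a.1, a.2; move: b; rewrite expr2 => -[<- <-].
by rewrite -!expr2; split=> //; ring.
Qed.

(* For ell = 1, scaling v by a complex number multiplies the complex number
   bil v v - i bil v (vJ) by its square. *)
Lemma complex_normalization U v : ell = 1 -> stable_nondegenerate B J S U ->
  (v <= U)%MS -> bil v v != 0 ->
  exists w k, [/\ (w <= U)%MS, bil w w = 1, bil w (w *m J) = 0 &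
    bil w (w *m J *m S) = k * bil v (v *m J *m S)].
Proof.
move=> ellE nU vU; set a := bil v v; set c := bil v (v *m J); set d := bil v _ => a0.
have D0 : a ^+ 2 + c ^+ 2 != 0.
  by rewrite paddr_eq0 ?sqr_ge0 // negb_and sqrf_eq0 a0.
(* [p + i q] is a square root of [1 / (a - i c)], so multiplying [v] by it turns [a - i c] into
   1. *)
have [p [q [Pe Qe]]] := complex_square_root (a / (a ^+ 2 + c ^+ 2)) (c / (a ^+ 2 + c ^+ 2)).
have JJ : bil (v *m J) (v *m J) = - a by rewrite bilJ ellE mulJJ bilNr mul1r.
have JS : bil (v *m J) (v *m S) = - d by rewrite bilC bilS.
have JJS : bil (v *m J) (v *m J *m S) = 0 by exact: bil_vS.
have cC : bil (v *m J) v = c by rewrite bilC.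
have vS := bil_vS v.
exists (p *: v + q *: (v *m J)), (p ^+ 2 + q ^+ 2); split.
- by apply: addmx_sub; apply: scalemx_sub => //; exact: stableJ.
- rewrite !(bilDl, bilDr, bilZl, bilZr) JJ cC -/a -/c.
  transitivity (a * (p ^+ 2 - q ^+ 2) + c * (2 * (p * q))); first by ring.
  by rewrite Pe Qe; field.
- rewrite mulmxDl -!scalemxAl mulJJ !(bilDl, bilDr, bilZl, bilZr, bilNr) JJ cC -/a -/c.
  transitivity (c * (p ^+ 2 - q ^+ 2) - a * (2 * (p * q))); first by ring.
  by rewrite Pe Qe; field.
- rewrite mulmxDl -!scalemxAl mulJJ mulmxDl -!scalemxAl mulNmx.
  rewrite !(bilDl, bilDr, bilZl, bilZr, bilNr) JJS JS vS -/d.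
  by ring.
Qed.

(** For [ell = 1] the value [d = bil v (vJS)] need not vanish. Once [bil v (vJ) = 0], the cross
    terms [d] and [-d] cancel for [u = v + vS], and a second normalization keeps this zero while
    making the length 1. No sign remains, because [J] reverses the sign of [B]. *)
Lemma skew_hermitian_has_cells : ell = 1 ->
  has_cells B J quat_TJ quat_TS (quat_diag 1 (-1)) true S.
Proof.
move=> ellE U nU U0; have [x [y [xU yU xy]]] := nondegenerate_pair nU U0.
have [v0 [v0U v00 _]] := polarization bilDl bilC xU yU xy.
have [v [_ [vU vv vJ _]]] := complex_normalization ellE nU v0U v00.
pose u := v + v *m S.
have uU : (u <= U)%MS by apply: addmx_sub => //; exact: stableS.
have uu : bil u u != 0.
  rewrite /u !bilDl !bilDr bilSS bil_vS (bilC _ v) bil_vS vv !addr0 add0r.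
  by rewrite -mulr2n mulrn_eq0 oner_eq0.
have uJS : bil u (u *m J *m S) = 0.
  rewrite /u mulmxDl mulSJ mulmxDl mulNmx mulSS lamE scaleN1r opprK.
  by rewrite !bilDl !bilDr bilSS vJ bilS; ring.
have [w [k [wU ww wJ]]] := complex_normalization ellE nU uU uu.
rewrite uJS mulr0 => wJS.
exists true, (quat_cell w); split; last exact: quat_cell_sub.
split=> //; [exact: quat_cellJ|exact: quat_cellS|].
by rewrite quat_gram_diag // ww bilJ ellE mulJJ bilNr ww mul1r scale1r.
Qed.

End Quaternionic.

Section Paracomplex.
Hypothesis lamE : lam = 1.

Let plus x := x *m S = x.

Lemma plus_proj U x : stable_nondegenerate B J S U -> (x <= U)%MS ->
  ((x + x *m S)%R <= U)%MS /\ plus (x + x *m S).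
Proof.
move=> nU xU; split; first by apply: addmx_sub => //; exact: stableS.
by rewrite /plus mulmxDl mulSS lamE scale1r addrC.
Qed.

Lemma minus_plus x : x *m S = - x -> plus (x *m J).
Proof. by move=> xS; rewrite /plus -[LHS]opprK -mulSJ xS mulNmx opprK. Qed.

Lemma bil_plus x y : plus x -> plus y -> bil x y = 0.
Proof. by move=> xp yp; have := bilS x y; rewrite xp yp => h; lra. Qed.

(** Vectors fixed by [S] are orthogonal to each other, and [J] exchanges the eigenspaces of [S]. If
    all values [bil x (yJ)] vanished, a fixed vector in [U] would be orthogonal to both
    eigencomponents of every [y] in [U], hence zero; applying [J] would then kill the other
    eigenspace. *)
Lemma plus_pair U : stable_nondegenerate B J S U -> U != 0 ->
  exists x y, [/\ (x <= U)%MS, (y <= U)%MS, plus x, plus y & bil x (y *m J) != 0].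
Proof.
move=> nU U0; apply: contrapT => h.
have z x y : (x <= U)%MS -> (y <= U)%MS -> plus x -> plus y -> bil x (y *m J) = 0.
  move=> xU yU xp yp; apply/eqP; apply: contrapT => /negP xy.
  by apply: h; exists x, y.
have plus0 x : (x <= U)%MS -> plus x -> x = 0.
  move=> xU xp; have [_ _ nd] := nU; apply: nd => // y yU.
  rewrite bilE; suff -> : bil x y = 0 by rewrite raddf0.
  have [y1U y1p] := plus_proj nU yU.
  have y2S : (y - y *m S) *m S = - (y - y *m S).
    by rewrite mulmxBl mulSS lamE scale1r opprB.
  have y2U : ((y - y *m S)%R <= U)%MS.
    by apply: addmx_sub => //; rewrite eqmx_opp; exact: stableS.
  (* The second eigencomponent is expressed through the fixed vector [(y - yS) J], using
     [J^2 = -1]. *)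
  have e : y + y = (y + y *m S) - ((y - y *m S) *m J) *m J.
    by rewrite mulJJ opprK addrACA subrr addr0.
  have : bil x (y + y) = 0.
    rewrite e bilDr bilNr bil_plus // z ?subr0 //; first exact: stableJ.
    exact: minus_plus.
  by rewrite bilDr => h2; lra.
have all0 x : (x <= U)%MS -> x = 0.
  move=> xU; have [y1U y1p] := plus_proj nU xU.
  have e1 := plus0 _ y1U y1p.
  have xS : x *m S = - x by apply/eqP; rewrite -addr_eq0 addrC e1.
  have := plus0 _ (stableJ nU xU) (minus_plus xS).
  by move/(congr1 (mulmx^~ J)); rewrite mulJJ mul0mx => /eqP; rewrite oppr_eq0 => /eqP.
case/negP: U0; apply/eqP; apply/row_matrixP => i; rewrite row0.
by apply: all0; exact: row_sub.
Qed.

Definition para_cell a (v : 'M[R]_(a, N)) : 'M[R]_(a + a, N) := col_mx v (v *m J).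
Definition para_TJ a : 'M[R]_(a + a) := block_mx 0 1%:M (- 1%:M) 0.
Definition para_TS a : 'M[R]_(a + a) := block_mx 1%:M 0 0 (- 1%:M).

Lemma para_cellJ a (v : 'M[R]_(a, N)) : para_cell v *m J = para_TJ a *m para_cell v.
Proof.
rewrite /para_cell /para_TJ mul_block_col !mul0mx !mulNmx !mul1mx mul_col_mx.
by rewrite addr0 add0r -mulmxA J2 mulmxN mulmx1.
Qed.

Lemma para_cellS a (v : 'M[R]_(a, N)) : v *m S = v ->
  para_cell v *m S = para_TS a *m para_cell v.
Proof.
move=> vS; rewrite /para_cell /para_TS mul_block_col !mul0mx !mulNmx !mul1mx mul_col_mx.
by rewrite addr0 add0r -[v *m J *m S]opprK -!mulmxA -mulmxN -SJ !mulmxA vS.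
Qed.

Lemma para_cell_sub a U (v : 'M[R]_(a, N)) : stable_nondegenerate B J S U -> (v <= U)%MS ->
  (para_cell v <= U)%MS.
Proof.
move=> [UJ _ _] vU; rewrite col_mx_sub vU.
by apply: submx_trans UJ; exact: submxMr.
Qed.

Definition swap_mx a : 'M[R]_(a + a) := block_mx 0 1%:M 1%:M 0.

(** For [ell = 1] the form [bil x (yJ)] is symmetric on the vectors fixed by [S], so one vector on
    which it is nonzero spans a cell with its [J]-image. The sign of that form is the invariant of
    the cell; [B] itself is neutral there. *)
Lemma real_has_cells : ell = 1 ->
  has_cells B J (para_TJ 1) (para_TS 1) (swap_mx 1) false S.
Proof.
move=> ellE U nU U0; have [x [y [xU yU xp yp xy]]] := plus_pair nU U0.
have fD a b z : bil (a + b) (z *m J) = bil a (z *m J) + bil b (z *m J) by exact: bilDl.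
have fC a b : bil a (b *m J) = bil b (a *m J) by rewrite bilC bilJ ellE mul1r.
have [v [vU vv v3]] := @polarization (fun a b => bil a (b *m J)) U x y fD fC xU yU xy.
have vp : plus v by case: v3 => [->//|[->//|->]]; rewrite /plus mulmxDl xp yp.
pose b := bil v (v *m J); pose k := (Num.sqrt `|b|)^-1; pose e := 0 < b.
have kk : k * k * b = sg R e.
  have n0 : Num.sqrt `|b| != 0 by rewrite sqrtr_eq0 -ltNge normr_gt0.
  rewrite /k -invfM -expr2 sqr_sqrtr // /sg /e; rewrite -/b in vv.
  by case: ltrgt0P vv => // h _; rewrite ?mulVf ?gt_eqF // ?invrN ?mulNr mulVf ?lt_eqF.
have wp : (k *: v) *m S = k *: v by rewrite -scalemxAl vp.
exists e, (para_cell (k *: v)); split; last exact: (@para_cell_sub 1 U _ nU (scalemx_sub _ vU)).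
split=> //; [exact: (@para_cellJ 1)|exact: (@para_cellS 1)|].
have w0 : bil (k *: v) (k *: v) = 0 by exact: bil_plus.
have w1 : bil (k *: v) (k *: v *m J) = sg R e by rewrite -scalemxAl bilZl bilZr mulrA.
apply: etrans (@gram_col 1 1 _ _ _ _) _.
rewrite !bilE (bilC (_ *m J) (k *: v)) w0 w1.
rewrite bilJ ellE mulJJ bilNr w0 oppr0 mulr0 raddf0.
have sw : sg R e *: swap_mx 1 = block_mx 0 (sg R e)%:M (sg R e)%:M 0.
  by rewrite /swap_mx scale_block_mx !scaler0 scale_scalar_mx mulr1.
exact: esym sw.
Qed.

Definition symp_mx : 'M[R]_((1 + 1) + (1 + 1)) :=
  block_mx 0 (block_mx 0 1%:M (- 1%:M) 0) (block_mx 0 (- 1%:M) 1%:M 0) 0.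

(** For [ell = -1] the form [bil x (yJ)] is alternating, so a cell needs a symplectic pair [x], [u];
    rescaling [u] absorbs every sign. *)
Lemma symplectic_has_cells : ell = -1 ->
  has_cells B J (para_TJ (1 + 1)) (para_TS (1 + 1)) symp_mx true S.
Proof.
move=> ellE U nU U0; have [x [y [xU yU xp yp xy]]] := plus_pair nU U0.
pose k := (bil x (y *m J))^-1; pose u := k *: y.
have up : plus u by rewrite /plus -scalemxAl yp.
have xu : bil x (u *m J) = 1 by rewrite -scalemxAl bilZr mulVf.
have vS : col_mx x u *m S = col_mx x u by rewrite mul_col_mx xp up.
exists true, (para_cell (col_mx x u)); split; last first.
  apply: (@para_cell_sub (1 + 1) U _ nU); rewrite col_mx_sub xU; exact: scalemx_sub.
split=> //; [exact: (@para_cellJ (1 + 1))|exact: (@para_cellS (1 + 1))|].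
have self z : bil z (z *m J) = 0 by have := bilJ z z; rewrite ellE bilC => h; lra.
have ux : bil u (x *m J) = -1 by rewrite bilC bilJ ellE xu mulr1.
have jj a b : plus a -> plus b -> bil (a *m J) (b *m J) = 0.
  by move=> ap bp; rewrite bilJ ellE mulJJ bilNr bil_plus // oppr0 mulr0.
apply: etrans (@gram_col (1 + 1) (1 + 1) _ _ _ _) _.
rewrite (mul_col_mx x u J) !gram_col !bilE.
rewrite !jj // !self (bilC (x *m J) x) (bilC (u *m J) u) !self.
rewrite (bilC (x *m J) u) (bilC (u *m J) x) xu ux.
rewrite (bil_plus xp xp) (bil_plus xp up) (bil_plus up xp) (bil_plus up up).
by rewrite /symp_mx /= scale1r raddfN /= !raddf0 !block_mx0.
Qed.

End Paracomplex.
End CellExistence.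

(** * The complex linear model *)

(** [J] carries each of the eigenspaces for [mu] and [- mu] injectively into the other, so their
    ranks agree. Eigenvectors exist because [vA + mu v] and [vA - mu v] cannot both vanish for
    [v != 0]. *)
Lemma split_of_anticommuting (F : fieldType) N (A J : 'M[F]_N) (mu : F) :
  (0 < N)%N -> A *m A = (mu * mu)%:M -> mu != - mu -> J \in unitmx ->
  A *m J = - (J *m A) -> two_eigenspaces_same_dim A.
Proof.
case: N A J => // N A J _ AA mu0 uJ AJ.
have swap c (v : 'rV[F]_N.+1) : v *m A = c *: v -> (v *m J) *m A = - c *: (v *m J).
  move=> vA; rewrite -mulmxA -[J *m A]opprK -AJ mulmxN mulmxA vA.
  by rewrite -scalemxAl scaleNr.
have nz c (v : 'rV[F]_N.+1) : v != 0 -> v *m J != 0.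
  apply: contra_neq => /(congr1 (mulmx^~ (invmx J))); by rewrite mulmxK // mul0mx.
have rank_le c : (\rank (eigenspace A c) <= \rank (eigenspace A (- c)))%N.
  rewrite -(mxrankMfree (eigenspace A c) (_ : row_free J)) ?row_free_unit //.
  apply: mxrankS; apply/row_subP => i; rewrite row_mul; apply/eigenspaceP.
  by apply: swap; apply/eigenspaceP; exact: row_sub.
have eig c : eigenvalue A c -> eigenvalue A (- c).
  move=> /eigenvalueP[v vA v0]; apply/eigenvalueP; exists (v *m J); first exact: swap.
  exact: nz.
exists mu, (- mu); split=> //; last first.
  by apply/eqP; rewrite eqn_leq rank_le -{2}[mu]opprK rank_le.
have emu : eigenvalue A mu.
  pose v : 'rV[F]_N.+1 := delta_mx 0 0.
  have v0 : v != 0.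
    by apply/eqP => /rowP/(_ 0)/eqP; rewrite !mxE !eqxx oner_eq0.
  have vAA : v *m A *m A = (mu * mu) *: v by rewrite -mulmxA AA mul_mx_scalar.
  pose x := v *m A + mu *: v; pose y := v *m A - mu *: v.
  have xA : x *m A = mu *: x.
    by rewrite /x mulmxDl vAA -scalemxAl scalerDr scalerA addrC.
  have yA : y *m A = - mu *: y.
    by rewrite /y mulmxBl vAA -scalemxAl scalerBr !scaleNr scalerA opprK addrC.
  have [x0|x0] := eqVneq x 0; last by apply/eigenvalueP; exists x.
  have y0 : y != 0.
    apply: contra_neq v0 => y0.
    have : x - y = (mu - - mu) *: v.
      by rewrite /x /y opprB [v *m A + _]addrC addrACA subrr addr0 opprK scalerDl.
    rewrite x0 y0 subrr => /esym/eqP; rewrite scaler_eq0 subr_eq0 (negbTE mu0).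
    by move/eqP.
  by rewrite -[mu]opprK; apply: eig; apply/eigenvalueP; exists y.
move=> c; apply/idP/idP; last first.
  by rewrite !inE => /orP[] /eqP ->; [|exact: eig].
move=> /eigenvalueP[v vA v0]; rewrite !inE -eqf_sqr -subr_eq0.
have : (c ^+ 2 - mu ^+ 2) *: v = 0.
  have : v *m A *m A = (mu * mu) *: v by rewrite -mulmxA AA mul_mx_scalar.
  rewrite vA -scalemxAl vA scalerA => e.
  by rewrite scalerBl !expr2 e subrr.
by move/eqP; rewrite scaler_eq0 (negbTE v0) orbF.
Qed.

(** * Complex matrices as real block matrices *)

Section Realification.
Variables (R : realType) (n : nat).
Implicit Types z : 'M[R]_n * 'M[R]_n.

(** A row [(x, y)] stands for [x + i y], and this block matrix is right multiplication by
    [X + i Y]. *)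
Definition real_mx z : 'M[R]_(n + n) := block_mx z.1 z.2 (- z.2) z.1.
Lemma re_im_inj : injective (@re_im R n).
Proof. exact: (can_inj (@re_imK R n)). Qed.

Lemma real_mx_inj : injective real_mx.
Proof. by move=> [X Y] [X' Y'] /eq_block_mx[/= -> ->]. Qed.

Lemma re_imM (g h : 'M[R[i]]_n) : re_im (g *m h) =
  ((re_im g).1 *m (re_im h).1 - (re_im g).2 *m (re_im h).2,
   (re_im g).1 *m (re_im h).2 + (re_im g).2 *m (re_im h).1).
Proof.
congr pair; apply/matrixP => i j; rewrite !mxE raddf_sum /=.
  rewrite -sumrB; apply: eq_bigr => k _; rewrite !mxE.
  by case: (g i k) => a b; case: (h k j).
rewrite -big_split /=; apply: eq_bigr => k _; rewrite !mxE.
by case: (g i k) => a b; case: (h k j).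
Qed.

Lemma real_mxM (g h : 'M[R[i]]_n) : real_mx (re_im (g *m h)) = real_mx (re_im g) *m real_mx (re_im h).
Proof.
rewrite re_imM /real_mx mulmx_block /=; congr block_mx.
- by rewrite mulmxN.
- by rewrite opprD mulNmx mulmxN addrC.
- by rewrite mulNmx addrC.
Qed.

Lemma re_im1 : re_im (1%:M : 'M[R[i]]_n) = (1%:M, 0).
Proof.
by congr pair; apply/matrixP => i j; rewrite !mxE; case: (i == j).
Qed.

Lemma real_mx1 : real_mx (re_im (1%:M : 'M[R[i]]_n)) = 1%:M.
Proof. by rewrite re_im1 /real_mx /= oppr0 -scalar_mx_block. Qed.

Lemma real_mx_j z : real_mx z *m j_std R n = j_std R n *m real_mx z.
Proof.
rewrite /real_mx /j_std !mulmx_block !mulmx0 !mul0mx !mulmxN !mulNmx !mulmx1 !mul1mx.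
by rewrite !addr0 !add0r.
Qed.

Lemma real_mx_of_j (A : 'M[R]_(n + n)) : A *m j_std R n = j_std R n *m A ->
  A = real_mx (ulsubmx A, ursubmx A).
Proof.
rewrite -{1 2}[A]submxK /j_std !mulmx_block !mulmx0 !mul0mx !mulmxN !mulNmx !mulmx1 !mul1mx.
rewrite !addr0 !add0r => /eq_block_mx[e1 e2 _ _].
by rewrite -{1}[A]submxK /real_mx /= -e1 e2.
Qed.

Lemma re_im_conj (g : 'M[R[i]]_n) : re_im (conj_mx g) = ((re_im g).1, - (re_im g).2).
Proof. by congr pair; apply/matrixP => i j; rewrite !mxE; case: (g i j). Qed.

Lemma real_mx_unit (g : 'M[R[i]]_n) : real_mx (re_im g) \in unitmx -> g \in unitmx.
Proof.
move=> u; have e := real_mx_j (re_im g).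
have e' : invmx (real_mx (re_im g)) *m j_std R n = j_std R n *m invmx (real_mx (re_im g)).
  by apply: (canRL (mulmxK u)); rewrite -mulmxA -e mulKmx.
have : g *m cplx_mx (ulsubmx (invmx (real_mx (re_im g))), ursubmx (invmx (real_mx (re_im g)))) = 1%:M.
  apply: re_im_inj; apply: real_mx_inj.
  by rewrite real_mxM cplx_mxK -real_mx_of_j // mulmxV // real_mx1.
by case/mulmx1_unit.
Qed.

End Realification.

Section StandardStructure.
Variables (R : realType) (m : nat) (ell : R).
Hypothesis ell2 : ell * ell = 1.
Let n := (m + m)%N.
Let J := J_ell m ell.
Let B := b_mx R n.

Lemma j_std_sqr k : j_std R k *m j_std R k = - 1%:M.
Proof.
rewrite /j_std mulmx_block !mulmx0 !mul0mx !mulmxN !mulNmx !mulmx1 !addr0 !add0r.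
by rewrite -[RHS]/(- _) scalar_mx_block opp_block_mx !oppr0.
Qed.

Lemma b_mx_sym : B^T = B.
Proof. by rewrite /B /b_mx tr_block_mx !trmx0 !trmx1. Qed.

Lemma J_ell_sqr : J *m J = - 1%:M.
Proof.
rewrite /J /J_ell mulmx_block !mulmx0 !mul0mx !addr0 !add0r j_std_sqr.
rewrite -scalemxAl -scalemxAr scalerA ell2 scale1r -trmx_mul j_std_sqr.
by rewrite linearN /= trmx1 [in RHS]scalar_mx_block opp_block_mx !oppr0.
Qed.

Lemma J_ell_b : J *m B = ell *: (B *m J^T).
Proof.
rewrite /J /J_ell /B /b_mx tr_block_mx !mulmx_block linearZ /= trmxK.
rewrite !(trmx0, mulmx0, mul0mx, mulmx1, mul1mx, addr0, add0r).
by rewrite scale_block_mx !scaler0 scalerA ell2 scale1r.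
Qed.

Lemma J_ell_unit : J \in unitmx.
Proof.
have : J *m (- J) = 1%:M by rewrite mulmxN J_ell_sqr opprK.
by case/mulmx1_unit.
Qed.

Lemma trans_TT_J (M : complexManifold R m) (i j : idx M) p : dom i p -> dom j p ->
  trans_TT i j p *m J = J *m trans_TT i j p.
Proof.
move=> di dj; have uT := trans_jacV di dj; have h := holomorphic_charts di dj.
rewrite /trans_TT /J /J_ell !mulmx_block !mulmx0 !mul0mx !addr0 !add0r.
move: (trans_jac i j p) uT h => T uT h.
congr block_mx => //; rewrite -scalemxAl -scalemxAr -!trmx_mul; congr (_ *: _^T).
by apply: (canRL (mulKmx uT)); rewrite mulmxA -h mulmxK.
Qed.

Section Model.
Variables (a : 'M[R]_(n, n + n)) (sig P Q : 'M[R]_n) (lam : R).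
Hypotheses (sig2 : sig *m sig = 1%:M) (sigT : sig^T = sig).
Hypotheses (aBa : a *m B *m a^T = sig) (aJBa : a *m J *m B *m a^T = 0).
Hypotheses (PQ2 : P *m P + Q *m Q = lam%:M) (PQC : P *m Q = Q *m P).
Hypotheses (Psig : P *m sig = - (sig *m P^T)) (Qsig : Q *m sig = ell *: (sig *m Q^T)).

(** A complex basis [a] followed by its [J]-multiples; in it [J] becomes [j_std] and the form
    becomes [B0]. *)
Definition frame_mx : 'M[R]_(n + n) := col_mx a (a *m J).
Let C := frame_mx.
Let B0 : 'M[R]_(n + n) := block_mx sig 0 0 (- ell *: sig).
(** The antilinear map [x |-> conj(x) (P + i Q)]. [PQ2] and [PQC] say that its square is [lam];
    [Psig] and [Qsig] say that it is skew for [B0]. *)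
Let T0 : 'M[R]_(n + n) := block_mx P Q Q (- P).

Lemma frame_J : C *m J = j_std R n *m C.
Proof.
rewrite /C /frame_mx /j_std mul_block_col !mul0mx !mulNmx !mul1mx mul_col_mx.
by rewrite -mulmxA J_ell_sqr mulmxN mulmx1 addr0 add0r.
Qed.

Lemma frame_B : C *m B *m C^T = B0.
Proof.
rewrite /C /frame_mx mul_col_mx tr_col_mx mul_col_row aBa aJBa /B0.
have BJ : B *m J^T = ell *: (J *m B) by rewrite J_ell_b scalerA ell2 scale1r.
have e1 (x : 'M[R]_(n, n + n)) : x *m B *m (a *m J)^T = ell *: (x *m J *m B *m a^T).
  by rewrite trmx_mul mulmxA -(mulmxA x) BJ -scalemxAr -scalemxAl !mulmxA.
rewrite !e1 aJBa scaler0; congr block_mx.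
by rewrite -(mulmxA a J) J_ell_sqr mulmxN mulmx1 !mulNmx aBa scalerN scaleNr.
Qed.

Lemma frame_unit : C \in unitmx.
Proof.
have : B0 *m block_mx sig 0 0 (- ell *: sig) = 1%:M.
  rewrite /B0 mulmx_block !mulmx0 !mul0mx !addr0 !add0r sig2.
  by rewrite -scalemxAl -scalemxAr scalerA mulrNN ell2 scale1r sig2 -scalar_mx_block.
by rewrite -frame_B -!mulmxA => /mulmx1_unit[].
Qed.

Let uC := frame_unit.

Definition frame_conj (A : 'M[R]_(n + n)) : 'M[R]_(n + n) := invmx C *m A *m C.

Lemma frame_conjM A A' : frame_conj (A *m A') = frame_conj A *m frame_conj A'.
Proof. by rewrite /frame_conj !mulmxA mulmxK. Qed.

Lemma frame_conjK A : C *m frame_conj A *m invmx C = A.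
Proof. by rewrite /frame_conj !mulmxA mulmxV // mul1mx mulmxK. Qed.

Lemma frame_conjVK A : frame_conj (C *m A *m invmx C) = A.
Proof. by rewrite /frame_conj !mulmxA mulVmx // mul1mx mulmxKV. Qed.

Lemma frame_conj_inj : injective frame_conj.
Proof. by move=> A A' e; rewrite -[A]frame_conjK e frame_conjK. Qed.

Lemma frame_conjN A : frame_conj (- A) = - frame_conj A.
Proof. by rewrite /frame_conj mulmxN mulNmx. Qed.

Lemma frame_conj_J : frame_conj (j_std R n) = J.
Proof. by rewrite /frame_conj -mulmxA -frame_J mulKmx. Qed.

Lemma frame_conj_b A : C *m (frame_conj A *m B) *m C^T = A *m B0.
Proof. by rewrite -frame_B /frame_conj !mulmxA mulmxV // mul1mx. Qed.

Lemma frame_conj_bT A : C *m (B *m (frame_conj A)^T) *m C^T = B0 *m A^T.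
Proof.
have uCT : C^T \in unitmx by rewrite unitmx_tr.
rewrite -frame_B /frame_conj !trmx_mul trmx_inv !mulmxA.
by rewrite mulmxKV.
Qed.

Lemma frame_gram A :
  C *m (frame_conj A *m B *m (frame_conj A)^T) *m C^T = A *m B0 *m A^T.
Proof.
have uCT : C^T \in unitmx by rewrite unitmx_tr.
rewrite -frame_B /frame_conj !trmx_mul trmx_inv !mulmxA mulmxV // mul1mx.
by rewrite mulmxKV.
Qed.

Lemma frame_b_inj A A' : C *m A *m C^T = C *m A' *m C^T -> A = A'.
Proof.
have uCT : C^T \in unitmx by rewrite unitmx_tr.
by move/(can_inj (mulmxK uCT))/(can_inj (mulKmx uC)).
Qed.

Definition std_op : 'M[R]_(n + n) := frame_conj T0.

Lemma std_op_sqr : std_op *m std_op = lam%:M.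
Proof.
rewrite /std_op -frame_conjM /T0 mulmx_block !mulmxN !mulNmx opprK PQ2 PQC.
rewrite !subrr (addrC (Q *m Q)) PQ2 -scalar_mx_block.
by rewrite /frame_conj scalar_mxC mulmxKV.
Qed.

Lemma std_op_J : std_op *m J = - (J *m std_op).
Proof.
rewrite /std_op -frame_conj_J -!frame_conjM -frame_conjN; congr frame_conj.
rewrite /T0 /j_std !mulmx_block !mulmx0 !mul0mx !mulmxN !mulNmx !mulmx1 !mul1mx.
by rewrite !addr0 !add0r opp_block_mx !opprK.
Qed.

Lemma std_op_b : std_op *m B = - (B *m std_op^T).
Proof.
apply: frame_b_inj; rewrite mulmxN mulNmx frame_conj_b frame_conj_bT.
rewrite /T0 /B0 tr_block_mx !mulmx_block !mulmx0 !mul0mx !addr0 !add0r opp_block_mx.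
rewrite linearN /= mulmxN -!scalemxAr -!scalemxAl.
congr block_mx => //.
- by rewrite Qsig scaleNr scalerA ell2 scale1r.
- by rewrite Qsig scaleNr opprK.
- by rewrite mulNmx Psig ?(scaleNr, scalerN, mulmxN, opprK).
Qed.

Definition frame_Phi (z : 'M[R]_n * 'M[R]_n) : 'M[R]_(n + n) := frame_conj (real_mx z).
Definition frame_Psi (A : 'M[R]_(n + n)) : 'M[R]_n * 'M[R]_n :=
  let A' := C *m A *m invmx C in (ulsubmx A', ursubmx A').

Lemma frame_Phi_smooth z : smooth_at frame_Phi z.
Proof.
apply: smooth_at_mulmx; last exact: smooth_at_cst.
apply: smooth_at_mulmx; first exact: smooth_at_cst.
have h : smooth_at (fun z : 'M[R]_n * 'M[R]_n => block_mx z.1 0 0 z.1 +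
   block_mx z.2 0 0 z.2 *m j_std R n) z.
  apply: smooth_atD; first by apply: smooth_at_block_diag; exact: smooth_at_fst.
  apply: smooth_at_mulmx; last exact: smooth_at_cst.
  by apply: smooth_at_block_diag; exact: smooth_at_snd.
apply: smooth_at_ext h => w.
rewrite /real_mx /j_std mulmx_block !mulmx0 !mul0mx !mulmxN !mulmx1 !addr0 !add0r.
by rewrite add_block_mx !addr0 !add0r.
Qed.

Lemma frame_Psi_smooth A : smooth_at frame_Psi A.
Proof.
have h : smooth_at (fun A => C *m A *m invmx C) A.
  apply: smooth_at_mulmx; last exact: smooth_at_cst.
  by apply: smooth_at_mulmx; [exact: smooth_at_cst|exact: smooth_at_id].
by apply: smooth_at_pair; do 2!apply: smooth_at_mxlin.
Qed.

Lemma frame_PhiK z : frame_Psi (frame_Phi z) = z.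
Proof.
by case: z => X Y; rewrite /frame_Psi /frame_Phi frame_conjK block_mxKul block_mxKur.
Qed.

Lemma frame_PsiK A : A *m J = J *m A -> frame_Phi (frame_Psi A) = A.
Proof.
move=> AJ; rewrite /frame_Phi /frame_Psi -[X in _ = X]frame_conjVK; congr frame_conj.
rewrite -real_mx_of_j //; apply: frame_conj_inj.
by rewrite [LHS]frame_conjM [RHS]frame_conjM frame_conj_J frame_conjVK.
Qed.

(** Real and imaginary parts of [g sig g^T = sig] for [ell = 1] and, up to the sign of the imaginary
    part, of [g sig conj(g)^T = sig] for [ell = -1]. The transposed factor stands on the right
    because [g] acts on rows. *)
Definition frame_unitary (z : 'M[R]_n * 'M[R]_n) : Prop :=
  z.1 *m sig *m z.1^T - ell *: (z.2 *m sig *m z.2^T) = sig /\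
  z.1 *m sig *m z.2^T + ell *: (z.2 *m sig *m z.1^T) = 0.

Lemma frame_unitaryP z : frame_unitary z <-> isom_group B J (frame_Phi z).
Proof.
have e : frame_unitary z <-> real_mx z *m B0 *m (real_mx z)^T = B0.
  rewrite /real_mx /B0 tr_block_mx !mulmx_block !(mulmx0, addr0, add0r) linearN /=.
  rewrite !(mulmxN, mulNmx, opprK, scaleNr) -!scalemxAr -!scalemxAl.
  split=> [[h1 h2]|/eq_block_mx[h1 h2 _ _]]; last first.
    split; first by rewrite -[RHS]h1.
    by apply: oppr_inj; rewrite oppr0 -[RHS]h2 opprD.
  have h3 : z.2 *m sig *m z.1^T + ell *: (z.1 *m sig *m z.2^T) = 0.
    have := congr1 trmx h2; rewrite linearD linearZ /= !trmx_mul !trmxK sigT trmx0.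
    by rewrite !mulmxA.
  congr block_mx.
  - by rewrite -[RHS]h1.
  - by rewrite -opprD h2 oppr0.
  - by rewrite -opprD h3 oppr0.
  - have := congr1 (fun A => - (ell *: A)) h1.
    by rewrite scalerBr scalerA ell2 scale1r opprB.
rewrite e /frame_Phi; split=> [h|[_ h _]].
  have hJ : frame_conj (real_mx z) *m J = J *m frame_conj (real_mx z).
    by rewrite -frame_conj_J -!frame_conjM real_mx_j.
  have hB : frame_conj (real_mx z) *m B *m (frame_conj (real_mx z))^T = B.
    by apply: frame_b_inj; rewrite frame_gram h frame_B.
  split=> //.
  by have := b_mx_unit R n; rewrite -/B -{1}hB !unitmx_mul => /andP[/andP[]].
by rewrite -frame_gram h frame_B.
Qed.

Lemma frame_Phi_unit g : isom_group B J (frame_Phi (re_im g)) -> g \in unitmx.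
Proof.
case=> u _ _; apply: real_mx_unit; move: u.
by rewrite /frame_Phi /frame_conj !unitmx_mul => /andP[/andP[]].
Qed.

Lemma frame_PhiM g h : frame_Phi (re_im (g *m h)) = frame_Phi (re_im g) *m frame_Phi (re_im h).
Proof. by rewrite /frame_Phi real_mxM frame_conjM. Qed.

(* T0 is diag(1, -1) times the real form of K = P + iQ, and moving diag(1, -1)
   across the real form of g conjugates g. *)
Lemma frame_Phi_comm g : conj_mx g *m cplx_mx (P, Q) = cplx_mx (P, Q) *m g <->
  frame_Phi (re_im g) *m std_op = std_op *m frame_Phi (re_im g).
Proof.
pose D : 'M[R]_(n + n) := block_mx 1%:M 0 0 (- 1%:M).
have D2 : D *m D = 1%:M.
  rewrite /D mulmx_block !(mulmx0, mul0mx, mulmx1, mulNmx, mul1mx, addr0, add0r).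
  by rewrite opprK -scalar_mx_block.
have T0E : T0 = D *m real_mx (re_im (cplx_mx (P, Q))).
  rewrite cplx_mxK /D /real_mx mulmx_block.
  by rewrite !(mulmx0, mul0mx, mulmx1, mulNmx, mulmxN, mul1mx, addr0, add0r) opprK.
have gD : real_mx (re_im g) *m D = D *m real_mx (re_im (conj_mx g)).
  rewrite re_im_conj /D /real_mx !mulmx_block /=.
  by rewrite !(mulmx0, mul0mx, mulmx1, mulNmx, mulmxN, mul1mx, addr0, add0r) opprK.
rewrite /std_op /frame_Phi -!frame_conjM T0E mulmxA gD -!(mulmxA D) -!real_mxM.
split=> [->//|] /frame_conj_inj /(congr1 (mulmx D)).
by rewrite !mulmxA D2 !mul1mx => /real_mx_inj/re_im_inj.
Qed.

Section Bundle.
Variables (M : complexManifold R m) (I : tensor_End M -> Prop).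
Variables (Pt : 'M[R]_(n + n) -> Prop) (G H : set 'M[R[i]]_n).
Hypothesis lam0 : lam != 0.
Hypothesis GE : forall g, G g <-> frame_unitary (re_im g).
Hypothesis HE : forall g, G g ->
  (H g <-> conj_mx g *m cplx_mx (P, Q) = cplx_mx (P, Q) *m g).
Hypothesis PE : forall A, Pt A <-> orbit_set B J std_op A.
Hypothesis IP : forall S, I S -> section_End S /\ forall i p, dom i p -> Pt (S i p).

Lemma sections_of_model_bundle : sections_of_bundle I Pt G H.
Proof.
have GL g : G g <-> isom_group B J (frame_Phi (re_im g)).
  exact: iff_trans (GE g) (frame_unitaryP _).
apply: (sections_of_orbit_bundle lam0 std_op_sqr std_op_J std_op_b _ PE IP
  frame_Phi_smooth frame_Psi_smooth).
- by move=> i j p di dj; exact: trans_TT_J.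
- by move=> g /GL.
- move=> A LA; have [_ _ AJ] := LA.
  have e := frame_PsiK AJ; split=> //; apply/GL.
  by rewrite cplx_mxK e.
- by move=> g _; exact: frame_PhiK.
- move=> g h Gg Gh; have /GL Lg := Gg; have /GL Lh := Gh.
  have ug := frame_Phi_unit Lg; have [uPg _ _] := Lg.
  have e : frame_Phi (re_im (invmx g *m h)) =
      invmx (frame_Phi (re_im g)) *m frame_Phi (re_im h).
    by apply: (canRL (mulKmx uPg)); rewrite -frame_PhiM mulKVmx.
  split; last exact: e.
  by apply/GL; rewrite e; apply: isom_groupM => //; exact: isom_groupV.
- by move=> g Gg; apply: iff_trans (HE Gg) (frame_Phi_comm g).
Qed.

End Bundle.

End Model.
End StandardStructure.

Lemma skew_opP (R : realType) n (A : 'M[R]_(n + n)) :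
  skew_op A <-> A *m b_mx R n = - (b_mx R n *m A^T).
Proof.
split=> [h|h x y]; last first.
  by rewrite /b_form trmx_mul -[in LHS](mulmxA x) h mulmxN mulNmx !mulmxA mxE.
have entry (X : 'M[R]_(n + n)) i j : X i j = ((delta_mx 0 i : 'rV[R]_(n + n)) *m X *m (delta_mx 0 j : 'rV[R]_(n + n))^T) 0 0.
  by rewrite trmx_delta -rowE -colE !mxE.
apply/matrixP => i j; rewrite [RHS]mxE [LHS]entry [in RHS]entry !mulmxA.
by have := h (delta_mx 0 i) (delta_mx 0 j); rewrite /b_form (trmx_mul _ A) !mulmxA.
Qed.

Lemma split_op_of_anticommuting (R : realType) N (A J : 'M[R]_N) (lam : R) :
  (0 < N)%N -> lam = 1 \/ lam = -1 -> A *m A = lam%:M -> J \in unitmx ->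
  A *m J = - (J *m A) -> split_op lam A.
Proof.
move=> N0 hl AA uJ AJ; rewrite /split_op.
have m11 : (1 : R) != -1 by rewrite -subr_eq0 opprK -(natrD _ 1 1) pnatr_eq0.
case: hl AA => -> AA; first by rewrite eqxx; apply: (split_of_anticommuting (J := J) (mu := 1)); rewrite ?mulr1.
rewrite eq_sym (negbTE m11).
have uJ' : complexify J \in unitmx by rewrite map_unitmx.
apply: (split_of_anticommuting (J := complexify J) (mu := 'i)) => //.
- by rewrite /complexify -map_mxM AA map_scalar_mx -expr2 sqrCi rmorphN rmorph1.
- by rewrite -subr_eq0 opprK -mulr2n mulrn_eq0 /= neq0Ci.
- by rewrite /complexify -!map_mxM AJ map_mxN.
Qed.

(** * Pointwise structures as one orbit *)

Section PointwiseOrbits.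
Variables (R : realType) (m : nat) (ell lam : R).
Hypotheses (m0 : (0 < m)%N) (ell2 : ell * ell = 1) (hl : lam = 1 \/ lam = -1).
Let n := (m + m)%N.
Let J := J_ell m ell.
Let B := b_mx R n.

(** The equality of eigenspace dimensions comes from [J], which exchanges the eigenspaces of [A]. *)
Lemma lambda_ell_opP (A : 'M[R]_(n + n)) : lambda_ell_op lam ell A <->
  [/\ A *m A = lam%:M, A *m B = - (B *m A^T) & A *m J = - (J *m A)].
Proof.
have AJE : anticommute_J ell A <-> A *m J = - (J *m A).
  by rewrite /anticommute_J -/J; split=> ->; rewrite opprK.
split=> [[[AA _ /skew_opP AB] /AJE AJ]|[AA AB AJ]]; first by split.
split; last exact/AJE; split=> //; last exact/skew_opP.
apply: split_op_of_anticommuting hl AA (J_ell_unit m ell2) AJ.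
by rewrite !addn_gt0 m0.
Qed.

Variables (c : nat) (TJ TS Gam : 'M[R]_c.+1) (pos : bool) (S0 : 'M[R]_(n + n)).
Hypotheses (uG : Gam \in unitmx) (G_sym : Gam^T = Gam).
Hypothesis cells : forall S : 'M[R]_(n + n), S *m S = lam%:M ->
  S *m B = - (B *m S^T) -> S *m J = - (J *m S) -> has_cells B J TJ TS Gam pos S.
Hypotheses (S0S0 : S0 *m S0 = lam%:M) (S0B : S0 *m B = - (B *m S0^T)).
Hypothesis S0J : S0 *m J = - (J *m S0).

(** With [Gam = 1] the cells are orthonormal up to sign for [B] itself, so [B] serves as both
    counting forms. *)
Lemma lambda_ell_op_orbit : pos \/ Gam = 1%:M ->
  forall A, lambda_ell_op lam ell A <-> orbit_set B J S0 A.
Proof.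
move=> hp A; split=> [/lambda_ell_opP[AA AB AJ]|FA]; last first.
  apply/lambda_ell_opP; split; [exact: orbit_square FA|exact: orbit_B FA|exact: orbit_J FA].
apply: (orbit_of_cells (b_mx_unit R n) (b_mx_sym R m) (J_ell_b m ell2) uG G_sym AB S0B
  (cells AA AB AJ) (cells S0S0 S0B S0J)).
case: hp => [->|G1]; [by left|right]; exists B, B, 1%:M.
rewrite trmx1 mul1mx mulmx1 unitmx1; split=> // e w [_ _ + _]; by rewrite G1.
Qed.

End PointwiseOrbits.

Lemma has_signature_congr (R : realType) N (Q T : 'M[R]_N) p q : T \in unitmx ->
  has_signature (T *m Q *m T^T) p q -> has_signature Q p q.
Proof.
move=> uT [pq [P uP e]]; split=> //; exists (P *m T); first by rewrite unitmx_mul uP.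
by rewrite trmx_mul -e !mulmxA.
Qed.

Lemma congr_of_signature (R : realType) N (Q Q' : 'M[R]_N) p q :
  has_signature Q p q -> has_signature Q' p q ->
  exists2 T, T \in unitmx & Q' = T *m Q *m T^T.
Proof.
move=> [_ [P uP e]] [_ [P' uP' e']].
have uPT' : P'^T \in unitmx by rewrite unitmx_tr.
exists (invmx P' *m P); first by rewrite unitmx_mul unitmx_inv uP' uP.
rewrite trmx_mul trmx_inv !mulmxA -2!(mulmxA (invmx P')) e -e'.
by rewrite !mulmxA mulVmx // mul1mx mulmxK.
Qed.

(** A permutation matrix moves the positive entries to the front; the permutation is an injection
    matching [d] with the first [p] indices. *)
Lemma has_signature_diag (R : realType) N (d : pred 'I_N) p q :
  #|d| = p -> (p + q)%N = N -> has_signature (diag_mx (\row_i sg R (d i))) p q.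
Proof.
move=> dp pq; split=> //.
have lt_card : #|[pred i : 'I_N | (i < p)%N]| = p.
  rewrite -sum1_card (eq_bigl (fun i : 'I_N => (i < p)%N)) //.
  by rewrite -(big_ord_widen N (fun=> 1%N)) ?sum1_card ?card_ord // -pq leq_addr.
have [f fI fd] : exists2 f : 'I_N -> 'I_N, injective f & forall i, d (f i) = (i < p)%N.
  apply: injective_preserving_sign; first by rewrite dp lt_card.
  rewrite -(leq_add2l #|d|) cardC {1}dp -{1}lt_card; have := cardC [pred i : 'I_N | (i < p)%N].
  by move=> /= ->.
pose P : 'M[R]_N := \matrix_(i, j) (f i == j)%:R.
have PD (r : 'rV[R]_N) : P *m diag_mx r *m P^T = diag_mx (\row_i r 0 (f i)).
  apply/matrixP => i j; rewrite mul_mx_diag !mxE (bigD1 (f i)) //= big1 => [|k ki].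
    by rewrite !mxE eqxx mul1r addr0 (inj_eq fI) eq_sym mulr_natr.
  by rewrite !mxE eq_sym (negbTE ki) mul0r mul0r.
exists P.
  have := PD (const_mx 1); rewrite diag_const_mx mulmx1.
  rewrite (_ : \row_i _ = const_mx 1); last by apply/rowP => i; rewrite !mxE.
  by rewrite diag_const_mx => /mulmx1_unit[].
by rewrite PD; congr diag_mx; apply/rowP => i; rewrite !mxE fd.
Qed.

Section OneOne.
Variables (R : realType) (m k : nat).
Hypotheses (m0 : (0 < m)%N).
Let n := (m + m)%N.
Let J : 'M[R]_(n + n) := J_ell m 1.
Let B := b_mx R n.
Variable S0 : 'M[R]_(n + n).
Hypotheses (S0S0 : S0 *m S0 = 1%:M) (S0B : S0 *m B = - (B *m S0^T)).
Hypotheses (S0J : S0 *m J = - (J *m S0)) (S0k : beta_signature k S0).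

(** Conjugation by [t] in the group is a congruence of [beta_mx], so the signature is constant on
    the orbit. Conversely, equal signatures give a congruence [T] between the forms of [A] and [S0],
    and these forms count the signs of the cells. *)
Lemma one_one_op_orbit (A : 'M[R]_(n + n)) : one_one_op k A <-> orbit_set B J S0 A.
Proof.
have ell2 : 1 * 1 = 1 :> R by rewrite mulr1.
have hl : (1 : R) = 1 \/ (1 : R) = -1 by left.
split=> [[/(lambda_ell_opP m0 ell2 hl)[AA AB AJ] Ak]|FA]; last first.
  split.
    by apply/(lambda_ell_opP m0 ell2 hl); split; [exact: orbit_square FA|exact: orbit_B FA|exact: orbit_J FA].
  case: FA => t [ut tB tJ] ->.
  apply: (has_signature_congr (T := invmx t)); first by rewrite unitmx_inv.
  suff -> : invmx t *m beta_mx (t *m S0 *m invmx t) *m (invmx t)^T = beta_mx S0 by [].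
  have utT : t^T \in unitmx by rewrite unitmx_tr.
  have tB' : invmx t *m B = B *m t^T.
    by rewrite -[X in _ *m X = _]tB !mulmxA mulVmx // mul1mx.
  rewrite /beta_mx -/J -/B !mulmxA -(mulmxA _ J) -tJ !mulmxA mulVmx // mul1mx.
  by rewrite -(mulmxA _ (invmx t)) tB' !mulmxA trmx_inv mulmxK.
have cells := real_has_cells (b_mx_sym R m) (J_ell_sqr m ell2) (J_ell_b m ell2) _ _ _ erefl.
have GG : swap_mx R 1 *m swap_mx R 1 = 1%:M.
  rewrite /swap_mx mulmx_block !(mulmx0, mul0mx, mulmx1, addr0, add0r).
  by rewrite -scalar_mx_block.
have uG : swap_mx R 1 \in unitmx by case/mulmx1_unit: GG.
have GT : (swap_mx R 1)^T = swap_mx R 1 by rewrite /swap_mx tr_block_mx !trmx0 !trmx1.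
apply: (orbit_of_cells (c' := 1) (b_mx_unit R n) (b_mx_sym R m) (J_ell_b m ell2) uG GT AB
  S0B (cells _ AA AB AJ erefl) (cells _ S0S0 S0B S0J erefl)); right.
have [T uT e] := congr_of_signature Ak S0k.
have betaE (S : 'M[R]_(n + n)) x y (w : 'M[R]_(x, n + n)) (w' : 'M[R]_(y, n + n)) E F :
    w *m J = E *m w -> w *m S = F *m w ->
    w *m (- beta_mx S) *m w'^T = - (E *m F *m (w *m B *m w'^T)).
  move=> wJ wS; rewrite mulmxN mulNmx /beta_mx -/J -/B !mulmxA wJ.
  by rewrite -(mulmxA E w S) wS !mulmxA.
(* By this identity [beta_mx] has Gram matrix [- sg e] on a cell, so the negated form is the one
   whose signs agree with those of the cells. *)
have TG : para_TJ R 1 *m para_TS R 1 *m swap_mx R 1 = - 1%:M.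
  rewrite /para_TJ /para_TS /swap_mx !mulmx_block.
  rewrite !(mulmx0, mul0mx, mulmx1, mulNmx, mulmxN, mul1mx, addr0, add0r, oppr0).
  by rewrite [in RHS]scalar_mx_block opp_block_mx !oppr0.
exists (- beta_mx A), (- beta_mx S0), T; split=> //.
- by rewrite mulmxN mulNmx e.
- by move=> s w [wJ wS wB _]; rewrite (betaE _ _ _ _ _ _ _ wJ wS) wB -scalemxAr TG scalerN opprK.
- by move=> s w [wJ wS wB _]; rewrite (betaE _ _ _ _ _ _ _ wJ wS) wB -scalemxAr TG scalerN opprK.
- by split=> s w s' w' [wJ wS _ _] _ wB; rewrite (betaE _ _ _ _ _ _ _ wJ wS) wB mulmx0 oppr0.
Qed.

End OneOne.

(** * The four cases *)

Section ComplexMatrices.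
Variables (R : realType).

Lemma conj_mxM m n p (A : 'M[R[i]]_(m, n)) (B : 'M[R[i]]_(n, p)) :
  conj_mx (A *m B) = conj_mx A *m conj_mx B.
Proof. exact: map_mxM. Qed.

Lemma conj_mx1 n : conj_mx (1%:M : 'M[R[i]]_n) = 1%:M.
Proof. exact: map_mx1. Qed.

Lemma conj_mxK m n (A : 'M[R[i]]_(m, n)) : conj_mx (conj_mx A) = A.
Proof. by apply/matrixP => i j; rewrite !mxE conjcK. Qed.

Lemma conj_mx_tr m n (A : 'M[R[i]]_(m, n)) : conj_mx A^T = (conj_mx A)^T.
Proof. by rewrite /conj_mx map_trmx. Qed.

Lemma conj_complexify m n (A : 'M[R]_(m, n)) : conj_mx (complexify A) = complexify A.
Proof. by apply/matrixP => i j; rewrite !mxE /= oppr0. Qed.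

Lemma complexify_Re m n (A : 'M[R[i]]_(m, n)) : conj_mx A = A -> complexify (Re_mx A) = A.
Proof.
move=> h; apply/matrixP => i j; have := congr1 (fun X : 'M[R[i]]_(m, n) => X i j) h.
rewrite !mxE; case: (A i j) => x y /= [] /eqP; rewrite eq_sym -addr_eq0 -mulr2n.
by rewrite mulrn_eq0 /= => /eqP ->.
Qed.

Lemma complexify_inj m n : injective (@complexify R m n).
Proof.
move=> A B /matrixP h; apply/matrixP => i j; have := h i j.
by rewrite !mxE => -[].
Qed.

Lemma complexifyM m n p (A : 'M[R]_(m, n)) (B : 'M[R]_(n, p)) :
  complexify (A *m B) = complexify A *m complexify B.
Proof. exact: map_mxM. Qed.

Lemma complexify_tr m n (A : 'M[R]_(m, n)) : complexify A^T = (complexify A)^T.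
Proof. by rewrite /complexify map_trmx. Qed.

Lemma complexify_sig p N : complexify (sig_mx R p N) = sig_mx R[i] p N.
Proof.
rewrite /complexify /sig_mx map_diag_mx; congr diag_mx; apply/rowP => i.
by rewrite !mxE; case: ifP => _; rewrite ?rmorphN rmorph1.
Qed.

Lemma re_im_complexify n (A : 'M[R]_n) : re_im (complexify A) = (A, 0).
Proof. by congr pair; apply/matrixP => i j; rewrite !mxE. Qed.

Lemma complexifyE n (A : 'M[R]_n) : cplx_mx (A, 0) = complexify A.
Proof. by apply: re_im_inj; rewrite cplx_mxK re_im_complexify. Qed.

Lemma re_im_tr n (A : 'M[R[i]]_n) : re_im A^T = ((re_im A).1^T, (re_im A).2^T).
Proof. by congr pair; apply/matrixP => i j; rewrite !mxE. Qed.

Lemma conj_byE n (C X g : 'M[R[i]]_n) : C \in unitmx ->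
  conj_by C X = g <-> X = invmx C *m g *m C.
Proof.
by move=> uC; split=> [<-|->]; rewrite /conj_by !mulmxA ?mulVmx ?mulmxV // mul1mx
  ?mulmxKV ?mulmxK.
Qed.

Lemma conj_byP n (C X : 'M[R[i]]_n) : C \in unitmx -> conj_by C X *m C = C *m X.
Proof. by move=> uC; rewrite /conj_by mulmxKV. Qed.

(** [C^-1 g C] is real exactly when it equals its conjugate; with [W = conj(C) C^-1] this reads
    [conj(g) W = W g]. *)
Lemma real_pointsP n (C W g : 'M[R[i]]_n) : C \in unitmx -> W \in unitmx ->
  conj_mx C = W *m C ->
  (exists A, conj_by C (complexify A) = g) <-> conj_mx g *m W = W *m g.
Proof.
move=> uC uW CW; split=> [[A <-]|h].
  apply: (can_inj (mulmxK uC)); rewrite -[LHS]mulmxA -[RHS]mulmxA conj_byP // -CW -conj_mxM.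
  by rewrite conj_byP // conj_mxM conj_complexify CW mulmxA.
pose X := invmx C *m g *m C; have CX : C *m X = g *m C by rewrite !mulmxA mulmxV ?mul1mx.
exists (Re_mx X); apply/conj_byE => //; apply: complexify_Re.
apply: (can_inj (mulKmx uC)); apply: (can_inj (mulKmx uW)).
by rewrite mulmxA -CW -conj_mxM CX conj_mxM CW !mulmxA h.
Qed.

Lemma sig_mx_sqr (F : pzRingType) p N : sig_mx F p N *m sig_mx F p N = 1%:M.
Proof.
rewrite /sig_mx mulmx_diag -diag_const_mx; congr diag_mx; apply/rowP => i.
by rewrite !mxE; case: ifP => _; rewrite ?mulrNN mulr1.
Qed.

Lemma sig_mx_tr (F : pzRingType) p N : (sig_mx F p N)^T = sig_mx F p N.
Proof. exact: tr_diag_mx. Qed.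

Lemma sig_mx_block (F : pzRingType) p q :
  sig_mx F p (p + q) = block_mx 1%:M 0 0 (- 1%:M).
Proof.
rewrite /sig_mx -[X in diag_mx X]hsubmxK diag_mx_row; congr block_mx.
- rewrite -diag_const_mx; congr diag_mx; apply/rowP => i.
  by rewrite !mxE /= ltn_ord.
- rewrite -diag_const_mx -raddfN; congr diag_mx; apply/rowP => i.
  by rewrite !mxE /= ltnNge leq_addr.
Qed.

End ComplexMatrices.

Section Groups.
Variables (R : realType).

Lemma O_C_unitary m (g : 'M[R[i]]_(m + m)) :
  O_C R (m + m) g <-> frame_unitary (m := m) 1 1%:M (re_im g).
Proof.
have gE : O_C R (m + m) g <-> g *m g^T = 1%:M by split=> /mulmx1C.
apply: iff_trans gE _; rewrite /frame_unitary !mulmx1 !scale1r.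
have e := re_imM g g^T; rewrite re_im_tr /= in e.
split=> [h|[h1 h2]]; first by move: e; rewrite h re_im1 => -[-> ->].
by apply: re_im_inj; rewrite e re_im1 h1 h2.
Qed.

(** Since [s^2 = 1], the hypothesis says that [s h s] is a left inverse of [g], hence a right
    inverse. This passes between the column and row conventions for the unitary equation. *)
Lemma unitary_mulC N (s g h : 'M[R[i]]_N) : s *m s = 1%:M ->
  h *m s *m g = s -> g *m s *m h = s.
Proof.
move=> s2 e; have /mulmx1C : (s *m (h *m s)) *m g = 1%:M by rewrite -mulmxA e.
move=> /(congr1 (mulmx^~ s)); rewrite mul1mx !mulmxA => {2}<-.
by rewrite -[RHS]mulmxA s2 mulmx1.
Qed.

Lemma U_pq_unitary m p (g : 'M[R[i]]_(m + m)) :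
  U_pq R p (m + m) g <-> frame_unitary (m := m) (-1) (sig_mx R p (m + m)) (re_im g).
Proof.
have s2 := sig_mx_sqr R[i] p (m + m).
have gE : U_pq R p (m + m) g <->
    g *m sig_mx R[i] p (m + m) *m (conj_mx g)^T = sig_mx R[i] p (m + m).
  by split; exact: unitary_mulC.
apply: iff_trans gE _; rewrite -complexify_sig /frame_unitary !scaleN1r.
move: (sig_mx R p (m + m)) => s.
have e := re_imM (g *m complexify s) (conj_mx g)^T.
rewrite re_im_tr (re_imM g (complexify s)) re_im_conj re_im_complexify !mulmx0 subr0 add0r in e.
rewrite /= in e *.
have trN : (- Im_mx g)^T = - (Im_mx g)^T by rewrite linearN.
rewrite trN !mulmxN opprK in e; rewrite opprK.
split=> [h|[h1 h2]].
  move: e; rewrite h re_im_complexify => -[e1 e2]; split; first by rewrite [RHS]e1.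
  by apply: oppr_inj; rewrite oppr0 opprB [RHS]e2 addrC.
apply: re_im_inj; rewrite e re_im_complexify h1; congr pair.
by apply: oppr_inj; rewrite oppr0 -[RHS]h2 opprD opprK.
Qed.

End Groups.

Lemma tr_opp_mx (V : zmodType) a b (A : 'M[V]_(a, b)) : (- A)^T = - A^T.
Proof. by apply/matrixP => i j; rewrite !mxE. Qed.

Section Frames.
Variables (R : realType) (m : nat).
Let n := (m + m)%N.

Lemma half2 : 2^-1 + 2^-1 = 1 :> R.
Proof. by rewrite -mulr2n -[_ *+ 2]mulr_natl mulfV // pnatr_eq0. Qed.

Lemma j_std_tr k : (j_std R k)^T = - j_std R k.
Proof.
by rewrite /j_std tr_block_mx tr_opp_mx !trmx0 trmx1 opp_block_mx !oppr0 opprK.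
Qed.

(* The rows form a basis of the complex vector space (TM + T*M, J_1) that is
   orthonormal for the complex bilinear form determined by b; odd_frame is the
   analogue for J_(-1) and the Hermitian form of signature (m, m). *)
Definition even_frame : 'M[R]_(n, n + n) := row_mx 1%:M (2^-1)%:M.

(** A basis vector plus half its dual covector has squared length [1/2 + 1/2], which is the origin
    of the constant in the frame. *)
Lemma even_frame_b : even_frame *m b_mx R n *m even_frame^T = 1%:M.
Proof.
rewrite /even_frame /b_mx mul_row_block tr_row_mx mul_row_col !mulmx0 !mulmx1 add0r addr0.
by rewrite trmx1 mulmx1 mul1mx tr_scalar_mx -raddfD /= half2.
Qed.

Lemma even_frame_Jb : even_frame *m J_ell m 1 *m b_mx R n *m even_frame^T = 0.
Proof.
rewrite /even_frame /b_mx /J_ell !mul_row_block tr_row_mx mul_row_col.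
rewrite !mulmx0 !mulmx1 !mul1mx !add0r !addr0 scale1r trmx1 mulmx1 tr_scalar_mx.
by rewrite mul_mx_scalar mul_scalar_mx j_std_tr scalerN addNr.
Qed.

Definition odd_frame : 'M[R]_(n, n + n) :=
  row_mx (block_mx 1%:M 0 1%:M 0) (block_mx (2^-1)%:M 0 (- (2^-1)%:M) 0).

(** Only the first [m] coordinate directions enter, since [J] supplies the others. Adding or
    subtracting half the dual covector gives squared lengths 1 and -1. *)
Lemma odd_frame_b : odd_frame *m b_mx R n *m odd_frame^T = sig_mx R m (m + m).
Proof.
rewrite /odd_frame /b_mx mul_row_block tr_row_mx mul_row_col !tr_block_mx !mulmx0 !mulmx1.
rewrite add0r addr0 !mulmx_block tr_opp_mx !tr_scalar_mx !trmx0.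
rewrite !(mulmx0, mul0mx, addr0, mul1mx, mulmx1, mulNmx) add_block_mx sig_mx_block.
by rewrite subrr addNr -opprD -raddfD /= half2.
Qed.

Lemma odd_frame_Jb : odd_frame *m J_ell m (-1) *m b_mx R n *m odd_frame^T = 0.
Proof.
rewrite /odd_frame /b_mx /J_ell j_std_tr scaleN1r opprK.
rewrite !mul_row_block tr_row_mx mul_row_col !tr_block_mx /j_std !(mulmx0, add0r, addr0, mulmx1) !mulmx_block.
rewrite tr_opp_mx !tr_scalar_mx !trmx0.
rewrite !(mulmx0, mul0mx, addr0, add0r, mul1mx, mulmx1, mulNmx, mulmxN, oppr0).
by rewrite add_block_mx !addr0 block_mx0.
Qed.

End Frames.

Lemma lambda_ell_pointwise (R : realType) (m : nat) (M : complexManifold R m)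
    (lam ell : R) (S : tensor_End M) : integrable_lambda_ell M lam ell S ->
  section_End S /\ forall i p, dom i p -> lambda_ell_op lam ell (S i p).
Proof. by case=> -[eS SA _] SJ; split=> // i p di; split; [exact: SA|exact: SJ]. Qed.

(** * The case of [O(2m, C)] and [O(n, 2m - n)] *)

Section OneOneCase.
Variables (R : realType) (m k : nat).
Let N := (m + m)%N.

(** In the frame [beta_mx] becomes two copies of [Q sig], which is why the signature has an even
    number of positive directions. *)
Lemma std_op_beta (sig Q : 'M[R]_N) (a : 'M[R]_(N, N + N)) :
  sig *m sig = 1%:M -> a *m b_mx R N *m a^T = sig -> a *m J_ell m 1 *m b_mx R N *m a^T = 0 ->
  frame_mx 1 a *m beta_mx (std_op 1 a 0 Q) *m (frame_mx 1 a)^T =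
    block_mx (Q *m sig) 0 0 (Q *m sig).
Proof.
move=> s2 aBa aJBa; have ell2 : 1 * 1 = 1 :> R by rewrite mulr1.
rewrite /beta_mx -(mulmxA (J_ell m 1)) (mulmxA (frame_mx _ _)) frame_J //.
rewrite -!(mulmxA (j_std R N)) (frame_conj_b ell2 s2 aBa aJBa) /j_std !mulmx_block.
rewrite !(mulmx0, mul0mx, addr0, add0r, mul1mx, mulNmx, oppr0).
by rewrite -scalemxAr scaleN1r opprK.
Qed.

Lemma std_op_signature : (k <= 2 * m)%N ->
  beta_signature k (std_op 1 (even_frame R m) 0 (sig_mx R k N)).
Proof.
move=> km; apply: (has_signature_congr (T := frame_mx 1 (even_frame R m))).
  exact: (frame_unit (mulr1 1) (mulmx1 _) (even_frame_b R m) (even_frame_Jb R m)).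
rewrite (std_op_beta _ (mulmx1 _) (even_frame_b R m) (even_frame_Jb R m)) mulmx1.
pose d : pred 'I_(N + N) := fun i => match fintype.split i with inl j | inr j => (j < k)%N end.
have -> : block_mx (sig_mx R k N) 0 0 (sig_mx R k N) = diag_mx (\row_i sg R (d i)).
  rewrite /sig_mx -[X in _ = diag_mx X]hsubmxK diag_mx_row.
  congr block_mx; congr diag_mx; apply/rowP => i; rewrite !mxE /d.
    by rewrite (unsplitK (inl i)).
  by rewrite (unsplitK (inr i)).
have cnt : (\sum_(i < N | i < k) 1 = k)%N.
  by rewrite -(big_ord_widen N (fun=> 1%N)) ?sum1_card ?card_ord // /N addnn -mul2n.
apply: has_signature_diag; last first.
  rewrite subnKC; first by rewrite /N !addnn -!mul2n mulnA.
  by rewrite -[4%N]/(2 * 2)%N -mulnA leq_mul2l.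
rewrite -sum1_card (eq_bigl d) // big_mkcond big_split_ord /= mul2n -addnn -[in RHS]cnt !(big_mkcond (fun i : 'I_N => (i < k)%N)).
by congr addn; apply: eq_bigr => i _; rewrite /d;
  [rewrite (unsplitK (inl i))|rewrite (unsplitK (inr i))].
Qed.

(** Here [K = i sig], and [C] is a square root of [sig] with [conj(C) = sig C]. So a [g] in the
    centralizer is [C A C^-1] with [A] real, and [g^T g = 1] becomes [A^T C^2 A = C^2], the equation
    of [O_pq]. *)
Lemma O_pq_in_O_C_centralizer (g : 'M[R[i]]_N) : O_C R N g ->
  (O_pq_in_O_C R k N g <-> conj_mx g *m cplx_mx (0, sig_mx R k N) = cplx_mx (0, sig_mx R k N) *m g).
Proof.
move=> Gg; pose C : 'M[R[i]]_N := diag_mx (\row_(i < N) (if (i < k)%N then 1 else 'i : R[i])).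
have CC : C *m C = sig_mx R[i] k N.
  rewrite mulmx_diag; congr diag_mx; apply/rowP => i; rewrite !mxE.
  by case: ifP => _; rewrite ?mulr1 // -expr2 sqrCi.
have s2 := sig_mx_sqr R[i] k N.
have uC : C \in unitmx by move: s2; rewrite -CC -!mulmxA => /mulmx1_unit[].
have us : sig_mx R[i] k N \in unitmx by case/mulmx1_unit: s2.
have CT : C^T = C by exact: tr_diag_mx.
have cC : conj_mx C = sig_mx R[i] k N *m C.
  apply/matrixP => i j; rewrite mul_diag_mx !mxE.
  case: (eqVneq i j) => _; last by rewrite !mulr0n mulr0 conjc0.
  rewrite !mulr1n; case: ifP => _; rewrite ?mul1r ?conjc1 ?mulN1r //.
  exact: conjCi.
have KE : cplx_mx (0, sig_mx R k N) = 'i *: sig_mx R[i] k N.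
  rewrite -complexify_sig; apply/matrixP => i j; rewrite !mxE.
  rewrite -complexiE; apply/eqP; rewrite eq_complex /=.
  by rewrite !(mul0r, mul1r, mulr0, subr0, add0r, oppr0) !eqxx.
rewrite KE -scalemxAr -scalemxAl.
have iI : injective (fun X : 'M[R[i]]_N => 'i *: X) by apply: scalerI; exact: neq0Ci.
have e : 'i *: (conj_mx g *m sig_mx R[i] k N) = 'i *: (sig_mx R[i] k N *m g) <->
    conj_mx g *m sig_mx R[i] k N = sig_mx R[i] k N *m g by split=> [/iI|->].
rewrite e -(real_pointsP g uC us cC); split=> [[A _ <-]|[A gA]]; first by exists A.
exists A => //; rewrite /O_pq /=; apply: complexify_inj.
rewrite !complexifyM complexify_tr complexify_sig -CC.
have CA : C *m complexify A = g *m C by rewrite -gA conj_byP.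
rewrite !mulmxA -{1}CT -trmx_mul -mulmxA CA trmx_mul CT.
have gg : g^T *m g = 1%:M by [].
rewrite !mulmxA -(mulmxA C g^T g) gg mulmx1; reflexivity.
Qed.

Lemma one_one_case (M : complexManifold R m) : (0 < m)%N -> (k <= 2 * m)%N ->
  sections_of_bundle (integrable_one_one M k) (one_one_op k)
    (O_C R (m + m)) (O_pq_in_O_C R k (m + m)).
Proof.
move=> m0 km; have ell2 : 1 * 1 = 1 :> R by rewrite mulr1.
have s2 : 1%:M *m 1%:M = 1%:M :> 'M[R]_N by rewrite mulmx1.
have PQ2 : (0 : 'M[R]_N) *m (0 : 'M[R]_N) + sig_mx R k N *m sig_mx R k N = 1%:M by rewrite mulmx0 add0r sig_mx_sqr.
have PQC : (0 : 'M[R]_N) *m sig_mx R k N = sig_mx R k N *m (0 : 'M[R]_N) by rewrite mulmx0 mul0mx.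
have Psig : (0 : 'M[R]_N) *m 1%:M = - (1%:M *m (0 : 'M[R]_N)^T) by rewrite trmx0 mulmx0 mul0mx oppr0.
have Qsig : sig_mx R k N *m 1%:M = 1 *: (1%:M *m (sig_mx R k N)^T).
  by rewrite mulmx1 mul1mx scale1r sig_mx_tr.
have aBa := even_frame_b R m; have aJBa := even_frame_Jb R m.
apply: (sections_of_model_bundle ell2 s2 (trmx1 _ _) aBa aJBa PQ2 PQC Psig Qsig).
- exact: oner_neq0.
- exact: O_C_unitary.
- exact: O_pq_in_O_C_centralizer.
- apply: one_one_op_orbit => //.
  + exact: (std_op_sqr ell2 s2 aBa aJBa PQ2 PQC).
  + exact: (std_op_b ell2 s2 aBa aJBa Psig Qsig).
  + exact: (std_op_J ell2 _ _ s2 aBa aJBa).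
  + exact: std_op_signature.
- move=> S [SI Sk]; have [eS SP] := lambda_ell_pointwise SI.
  by split=> // i p di; split; [exact: SP|exact: Sk].
Qed.

End OneOneCase.

(** * The case of [U(m, m)] and [Sp(m, R)] *)

Section MixedCase.
Variables (R : realType) (m : nat).
Let N := (m + m)%N.
Let W (F : pzRingType) : 'M[F]_N := block_mx 0 1%:M 1%:M 0.
Let sig := sig_mx R m N.

Let W2 (F : pzRingType) : W F *m W F = 1%:M.
Proof.
by rewrite /W mulmx_block !(mulmx0, mul0mx, addr0, add0r, mulmx1) -scalar_mx_block.
Qed.

Let Wsig : W R *m sig = - (sig *m (W R)^T).
Proof.
rewrite /sig sig_mx_block /W tr_block_mx !trmx0 !trmx1 !mulmx_block.
rewrite !(mulmx0, mul0mx, addr0, add0r, mulmx1, mul1mx, mulmxN, mulNmx).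
by rewrite opp_block_mx !oppr0 opprK.
Qed.

Lemma cplx_W : cplx_mx (W R, 0) = W R[i].
Proof. by rewrite complexifyE /complexify map_block_mx !map_mx0 !map_mx1. Qed.

(** The Cayley matrix satisfies [conj(C) = W C], so the centralizer consists of conjugates of real
    matrices, and [conj(C)^T sig C = 2 i Omega] turns the Hermitian equation into the symplectic
    one. *)
Lemma Sp_R_in_U_centralizer (g : 'M[R[i]]_N) : U_pq R m N g ->
  (Sp_R_in_U R m g <-> conj_mx g *m cplx_mx (W R, 0) = cplx_mx (W R, 0) *m g).
Proof.
move=> Gg; rewrite cplx_W.
pose C : 'M[R[i]]_N := block_mx 1%:M 'i%:M 1%:M (- 'i%:M).
have conj_i k : conj_mx ('i%:M : 'M[R[i]]_k) = - 'i%:M.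
  by rewrite /conj_mx map_scalar_mx -raddfN /=; congr _%:M; exact: conjCi.
have cC : conj_mx C = W R[i] *m C.
  rewrite /conj_mx /C map_block_mx map_mxN map_mx1 -/(conj_mx _) conj_i opprK.
  by rewrite /W mulmx_block !(mul0mx, addr0, add0r, mul1mx).
have i2 k : ('i%:M : 'M[R[i]]_k) *m 'i%:M = - 1%:M.
  by rewrite -scalar_mxM -expr2 sqrCi raddfN.
have two k : (1%:M + 1%:M : 'M[R[i]]_k) = 2%:M by rewrite -raddfD.
have uC : C \in unitmx.
  have : C *m (2^-1 *: block_mx 1%:M 1%:M (- 'i%:M) 'i%:M) = 1%:M.
    rewrite -scalemxAr /C mulmx_block !(mul1mx, mulmx1, mulNmx, mulmxN) i2 !opprK.
    by rewrite !subrr two -scalar_mx_block scale_scalar_mx mulVf // pnatr_eq0.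
  by case/mulmx1_unit.
have uW : W R[i] \in unitmx by case/mulmx1_unit: (W2 R[i]).
have CsC : (conj_mx C)^T *m sig_mx R[i] m N *m C = 'i *: (2%:R *: complexify (Omega R m)).
  have conjC : conj_mx C = block_mx 1%:M (- 'i%:M) 1%:M 'i%:M.
    by rewrite cC /C /W mulmx_block !(mul0mx, addr0, add0r, mul1mx).
  rewrite conjC tr_block_mx tr_opp_mx !tr_scalar_mx sig_mx_block /C !mulmx_block.
  rewrite !mulmx0 !addr0 !add0r !mulmx1 !mul1mx !mulmxN !mulmx1 !mulNmx !mul1mx i2 !opprK.
  rewrite !subrr /complexify /Omega map_block_mx map_mxN !map_mx0 map_mx1.
  rewrite !scale_block_mx !scaler0 !scalerN !scalemx1 scale_scalar_mx.
  by rewrite -opprD -raddfD /= -mulr2n mulr_natr.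
rewrite -(real_pointsP g uC uW cC); split=> [[A _ <-]|[A gA]]; first by exists A.
exists A => //; rewrite /Sp_R /=; apply: complexify_inj.
have CA : C *m complexify A = g *m C by rewrite -gA conj_byP.
have gg : (conj_mx g)^T *m sig_mx R[i] m N *m g = sig_mx R[i] m N by [].
have cI : injective (fun X : 'M[R[i]]_N => 'i *: (2%:R *: X)).
  by move=> X Y /(scalerI (neq0Ci _)); apply: scalerI; rewrite pnatr_eq0.
have h : (complexify A)^T *m ((conj_mx C)^T *m sig_mx R[i] m N *m C) *m complexify A =
    (conj_mx C)^T *m sig_mx R[i] m N *m C.
  rewrite -{1}(conj_complexify A) !mulmxA -trmx_mul -conj_mxM -(mulmxA _ C) CA.
  rewrite conj_mxM trmx_mul !mulmxA.
  by rewrite -[X in X *m C = _]mulmxA -[X in X *m C = _]mulmxA (mulmxA (conj_mx g)^T) gg.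
apply: cI; rewrite !complexifyM complexify_tr -CsC -h CsC.
by rewrite -!scalemxAr -!scalemxAl.
Qed.

Lemma mixed_para_case (M : complexManifold R m) : (0 < m)%N ->
  sections_of_bundle (integrable_lambda_ell M 1 (-1)) (lambda_ell_op 1 (-1))
    (U_pq R m (m + m)) (Sp_R_in_U R m).
Proof.
move=> m0; have ell2 : -1 * -1 = 1 :> R by rewrite mulrNN mulr1.
have s2 : sig *m sig = 1%:M by exact: sig_mx_sqr.
have sT : sig^T = sig by exact: sig_mx_tr.
have PQ2 : W R *m W R + (0 : 'M[R]_N) *m (0 : 'M[R]_N) = 1%:M by rewrite W2 mulmx0 addr0.
have PQC : W R *m (0 : 'M[R]_N) = (0 : 'M[R]_N) *m W R by rewrite mulmx0 mul0mx.
have Qsig : (0 : 'M[R]_N) *m sig = -1 *: (sig *m (0 : 'M[R]_N)^T).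
  by rewrite trmx0 mulmx0 mul0mx scaler0.
have aBa := odd_frame_b R m; have aJBa := odd_frame_Jb R m.
apply: (sections_of_model_bundle ell2 s2 sT aBa aJBa PQ2 PQC Wsig Qsig).
- exact: oner_neq0.
- exact: U_pq_unitary.
- exact: Sp_R_in_U_centralizer.
- have GG : symp_mx R *m symp_mx R = 1%:M.
    rewrite /symp_mx !mulmx_block !(mulmx0, mul0mx, addr0, add0r, mul1mx, mulmx1, mulNmx, mulmxN).
    by rewrite !opprK -!scalar_mx_block.
  have uG : symp_mx R \in unitmx by case/mulmx1_unit: GG.
  have GT : (symp_mx R)^T = symp_mx R.
    rewrite /symp_mx !tr_block_mx !tr_opp_mx !trmx0 !trmx1; reflexivity.
  have cells (S : 'M[R]_(N + N)) SS SB SJ := symplectic_has_cells (S := S) (b_mx_sym R m)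
    (J_ell_sqr m ell2) (J_ell_b m ell2) SS SB SJ erefl erefl.
  apply: (lambda_ell_op_orbit (c := 3) m0 ell2 _ uG GT cells).
  + by left.
  + exact: (std_op_sqr ell2 s2 aBa aJBa PQ2 PQC).
  + exact: (std_op_b ell2 s2 aBa aJBa Wsig Qsig).
  + exact: (std_op_J ell2 _ _ s2 aBa aJBa).
  + by left.
- by move=> S; exact: lambda_ell_pointwise.
Qed.

End MixedCase.

(** * The case of [O(2m, C)] and the quaternionic group [SO_star] *)

Section Quaternionic.
Variables (R : realType) (m : nat).
Let OmC : 'M[R[i]]_(m + m) := block_mx 0 1%:M (- 1%:M) 0.

Lemma Omega_sqr (F : pzRingType) :
  block_mx 0 1%:M (- 1%:M) 0 *m block_mx 0 1%:M (- 1%:M) 0 = - 1%:M :> 'M[F]_(m + m).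
Proof.
rewrite mulmx_block !mulmx0 !mul0mx !addr0 !add0r !mulmx1 mulmxN mulmx1.
by rewrite scalar_mx_block opp_block_mx !oppr0.
Qed.

Lemma complexify_Omega : complexify (Omega R m) = OmC.
Proof. by rewrite /complexify /Omega map_block_mx map_mxN !map_mx0 !map_mx1. Qed.

Lemma conj_block (A B C D : 'M[R[i]]_m) : conj_mx (block_mx A B C D) =
  block_mx (conj_mx A) (conj_mx B) (conj_mx C) (conj_mx D).
Proof. exact: map_block_mx. Qed.

Lemma conj_mxN n p (A : 'M[R[i]]_(n, p)) : conj_mx (- A) = - conj_mx A.
Proof. exact: map_mxN. Qed.

Lemma conj_mxD n p (A B : 'M[R[i]]_(n, p)) : conj_mx (A + B) = conj_mx A + conj_mx B.
Proof. exact: map_mxD. Qed.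

(** The right-hand side says that [g] commutes with the antilinear map [x |-> conj(x) Omega], which
    plays the role of a second quaternion unit. *)
Lemma quaternionic_pointsP (g : 'M[R[i]]_(m + m)) :
  (exists X, qmx_cplx X = g) <-> conj_mx g *m OmC = OmC *m g.
Proof.
have e (a b c d : 'M[R[i]]_m) : conj_mx (block_mx a b c d) *m OmC =
    block_mx (- conj_mx b) (conj_mx a) (- conj_mx d) (conj_mx c).
  by rewrite conj_block mulmx_block !mulmx0 !mulmx1 !mulmxN !mulmx1 !addr0 !add0r.
have e' (a b c d : 'M[R[i]]_m) : OmC *m block_mx a b c d = block_mx c d (- a) (- b).
  by rewrite mulmx_block !mul0mx !mul1mx !mulNmx !mul1mx !addr0 !add0r.
split=> [[X <-]|]; first by rewrite /qmx_cplx e e' conj_mxN !conj_mxK.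
rewrite -[g]submxK e e' => /eq_block_mx[ec ed _ _].
by exists (ulsubmx g, ursubmx g); rewrite /qmx_cplx /= ec ed.
Qed.

Lemma qmx_cplxM (X Y : qmx R m) : qmx_cplx (qmul X Y) = qmx_cplx X *m qmx_cplx Y.
Proof.
rewrite /qmx_cplx /qmul mulmx_block /= !conj_mxD conj_mxN !conj_mxM !conj_mxK.
congr block_mx; rewrite ?mulmxN ?mulNmx //.
- by rewrite opprD addrC.
- by rewrite addrC.
Qed.

Lemma qmx_cplx_adj (X : qmx R m) : qmx_cplx (qadj X) = (conj_mx (qmx_cplx X))^T.
Proof.
rewrite /qmx_cplx /qadj conj_block tr_block_mx /=.
by rewrite !conj_mxN !tr_opp_mx !conj_mx_tr !conj_mxK opprK.
Qed.

Lemma qmx_cplx_inj : injective (@qmx_cplx R m).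
Proof. by move=> [a b] [c d] /eq_block_mx[/= -> ->]. Qed.

Lemma qmx_cplx_form (F X : qmx R m) : qmul (qmul (qadj X) F) X = F <->
  (conj_mx (qmx_cplx X))^T *m qmx_cplx F *m qmx_cplx X = qmx_cplx F.
Proof.
rewrite -qmx_cplx_adj -!qmx_cplxM; split=> [->//|]; exact: qmx_cplx_inj.
Qed.

Lemma quat_diag_unit (a b : R) : a * a = 1 -> b * b = 1 -> quat_diag a b \in unitmx.
Proof.
move=> a2 b2; have : quat_diag a b *m quat_diag a b = 1%:M.
  rewrite /quat_diag !mulmx_block !(mulmx0, mul0mx, addr0, add0r).
  by rewrite -!scalar_mxM a2 b2 -!scalar_mx_block.
by case/mulmx1_unit.
Qed.

Lemma quat_diag_tr (a b : R) : (quat_diag a b)^T = quat_diag a b.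
Proof. by rewrite /quat_diag !tr_block_mx !trmx0 !tr_scalar_mx. Qed.

Lemma SO_star_centralizer (g : 'M[R[i]]_(m + m)) : O_C R (m + m) g ->
  (SO_star_in_O_C R m g <->
   conj_mx g *m cplx_mx (Omega R m, 0) = cplx_mx (Omega R m, 0) *m g).
Proof.
move=> Gg; have gg : g^T *m g = 1%:M by []; rewrite complexifyE complexify_Omega.
rewrite -quaternionic_pointsP; split=> [[X _ <-]|[X Xg]]; first by exists X.
exists X => //; apply/qmx_cplx_form.
have gO : conj_mx g *m OmC = OmC *m g by apply/quaternionic_pointsP; exists X.
have -> : qmx_cplx (0 : 'M[R[i]]_m, 1%:M) = OmC.
  by rewrite /qmx_cplx /= conj_mx1 /conj_mx map_mx0.
have OT : OmC^T = - OmC.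
  by rewrite /OmC tr_block_mx tr_opp_mx !trmx0 trmx1 opp_block_mx !oppr0 opprK.
have h : (conj_mx g)^T *m OmC = OmC *m g^T.
  apply: trmx_inj; rewrite !trmx_mul !trmxK OT mulmxN mulNmx; congr (- _).
  have O2 : OmC *m OmC = - 1%:M by exact: Omega_sqr.
  have := congr1 (fun A => OmC *m A *m OmC) gO.
  rewrite -!mulmxA O2 mulmxN mulmx1 mulmxA.
  by rewrite O2 mulNmx mul1mx mulmxN => /oppr_inj ->.
by rewrite Xg h -mulmxA gg mulmx1.
Qed.

Lemma orthogonal_case (M : complexManifold R m) : (0 < m)%N ->
  sections_of_bundle (integrable_lambda_ell M (-1) 1) (lambda_ell_op (-1) 1)
    (O_C R (m + m)) (SO_star_in_O_C R m).
Proof.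
move=> m0; have ell2 : 1 * 1 = 1 :> R by rewrite mulr1.
pose N := (m + m)%N; pose P := Omega R m.
have s2 : 1%:M *m 1%:M = 1%:M :> 'M[R]_N by rewrite mulmx1.
have P2 : P *m P = - 1%:M by exact: Omega_sqr.
have PQ2 : P *m P + (0 : 'M[R]_N) *m (0 : 'M[R]_N) = (-1)%:M.
  by rewrite P2 mulmx0 addr0 raddfN.
have PQC : P *m (0 : 'M[R]_N) = (0 : 'M[R]_N) *m P by rewrite mulmx0 mul0mx.
have Psig : P *m 1%:M = - (1%:M *m P^T).
  rewrite mulmx1 mul1mx /P /Omega tr_block_mx tr_opp_mx !trmx0 trmx1 opp_block_mx.
  by rewrite !oppr0 opprK.
have Qsig : (0 : 'M[R]_N) *m 1%:M = 1 *: (1%:M *m (0 : 'M[R]_N)^T).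
  by rewrite trmx0 mulmx0 mul0mx scaler0.
have aBa := even_frame_b R m; have aJBa := even_frame_Jb R m.
apply: (sections_of_model_bundle ell2 s2 (trmx1 _ _) aBa aJBa PQ2 PQC Psig Qsig).
- by rewrite oppr_eq0 oner_neq0.
- exact: O_C_unitary.
- exact: SO_star_centralizer.
- have uG : quat_diag (1 : R) (-1) \in unitmx by apply: quat_diag_unit; rewrite ?mulrNN mulr1.
  have cells (S : 'M[R]_(N + N)) SS SB SJ := skew_hermitian_has_cells (S := S)
    (b_mx_sym R m) (J_ell_sqr m ell2) (J_ell_b m ell2) SS SB SJ erefl erefl.
  apply: (lambda_ell_op_orbit (c := 3) m0 ell2 _ uG (quat_diag_tr _ _) cells).
  + by right.
  + exact: (std_op_sqr ell2 s2 aBa aJBa PQ2 PQC).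
  + exact: (std_op_b ell2 s2 aBa aJBa Psig Qsig).
  + exact: (std_op_J ell2 _ _ s2 aBa aJBa).
  + by left.
- by move=> S; exact: lambda_ell_pointwise.
Qed.

End Quaternionic.

(** * The case of [U(2k, 2k)] and [Sp(k, k)] *)

Section SplitHermitianCase.
Variables (R : realType) (k : nat).
Let m := (k + k)%N.
Let N := (m + m)%N.

Definition middle_swap (F : pzRingType) : 'M[F]_N :=
  block_mx (block_mx 1%:M 0 0 0) (block_mx 0 0 1%:M 0)
           (block_mx 0 1%:M 0 0) (block_mx 0 0 0 1%:M).

Lemma middle_swap_sqr (F : pzRingType) : middle_swap F *m middle_swap F = 1%:M.
Proof.
rewrite /middle_swap !mulmx_block !mulmx0 !mul0mx !mulmx1 !add_block_mx !addr0 !add0r.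
by rewrite -!scalar_mx_block block_mx0 -scalar_mx_block.
Qed.

Lemma middle_swap_tr (F : pzRingType) : (middle_swap F)^T = middle_swap F.
Proof. by rewrite /middle_swap !tr_block_mx !trmx0 !trmx1. Qed.

Lemma complexify_middle_swap : complexify (middle_swap R) = middle_swap R[i].
Proof. by rewrite /complexify /middle_swap !map_block_mx !map_mx0 !map_mx1. Qed.

Lemma middle_swap_sig (F : pzRingType) : sig_mx F m N *m middle_swap F =
  middle_swap F *m block_mx (sig_mx F k m) 0 0 (sig_mx F k m).
Proof.
rewrite !sig_mx_block /middle_swap !mulmx_block.
rewrite !(mulmx0, mul0mx, mulmxN, mulmx1, mulNmx, mul1mx, addr0, add0r).
by rewrite !opp_block_mx !oppr0.
Qed.

Let C := middle_swap R.
(** The quaternionic structure [Omega] moved to the basis in which the Hermitian form is diagonal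
    with its positive part first. *)
Let P := C *m Omega R m *m C.
Let sig := sig_mx R m N.
Let C2 : C *m C = 1%:M := middle_swap_sqr R.

Lemma middle_Omega_sqr : P *m P = - 1%:M.
Proof.
rewrite /P -!mulmxA (mulmxA C C) C2 mul1mx (mulmxA (Omega R m)) Omega_sqr.
by rewrite mulNmx mul1mx mulmxN C2.
Qed.

Lemma middle_Omega_sig : P *m sig = - (sig *m P^T).
Proof.
pose D : 'M[R]_N := block_mx (sig_mx R k m) 0 0 (sig_mx R k m).
have sC : sig *m C = C *m D by exact: middle_swap_sig.
have Cs : C *m sig = D *m C.
  by rewrite -[C *m sig]mulmx1 -C2 -!mulmxA (mulmxA sig) sC !mulmxA C2 mul1mx.
have OT : (Omega R m)^T = - Omega R m.
  by rewrite /Omega tr_block_mx tr_opp_mx !trmx0 trmx1 opp_block_mx !oppr0 opprK.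
have OD : Omega R m *m D = D *m Omega R m.
  rewrite /Omega /D !mulmx_block !mulmx0 !mul0mx !mulNmx !mulmxN !mulmx1 !mul1mx.
  by rewrite !addr0 !add0r.
rewrite /P !trmx_mul middle_swap_tr OT mulNmx !mulmxN opprK !mulmxA sC.
by rewrite -!mulmxA Cs !mulmxA -(mulmxA C) OD !mulmxA.
Qed.

(** With [h = c g c], the centralizer condition on [g] means that [h] is quaternionic, and
    [sig_mx m] becomes the diagonal form of [Sp_kk], so the two group equations correspond. *)
Lemma Sp_kk_centralizer (g : 'M[R[i]]_N) : U_pq R m N g ->
  (Sp_kk_in_U R k g <-> conj_mx g *m cplx_mx (P, 0) = cplx_mx (P, 0) *m g).
Proof.
move=> Gg; rewrite complexifyE /P !complexifyM complexify_middle_swap complexify_Omega.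
have gg : (conj_mx g)^T *m sig_mx R[i] m N *m g = sig_mx R[i] m N by [].
pose c := middle_swap R[i]; have c2 : c *m c = 1%:M := middle_swap_sqr R[i].
have uc : c \in unitmx by case/mulmx1_unit: c2.
have cV : invmx c = c by rewrite -[RHS](mulKmx uc) c2 mulmx1.
have cc : conj_mx c = c by rewrite /c -complexify_middle_swap conj_complexify.
have cT : c^T = c := middle_swap_tr R[i].
have cb Y : conj_by c Y = c *m Y *m c by rewrite /conj_by cV.
rewrite -/c; set Om := block_mx 0 _ _ _.
pose h := c *m g *m c.
have gh : g = c *m h *m c by rewrite /h !mulmxA c2 mul1mx -mulmxA c2 mulmx1.
have hP : (exists X, qmx_cplx X = h) <-> conj_mx g *m (c *m Om *m c) = c *m Om *m c *m g.
  apply: iff_trans (quaternionic_pointsP h) _; rewrite -/Om.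
  have -> : conj_mx h = c *m conj_mx g *m c by rewrite /h !conj_mxM cc.
  have cI : injective (fun A : 'M[R[i]]_N => c *m A *m c).
    by move=> A A' /(can_inj (mulmxK uc))/(can_inj (mulKmx uc)).
  have -> : (conj_mx g *m (c *m Om *m c) = c *m Om *m c *m g) =
      (c *m (c *m conj_mx g *m c *m Om) *m c = c *m (Om *m h) *m c).
    by rewrite /h !mulmxA c2 mul1mx -(mulmxA _ c c) c2 mulmx1.
  split=> [e|/cI e]; [rewrite e; reflexivity|exact: e].
rewrite -hP; split=> [[X _ e]|[X Xh]].
  by exists X; rewrite /h -e [conj_by _ _]cb !mulmxA c2 mul1mx -mulmxA c2 mulmx1.
exists X; last by rewrite [LHS]cb Xh [RHS]gh.
apply/qmx_cplx_form; rewrite Xh.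
have -> : qmx_cplx (sig_mx R[i] k m, 0) = c *m sig_mx R[i] m N *m c.
  rewrite -mulmxA middle_swap_sig mulmxA c2 mul1mx /qmx_cplx /=.
  by rewrite -complexify_sig conj_complexify /conj_mx map_mx0 oppr0.
have -> : (conj_mx h)^T = c *m (conj_mx g)^T *m c.
  by rewrite /h !conj_mxM cc !trmx_mul cT mulmxA.
rewrite /h !mulmxA -(mulmxA _ c c) c2 mulmx1 -(mulmxA _ c c) c2 mulmx1.
by rewrite -[in RHS]gg !mulmxA.
Qed.

Lemma split_hermitian_case (M : complexManifold R m) : (0 < m)%N ->
  sections_of_bundle (integrable_lambda_ell M (-1) (-1)) (lambda_ell_op (-1) (-1))
    (U_pq R m N) (Sp_kk_in_U R k).
Proof.
move=> m0; have ell2 : -1 * -1 = 1 :> R by rewrite mulrNN mulr1.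
have s2 : sig *m sig = 1%:M by exact: sig_mx_sqr.
have sT : sig^T = sig by exact: sig_mx_tr.
have PQ2 : P *m P + (0 : 'M[R]_N) *m (0 : 'M[R]_N) = (-1)%:M.
  by rewrite middle_Omega_sqr mulmx0 addr0 raddfN.
have PQC : P *m (0 : 'M[R]_N) = (0 : 'M[R]_N) *m P by rewrite mulmx0 mul0mx.
have Qsig : (0 : 'M[R]_N) *m sig = -1 *: (sig *m (0 : 'M[R]_N)^T).
  by rewrite trmx0 mulmx0 mul0mx scaler0.
have aBa := odd_frame_b R m; have aJBa := odd_frame_Jb R m.
apply: (sections_of_model_bundle ell2 s2 sT aBa aJBa PQ2 PQC middle_Omega_sig Qsig).
- by rewrite oppr_eq0 oner_neq0.
- exact: U_pq_unitary.
- exact: Sp_kk_centralizer.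
- have cells (S : 'M[R]_(N + N)) SS SB SJ := hermitian_has_cells (S := S)
    (b_mx_sym R m) (J_ell_sqr m ell2) (J_ell_b m ell2) SS SB SJ erefl erefl.
  apply: (lambda_ell_op_orbit (c := 3) m0 ell2 _ (unitmx1 _ _) (trmx1 _ _) cells).
  + by right.
  + exact: (std_op_sqr ell2 s2 aBa aJBa PQ2 PQC).
  + exact: (std_op_b ell2 s2 aBa aJBa middle_Omega_sig Qsig).
  + exact: (std_op_J ell2 _ _ s2 aBa aJBa).
  + by right.
- by move=> S; exact: lambda_ell_pointwise.
Qed.

End SplitHermitianCase.

Theorem theorem3p9 (R : realType) (m : nat) (M : complexManifold R m)
    (hm : (0 < m)%N) :
  [/\ forall n : nat, (n <= 2 * m)%N ->
        sections_of_bundle (integrable_one_one M n) (one_one_op n)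
          (O_C R (m + m)) (O_pq_in_O_C R n (m + m)),
      sections_of_bundle (integrable_lambda_ell M 1 (-1)) (lambda_ell_op 1 (-1))
        (U_pq R m (m + m)) (Sp_R_in_U R m),
      sections_of_bundle (integrable_lambda_ell M (-1) 1) (lambda_ell_op (-1) 1)
        (O_C R (m + m)) (SO_star_in_O_C R m) &
      forall k : nat, m = (2 * k)%N ->
        sections_of_bundle (integrable_lambda_ell M (-1) (-1))
          (lambda_ell_op (-1) (-1))
          (U_pq R (k + k) ((k + k) + (k + k))) (Sp_kk_in_U R k)].
Proof.
split.
- by move=> n nm; exact: one_one_case.
- exact: mixed_para_case.
- exact: orthogonal_case.
- by move=> k; rewrite mul2n -addnn => mk; subst m; exact: split_hermitian_case.
Qed.
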